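(* If $M$ is a proper biharmonic space-like surface in the three-dimensional anti de Sitter space $H^3_1(1)$, then $M$ is the hyperbolic plane $H^2\left(\tfrac{1}{\sqrt 2}\right)$ naturally embedded in $H^3_1(1)$.
   Context: Let $R^4_2$ be $\mathbb{R}^4$ with the indefinite scalar product given by $\langle x,x\rangle = x_1^2+x_2^2-x_3^2-x_4^2$. The anti de Sitter space is $H^3_1(1)=\{x\in R^4_2 : \langle x,x\rangle=-1\}$ with the induced metric; it has index $1$ and constant sectional curvature $-1$. For $r>0$, $H^2(r)$ is the connected component through $(0,0,r)$ of $\{x\in\mathbb{R}^3 : x_1^2+x_2^2-x_3^2=-r^2\}$, with the (Riemannian) metric induced from the form $x_1^2+x_2^2-x_3^2$. For $|s|<1$, fixing $x_4=s$ in $H^3_1(1)$ gives the natural embedding of $H^2(\sqrt{1-s^2})$ into $H^3_1(1)$, $y\mapsto (y,s)$; for $s=\tfrac1{\sqrt2}$ this is the natural embedding of $H^2(\tfrac1{\sqrt2})$. A space-like surface in a pseudo-Riemannian 3-manifold $N$ of index $1$ is a 2-dimensional immersed submanifold $\phi:M\to N$ on which the induced metric is positive definite. The tension field is $\tau(\phi)=\mathrm{trace}\,\nabla d\phi$. The second tension field is $\tau_2(\phi)=-\Delta^\phi\tau(\phi)-\mathrm{trace}\,R^N(d\phi,\tau(\phi))d\phi$, where $R^N(X,Y)Z=\nabla_X\nabla_YZ-\nabla_Y\nabla_XZ-\nabla_{[X,Y]}Z$ and $\Delta^\phi=-\mathrm{trace}(\nabla^\phi\nabla^\phi-\nabla^\phi_{\nabla})$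 is the (rough) Laplacian on sections of $\phi^{-1}TN$. The surface is biharmonic if its isometric immersion $\phi$ satisfies $\tau_2(\phi)=0$, and proper biharmonic if moreover $\phi$ is not harmonic, i.e. $\tau(\phi)\not\equiv 0$.
   Formalization: M is assumed connected, and ''is'' is read up to an isometry of H^3_1(1): M lies in H^2(1/√2), and is all of it when M is complete; an open piece, a translate or a disjoint union of copies is also proper biharmonic, so the literal claim fails. *)

(* Defs.v *)
From HB Require Import structures.
From mathcomp Require Import all_boot all_order all_algebra.
From mathcomp Require Import all_classical all_reals all_analysis.

Set Implicit Arguments.
Unset Strict Implicit.
Unset Printing Implicit Defensive.

Import Order.TTheory GRing.Theory Num.Theory numFieldNormedType.Exports.
Local Open Scope classical_set_scope.
Local Open Scope ring_scope.

(* The form x_0 y_0 + x_1 y_1 - x_2 y_2 - ... on R^n: for n = 4 the scalar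
   product of R^4_2, for n = 3 the Lorentzian form of R^3. *)
Definition form (R : realType) (n : nat) (x y : 'rV[R]_n) : R :=
  \sum_(i < n) (if (i < 2)%N then x 0 i * y 0 i else - (x 0 i * y 0 i)).

(* The anti de Sitter space H^3_1(1). *)
Definition AdS (R : realType) : set 'rV[R]_4 := [set x | form x x = -1].

(* H^2(r). *)
Definition H2 (R : realType) (r : R) : set 'rV[R]_3 :=
  connected_component [set x | form x x = - r ^+ 2]
    (\row_(i < 3) (if i == ord_max then r else 0)).

(* The natural embedding y |-> (y, s) of R^3 in R^4, and the image of
   H^2(sqrt (1 - s^2)) under it. *)
Definition append (R : realType) (s : R) (y : 'rV[R]_3) : 'rV[R]_4 :=
  (row_mx y (const_mx s) : 'rV[R]_(3 + 1)).

Definition natural_H2 (R : realType) (s : R) : set 'rV[R]_4 :=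
  append s @` H2 (Num.sqrt (1 - s ^+ 2)).

(* The linear isometries of R^4_2, acting on row vectors by x |-> x A; they
   restrict to isometries of H^3_1(1). *)
Definition linear_isometry (R : realType) (A : 'M[R]_4) : Prop :=
  forall x y : 'rV[R]_4, form (x *m A) (y *m A) = form x y.

(* Class C^k on an open set U, for V and W finite-dimensional. *)
Fixpoint class_C (R : realType) (V W : normedModType R) (k : nat) (U : set V)
    (f : V -> W) : Prop :=
  match k with
  | 0 => forall x, U x -> {for x, continuous f}
  | k'.+1 => (forall x, U x -> differentiable f x) /\
             (forall v, class_C k' U ('D_v f))
  end.

Definition smooth (R : realType) (V W : normedModType R) (U : set V)
  (f : V -> W) : Prop := forall k, class_C k U f.

(* A smooth atlas of dimension 2; [param a] is the inverse of [chart a], and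
   both are meaningful only on [cdom a] and [ccod a]. *)
Record atlas (R : realType) (M : topologicalType) := Atlas {
  cindex : Type;
  cdom : cindex -> set M;
  ccod : cindex -> set 'rV[R]_2;
  chart : cindex -> M -> 'rV[R]_2;
  param : cindex -> 'rV[R]_2 -> M;
  open_cdom : forall a, open (cdom a);
  open_ccod : forall a, open (ccod a);
  cdom_cover : forall p, exists a, cdom a p;
  chart_ccod : forall a p, cdom a p -> ccod a (chart a p);
  param_cdom : forall a x, ccod a x -> cdom a (param a x);
  chartK : forall a p, cdom a p -> param a (chart a p) = p;
  paramK : forall a x, ccod a x -> chart a (param a x) = x;
  chart_continuous : forall a p, cdom a p -> {for p, continuous (chart a)};
  param_continuous : forall a x, ccod a x -> {for x, continuous (param a)};
  transition_smooth : forall a b,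
    smooth (ccod a `&` param a @^-1` cdom b) (chart b \o param a)
}.

(* Covariant differentiation on H^3_1(1).  Since <x,x> = -1 on H^3_1(1), the
   orthogonal projection of R^4_2 onto the tangent space x^perp is
   w |-> w + <w,x> x, and the Levi-Civita connection is the tangential part of
   the flat derivative.  Vector fields are maps R^4 -> R^4 that are tangent
   along H^3_1(1). *)
Definition tproj (R : realType) (x w : 'rV[R]_4) : 'rV[R]_4 :=
  w + form w x *: x.

Definition nabla (R : realType) (X Y : 'rV[R]_4 -> 'rV[R]_4)
    (x : 'rV[R]_4) : 'rV[R]_4 :=
  tproj x ('D_(X x) Y x).

Definition lie_bracket (R : realType) (X Y : 'rV[R]_4 -> 'rV[R]_4)
    (x : 'rV[R]_4) : 'rV[R]_4 :=
  'D_(X x) Y x - 'D_(Y x) X x.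

Definition curvature_op (R : realType) (X Y Z : 'rV[R]_4 -> 'rV[R]_4)
    (x : 'rV[R]_4) : 'rV[R]_4 :=
  nabla X (nabla Y Z) x - nabla Y (nabla X Z) x
  - nabla (lie_bracket X Y) Z x.

(* R^N(u,v)w at p in H^3_1(1), for u, v, w tangent at p.  By tensoriality any
   tangent extensions may be used; the field x |-> w + <w,x> x takes the value
   w at p. *)
Definition RN (R : realType) (p u v w : 'rV[R]_4) : 'rV[R]_4 :=
  curvature_op (fun x => tproj x u) (fun x => tproj x v)
    (fun x => tproj x w) p.

(* Geometry of an immersion F of an open subset of R^2 in H^3_1(1), for the
   induced metric and the coordinate fields d_0, d_1 of R^2. *)
Definition pd (R : realType) (W : normedModType R) (k : 'I_2)
    (f : 'rV[R]_2 -> W) : 'rV[R]_2 -> W :=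
  'D_(delta_mx 0 k) f.

Definition metric (R : realType) (F : 'rV[R]_2 -> 'rV[R]_4)
    (x : 'rV[R]_2) : 'M[R]_2 :=
  \matrix_(k, l) form (pd k F x) (pd l F x).

Definition christoffel (R : realType) (F : 'rV[R]_2 -> 'rV[R]_4)
    (m k l : 'I_2) (x : 'rV[R]_2) : R :=
  2^-1 * \sum_n invmx (metric F x) m n *
    (pd k (fun y => metric F y n l : R) x
     + pd l (fun y => metric F y n k : R) x
     - pd n (fun y => metric F y k l : R) x).

(* The pull-back connection nabla^F_{d_k} on sections of F^{-1} TN. *)
Definition pnabla (R : realType) (F V : 'rV[R]_2 -> 'rV[R]_4)
    (k : 'I_2) (x : 'rV[R]_2) : 'rV[R]_4 :=
  tproj (F x) (pd k V x).

(* trace nabla dF, where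
   (nabla dF)(d_k, d_l) = nabla^F_{d_k} (dF d_l) - dF (nabla_{d_k} d_l). *)
Definition tension (R : realType) (F : 'rV[R]_2 -> 'rV[R]_4)
    (x : 'rV[R]_2) : 'rV[R]_4 :=
  \sum_k \sum_l invmx (metric F x) k l *:
    (pnabla F (pd l F) k x - \sum_m christoffel F m k l x *: pd m F x).

(* Delta^F = - trace (nabla^F nabla^F - nabla^F_nabla). *)
Definition rough_laplacian (R : realType) (F V : 'rV[R]_2 -> 'rV[R]_4)
    (x : 'rV[R]_2) : 'rV[R]_4 :=
  - \sum_k \sum_l invmx (metric F x) k l *:
    (pnabla F (pnabla F V l) k x
     - \sum_m christoffel F m k l x *: pnabla F V m x).

Definition bitension (R : realType) (F : 'rV[R]_2 -> 'rV[R]_4)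
    (x : 'rV[R]_2) : 'rV[R]_4 :=
  - rough_laplacian F (tension F) x
  - \sum_k \sum_l invmx (metric F x) k l *:
      RN (F x) (pd k F x) (tension F x) (pd l F x).

(* The tension fields of phi : M -> H^3_1(1) are independent of the chart in
   which they are computed. *)
Definition harmonic (R : realType) (M : topologicalType) (S : atlas R M)
    (phi : M -> 'rV[R]_4) : Prop :=
  forall (a : cindex S) x, ccod a x -> tension (phi \o param a) x = 0.

Definition biharmonic (R : realType) (M : topologicalType) (S : atlas R M)
    (phi : M -> 'rV[R]_4) : Prop :=
  forall (a : cindex S) x, ccod a x -> bitension (phi \o param a) x = 0.

Definition proper_biharmonic (R : realType) (M : topologicalType)
    (S : atlas R M) (phi : M -> 'rV[R]_4) : Prop :=
  biharmonic S phi /\ ~ harmonic S phi.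

Definition immersion_in_AdS (R : realType) (M : topologicalType)
    (S : atlas R M) (phi : M -> 'rV[R]_4) : Prop :=
  [/\ forall p, AdS (phi p),
      forall a : cindex S, smooth (ccod a) (phi \o param a)
    & forall (a : cindex S) x, ccod a x ->
        injective (fun v => 'D_v (phi \o param a) x)].

(* The induced metric is positive definite. *)
Definition spacelike (R : realType) (M : topologicalType)
    (S : atlas R M) (phi : M -> 'rV[R]_4) : Prop :=
  forall (a : cindex S) x v, ccod a x -> v != 0 ->
    0 < form ('D_v (phi \o param a) x) ('D_v (phi \o param a) x).

(* Completeness of M for the induced metric: a C^1 curve on ]0, 1[ of bounded
   speed converges at 1.  For a connected Riemannian manifold this is
   completeness: such a curve is Lipschitz for the Riemannian distance, and
   conversely the condition lets every geodesic be extended.  The velocity of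
   gamma has the same norm as that of phi o gamma. *)
Definition complete_surface (R : realType) (M : topologicalType)
    (S : atlas R M) (phi : M -> 'rV[R]_4) : Prop :=
  forall (gamma : R -> M) (L : R),
    (forall t, 0 < t < 1 -> {for t, continuous gamma}) ->
    (forall a : cindex S,
       class_C 1 (`]0, 1[ `&` gamma @^-1` cdom a) (chart a \o gamma)) ->
    (forall t, 0 < t < 1 ->
       form (derive1 (phi \o gamma) t) (derive1 (phi \o gamma) t) <= L) ->
    exists p : M, gamma t @[t --> 1^'-] --> p.

(* Main.v *)
(* Let h be the second fundamental form with respect to a unit normal xi and f
   its trace, so that the tension field is f xi.  The normal part of the
   biharmonic equation is Delta f + |h|^2 f = 2 f and the tangential part is
   2 h(grad f) + f grad f = 0.  Where f and grad f do not vanish, the Codazzi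
   and Gauss equations turn these into 45 f^2 + 28 = 0, so f is locally
   constant.  Where f is a nonzero constant, |h|^2 = 2, and a rotation argument
   for the traceless part of h excludes f^2 <> 4; hence the surface is umbilic
   and w = F - (f/2) xi is a constant vector with <w, w> = -2 and <F, w> = -1.
   The vector w is determined by the germ of F, hence is the same on all of the
   connected surface, and an isometry that takes w to a multiple of the fourth
   basis vector puts the surface in the hyperplane x_4 = 1 / sqrt 2.  The
   projection to the first two coordinates is then a local diffeomorphism to
   R^2 which does not decrease lengths, so that by completeness segments can be
   lifted and the projection is bijective. *)
Require Import Defs.
From HB Require Import structures.
From mathcomp Require Import all_boot all_order all_algebra.
From mathcomp Require Import all_classical all_reals all_analysis.
From mathcomp Require Import ring lra.
Import Defs.

Set Implicit Arguments.
Unset Strict Implicit.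
Unset Printing Implicit Defensive.

Import Order.TTheory GRing.Theory Num.Theory numFieldNormedType.Exports.
Local Open Scope classical_set_scope.
Local Open Scope ring_scope.

(** * Moving frames over a ring with derivations *)

(** The local part is algebra in a commutative ring with two commuting derivations: there every
    geometric equation is an identity for [ring], and no order of differentiability has to be
    tracked. The price is the absence of division, square roots and order. Nonvanishing becomes
    [regular], inverses and roots enter as elements satisfying an equation, and positivity is used
    only once the ring is taken to be the smooth functions on an open set. The frame is adapted to
    f: e2 runs along the level lines. The tangential equation then makes grad f an eigenvector of h
    with eigenvalue -f/2, so h = diag(-f/2, 3f/2), and what remains is an ordinary differential
    system along the gradient lines for f and the geodesic curvature q of the level lines. It yields
    two quadratic relations between f and q; eliminating q^2 gives 45 f^2 + 28 = 0, impossible over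
    the reals. Both xi and the sign of f exist only locally. Facts are therefore carried from one
    open set to another by the scalar <tau, tau> = -f^2 and by the vector w, both expressed through
    the map alone. *)

Section BilinearForm.
Variables (A : comNzRingType) (n : nat).
Implicit Types x y z : 'rV[A]_n.

Definition bform x y : A :=
  \sum_(i < n) (if (i < 2)%N then x 0 i * y 0 i else - (x 0 i * y 0 i)).

Lemma bformC x y : bform x y = bform y x.
Proof. by apply: eq_bigr => i _; case: ifP => _; rewrite mulrC. Qed.

Lemma bformDl x y z : bform (x + y) z = bform x z + bform y z.
Proof.
rewrite -big_split; apply: eq_bigr => i _ /=; rewrite mxE.
by case: ifP => _; rewrite mulrDl ?opprD.
Qed.

Lemma bformZl a x y : bform (a *: x) y = a * bform x y.
Proof.
rewrite big_distrr; apply: eq_bigr => i _ /=; rewrite mxE.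
by case: ifP => _; rewrite ?mulrN mulrA.
Qed.

Lemma bformNl x y : bform (- x) y = - bform x y.
Proof. by rewrite -scaleN1r bformZl mulN1r. Qed.

Lemma bform0l y : bform 0 y = 0.
Proof. by rewrite -(scale0r 0) bformZl mul0r. Qed.

Lemma bformDr x y z : bform z (x + y) = bform z x + bform z y.
Proof. by rewrite bformC bformDl !(bformC z). Qed.

Lemma bformZr a x y : bform x (a *: y) = a * bform x y.
Proof. by rewrite bformC bformZl bformC. Qed.

Lemma bformNr x y : bform x (- y) = - bform x y.
Proof. by rewrite bformC bformNl bformC. Qed.

Lemma bform0r y : bform y 0 = 0.
Proof. by rewrite bformC bform0l. Qed.

Definition bformE :=
  (bformDl, bformDr, bformZl, bformZr, bformNl, bformNr, bform0l, bform0r).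

End BilinearForm.

Lemma bform4 (A : comNzRingType) (x y : 'rV[A]_4) :
  bform x y = x 0 0 * y 0 0 + x 0 1 * y 0 1 - x 0 2%:R * y 0 2%:R
              - x 0 3%:R * y 0 3%:R.
Proof.
rewrite /bform !big_ord_recl big_ord0 /= addr0 !addrA.
by do !congr (_ + _); do ?congr (- _); congr (x 0 _ * y 0 _); apply/val_inj.
Qed.

(* A family orthonormal for the form is a basis, hence v is determined by its
   products: E J E^T = J gives E^T J E = J. *)
Lemma orthonormal_expand (A : comNzRingType) (e1 e2 xi F : 'rV[A]_4) :
  bform e1 e1 = 1 -> bform e2 e2 = 1 -> bform xi xi = -1 -> bform F F = -1 ->
  bform e1 e2 = 0 -> bform e1 xi = 0 -> bform e2 xi = 0 ->
  bform F e1 = 0 -> bform F e2 = 0 -> bform F xi = 0 ->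
  forall v, v = bform v e1 *: e1 + bform v e2 *: e2 - bform v xi *: xi
                - bform v F *: F.
Proof.
move=> e11 e22 xixi FF e12 e1xi e2xi Fe1 Fe2 Fxi v.
pose E : 'M[A]_4 := \matrix_(i, j)
  [tuple e1; e2; xi; F]`_i 0 j.
pose J : 'M[A]_4 := diag_mx (\row_i if (i < 2)%N then 1 else -1).
have JJ : J *m J = 1%:M.
  rewrite /J mulmx_diag -diag_const_mx; congr diag_mx; apply/rowP => i.
  by rewrite !mxE; case: ifP => _; rewrite ?mulr1 // mulrNN mulr1.
have EJ (w : 'rV_4) i : (w *m J *m E^T) 0 i = bform w [tuple e1; e2; xi; F]`_i.
  rewrite mxE /bform; apply: eq_bigr => j _.
  rewrite /J mul_mx_diag !mxE; case: ifP => _; rewrite ?mulr1 // mulrN1 mulNr //.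
have EJE : E *m J *m E^T = J.
  apply/matrixP => i j; have := EJ (row i E) j.
  rewrite -!row_mul mxE => ->.
  have -> : row i E = [tuple e1; e2; xi; F]`_i.
    by apply/rowP => k; rewrite !mxE.
  rewrite /J !mxE; case: i => [[|[|[|[|//]]]] ?]; case: j => [[|[|[|[|//]]]] ?];
    rewrite /= ?e11 ?e22 ?xixi ?FF ?e12 ?e1xi ?e2xi ?Fe1 ?Fe2 ?Fxi //;
    by rewrite bformC ?e12 ?e1xi ?e2xi ?Fe1 ?Fe2 ?Fxi.
have EE : J *m E^T *m J *m E = 1%:M.
  by apply: mulmx1C; rewrite !mulmxA EJE JJ.
apply/eqP; rewrite -subr_eq0; apply/eqP; set r := v - _.
suff rJE : r *m J *m E^T = 0 by rewrite -[r]mulmx1 -EE !mulmxA rJE !mul0mx.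
apply/rowP => i; rewrite EJ mxE /r.
case: i => [[|[|[|[|//]]]] ?];
  rewrite /= !bformE ?e11 ?e22 ?xixi ?FF ?e12 ?e1xi ?e2xi ?Fe1 ?Fe2 ?Fxi;
  rewrite ?(bformC e2 e1) ?(bformC xi e1) ?(bformC xi e2) ?(bformC xi F)
    ?(bformC e1 F) ?(bformC e2 F) ?e12 ?e1xi ?e2xi ?Fe1 ?Fe2 ?Fxi; ring.
Qed.

Definition derivation (A : comNzRingType) (D : A -> A) : Prop :=
  {morph D : a b / a + b} /\ forall a b, D (a * b) = D a * b + a * D b.

(** With the next lemma, this reduces a proof by linear combination of known equations to one ring
    identity: the coefficients [k] and [l] are given by hand and [ring] checks the rest. *)
Lemma eq_from_sub (V : zmodType) (a b c d : V) : a = b -> c - d = a - b -> c = d.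
Proof. by move=> ->; rewrite subrr => /eqP; rewrite subr_eq0 => /eqP. Qed.

Lemma eq_from_sub2 (A : pzRingType) (k l a b a' b' c d : A) :
  a = b -> a' = b' -> c - d = k * (a - b) + l * (a' - b') -> c = d.
Proof. by move=> ->-> /eqP; rewrite !subrr !mulr0 addr0 subr_eq0 => /eqP. Qed.

Section Derivation.
Variables (A : comNzRingType) (D : A -> A).
Hypothesis derD : derivation D.

Lemma der_add a b : D (a + b) = D a + D b. Proof. exact: derD.1. Qed.

Lemma der_mul a b : D (a * b) = D a * b + a * D b. Proof. exact: derD.2. Qed.

Lemma der_0 : D 0 = 0.
Proof. by apply: (addIr (D 0)); rewrite -der_add !add0r. Qed.

Lemma der_opp a : D (- a) = - D a.
Proof. by apply: (addIr (D a)); rewrite -der_add !addNr der_0. Qed.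

Lemma der_1 : D 1 = 0.
Proof.
by apply: (addIr (D 1)); rewrite add0r -[in RHS](mulr1 1) der_mul mulr1 mul1r.
Qed.

Lemma der_addv n (v w : 'rV[A]_n) :
  map_mx D (v + w) = map_mx D v + map_mx D w.
Proof. by apply/rowP => i; rewrite !mxE der_add. Qed.

Lemma der_oppv n (v : 'rV[A]_n) : map_mx D (- v) = - map_mx D v.
Proof. by apply/rowP => i; rewrite !mxE der_opp. Qed.

Lemma der_scalev n a (v : 'rV[A]_n) :
  map_mx D (a *: v) = D a *: v + a *: map_mx D v.
Proof. by apply/rowP => i; rewrite !mxE der_mul. Qed.

Lemma der_sum (I : Type) (r : seq I) (f : I -> A) :
  D (\sum_(i <- r) f i) = \sum_(i <- r) D (f i).
Proof. by elim/big_ind2: _ => [|a b c d <- <-|//]; rewrite ?der_0 ?der_add. Qed.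

Lemma der_bform n (v w : 'rV[A]_n) :
  D (bform v w) = bform (map_mx D v) w + bform v (map_mx D w).
Proof.
rewrite /bform der_sum -big_split; apply: eq_bigr => i _ /=; rewrite !mxE.
by case: ifP => _; rewrite ?der_opp der_mul ?opprD.
Qed.

End Derivation.

(** * Structure equations of an orthonormal frame along a space-like surface *)

Section Frame.
Variables (A : comNzRingType) (D1 D2 : A -> A).
Hypotheses (der1 : derivation D1) (der2 : derivation D2).
Hypothesis torsion_free : forall n (a : A), a *+ n.+1 = 0 -> a = 0.
Variables F e1 e2 xi : 'rV[A]_4.
Local Notation "v ^1" := (map_mx D1 v) (at level 2, format "v ^1").
Local Notation "v ^2" := (map_mx D2 v) (at level 2, format "v ^2").
Local Notation "<< v , w >>" := (bform v w) (format "<< v ,  w >>").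
Hypotheses (F1 : F^1 = e1) (F2 : F^2 = e2).
Hypotheses (e11 : <<e1, e1>> = 1) (e22 : <<e2, e2>> = 1)
  (xixi : <<xi, xi>> = -1) (FF : <<F, F>> = -1) (e12 : <<e1, e2>> = 0)
  (e1xi : <<e1, xi>> = 0) (e2xi : <<e2, xi>> = 0) (Fe1 : <<F, e1>> = 0)
  (Fe2 : <<F, e2>> = 0) (Fxi : <<F, xi>> = 0).

(** [p] and [q] are the connection coefficients: e1 has tangential derivative [p] e2 along e1 and
    [q] e2 along e2. The minus sign in the [h]'s comes from <xi, xi> = -1: they are the coefficients
    of xi in the derivatives of the frame. *)
Definition frame_p := <<e1^1, e2>>.
Definition frame_q := <<e1^2, e2>>.
Definition frame_h11 := - <<e1^1, xi>>.
Definition frame_h12 := - <<e1^2, xi>>.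
Definition frame_h22 := - <<e2^2, xi>>.
Local Notation p := frame_p.
Local Notation q := frame_q.
Local Notation h11 := frame_h11.
Local Notation h12 := frame_h12.
Local Notation h22 := frame_h22.
(** Absence of torsion: [e1, e2] is the difference of the covariant derivatives of e2 along e1 and
    of e1 along e2, which is - p e1 - q e2. *)
Hypothesis bracket : forall a, D1 (D2 a) - D2 (D1 a) = - (p * D1 a + q * D2 a).

Let e21 : <<e2, e1>> = 0. Proof. by rewrite bformC. Qed.
Let xie1 : <<xi, e1>> = 0. Proof. by rewrite bformC. Qed.
Let xie2 : <<xi, e2>> = 0. Proof. by rewrite bformC. Qed.
Let e1F : <<e1, F>> = 0. Proof. by rewrite bformC. Qed.
Let e2F : <<e2, F>> = 0. Proof. by rewrite bformC. Qed.
Let xiF : <<xi, F>> = 0. Proof. by rewrite bformC. Qed.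
Let tableE := (e11, e22, xixi, FF, e12, e1xi, e2xi, Fe1, Fe2, Fxi,
  e21, xie1, xie2, e1F, e2F, xiF).

Let expand := orthonormal_expand e11 e22 xixi FF e12 e1xi e2xi Fe1 Fe2 Fxi.

Let anti1 (v w : 'rV[A]_4) c : <<v, w>> = c -> D1 c = 0 -> <<v^1, w>> = - <<w^1, v>>.
Proof.
move=> vw Dc; have := der_bform der1 v w; rewrite vw Dc => /esym /eqP.
by rewrite addr_eq0 (bformC v) => /eqP.
Qed.

Let anti2 (v w : 'rV[A]_4) c : <<v, w>> = c -> D2 c = 0 -> <<v^2, w>> = - <<w^2, v>>.
Proof.
move=> vw Dc; have := der_bform der2 v w; rewrite vw Dc => /esym /eqP.
by rewrite addr_eq0 (bformC v) => /eqP.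
Qed.

Let self0 (a : A) : a = - a -> a = 0.
Proof. by move=> aN; apply: (@torsion_free 1); rewrite mulr2n {1}aN addNr. Qed.

Let d1_1 := der_1 der1.
Let d2_1 := der_1 der2.
Let d1_0 := der_0 der1.
Let d2_0 := der_0 der2.
Let d1_N1 : D1 (-1) = 0. Proof. by rewrite der_opp // d1_1 oppr0. Qed.
Let d2_N1 : D2 (-1) = 0. Proof. by rewrite der_opp // d2_1 oppr0. Qed.

Let bracketv n (v : 'rV[A]_n) : v^2^1 - v^1^2 = - (p *: v^1 + q *: v^2).
Proof. by apply/rowP => i; rewrite !mxE bracket. Qed.

(** The commutator identity applied to the position vector. It contains the symmetry of the second
    fundamental form, so that a single [h12] suffices. *)
Let e21_bracket : e2^1 = e1^2 - (p *: e1 + q *: e2).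
Proof.
by have := bracketv F; rewrite F1 F2 => <-; rewrite addrC subrK.
Qed.

(** The Gauss formula. The term [F] reflects the curvature of the ambient quadric: <D1 e1, F> = -
    <e1, e1>, and <F, F> = -1 turns this into the coefficient +1. *)
Lemma frame_e1_1 : e1^1 = p *: e2 + h11 *: xi + F.
Proof.
rewrite {1}[LHS]expand (anti1 e1F d1_0) F1 e11.
rewrite (self0 (anti1 e11 d1_1)); apply/rowP => i; rewrite !mxE /frame_p /frame_h11; ring.
Qed.

Lemma frame_e1_2 : e1^2 = q *: e2 + h12 *: xi.
Proof.
rewrite {1}[LHS]expand (anti2 e1F d2_0) F2 e21 oppr0 !scale0r subr0.
by rewrite (self0 (anti2 e11 d2_1)) scale0r add0r scaleNr.
Qed.

Lemma frame_e2_1 : e2^1 = - p *: e1 + h12 *: xi.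
Proof.
rewrite e21_bracket frame_e1_2; apply/rowP => i; rewrite !mxE; ring.
Qed.

Lemma frame_e2_2 : e2^2 = - q *: e1 + h22 *: xi + F.
Proof.
rewrite {1}[LHS]expand (anti2 e2F d2_0) F2 e22 (anti2 e21 d2_0).
rewrite (self0 (anti2 e22 d2_1)); apply/rowP => i; rewrite !mxE /frame_q /frame_h22; ring.
Qed.

Lemma frame_xi_1 : xi^1 = h11 *: e1 + h12 *: e2.
Proof.
rewrite {1}[LHS]expand (anti1 xiF d1_0) F1 e1xi (self0 (anti1 xixi d1_N1)).
rewrite (anti1 xie1 d1_0) (anti1 xie2 d1_0) oppr0 !scale0r !subr0.
by congr (_ + _ *: _); rewrite frame_e2_1 !bformE !tableE; ring.
Qed.

Lemma frame_xi_2 : xi^2 = h12 *: e1 + h22 *: e2.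
Proof.
rewrite {1}[LHS]expand (anti2 xiF d2_0) F2 e2xi (self0 (anti2 xixi d2_N1)).
by rewrite (anti2 xie1 d2_0) (anti2 xie2 d2_0) oppr0 !scale0r !subr0.
Qed.

Let structureE := (frame_e1_1, frame_e1_2, frame_e2_1, frame_e2_2, frame_xi_1,
  frame_xi_2, F1, F2).

Let derE := (der_addv der1, der_addv der2, der_scalev der1, der_scalev der2,
  der_oppv der1, der_oppv der2).

(** The compatibility equations are components of the commutator identity: applied to [xi] it gives
    the two Codazzi equations, applied to [e1] the Gauss equation. *)
Lemma codazzi1 :
  D1 h12 - D2 h11 = p * (h22 - h11) - 2%:R * q * h12.
Proof.
have /(congr1 (fun v => <<v, e1>>)) := bracketv xi.
rewrite !(frame_xi_1, frame_xi_2) !derE !structureE !bformE !tableE => H.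
by apply: (eq_from_sub H); ring.
Qed.

Lemma codazzi2 :
  D1 h22 - D2 h12 = q * (h11 - h22) - 2%:R * p * h12.
Proof.
have /(congr1 (fun v => <<v, e2>>)) := bracketv xi.
rewrite !(frame_xi_1, frame_xi_2) !derE !structureE !bformE !tableE => H.
by apply: (eq_from_sub H); ring.
Qed.

(** The left side is minus the Gaussian curvature in terms of the connection coefficients; the
    summand 1 is minus the ambient curvature. *)
Lemma gauss :
  D1 q - D2 p + p ^+ 2 + q ^+ 2 = h11 * h22 - h12 ^+ 2 + 1.
Proof.
have /(congr1 (fun v => <<v, e2>>)) := bracketv e1.
rewrite !(frame_e1_1, frame_e1_2) !derE !structureE !bformE !tableE => H.
by apply: (eq_from_sub H); ring.
Qed.

Definition frame_nabla1 (V : 'rV[A]_4) := V^1 + <<V^1, F>> *: F.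
Definition frame_nabla2 (V : 'rV[A]_4) := V^2 + <<V^2, F>> *: F.
(** The covariant derivatives of e1 along e1 and of e2 along e2 add up to p e2 - q e1, whence the
    first-order correction. For a normal [T] the curvature term of an ambient space of constant
    curvature -1 is 2 T. *)
Definition frame_bitension (T : 'rV[A]_4) :=
  frame_nabla1 (frame_nabla1 T) + frame_nabla2 (frame_nabla2 T)
  - (p *: frame_nabla2 T - q *: frame_nabla1 T) - 2%:R *: T.

Lemma frame_nabla1_normal g :
  frame_nabla1 (g *: xi) = D1 g *: xi + (g * h11) *: e1 + (g * h12) *: e2.
Proof.
rewrite /frame_nabla1 derE structureE !bformE !tableE.
by apply/rowP => i; rewrite !mxE; ring.
Qed.

Lemma frame_nabla2_normal g :
  frame_nabla2 (g *: xi) = D2 g *: xi + (g * h12) *: e1 + (g * h22) *: e2.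
Proof.
rewrite /frame_nabla2 derE structureE !bformE !tableE.
by apply/rowP => i; rewrite !mxE; ring.
Qed.

Let frame_bitensionE g u : <<F, u>> = 0 ->
  <<frame_bitension (g *: xi), u>> =
  <<(D1 g *: xi + (g * h11) *: e1 + (g * h12) *: e2)^1, u>>
  + <<(D2 g *: xi + (g * h12) *: e1 + (g * h22) *: e2)^2, u>>
  - p * <<D2 g *: xi + (g * h12) *: e1 + (g * h22) *: e2, u>>
  + q * <<D1 g *: xi + (g * h11) *: e1 + (g * h12) *: e2, u>>
  - 2%:R * (g * <<xi, u>>).
Proof.
move=> Fu; rewrite /frame_bitension frame_nabla1_normal frame_nabla2_normal.
rewrite {1}/frame_nabla1 {1}/frame_nabla2.
set V1 := _ + _ *: e2; set V2 := _ + (g * h22) *: e2.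
rewrite !(bformDl, bformZl, bformNl) Fu; ring.
Qed.

Local Notation f := (h11 + h22).
Hypothesis biharmonic : frame_bitension (f *: xi) = 0.

Lemma bitension_normal :
  D1 (D1 f) + D2 (D2 f) - p * D2 f + q * D1 f
  + f * (h11 ^+ 2 + 2%:R * h12 ^+ 2 + h22 ^+ 2) = 2%:R * f.
Proof.
have /(congr1 (fun v => <<v, xi>>)) := biharmonic.
rewrite frame_bitensionE // !derE !structureE !bformE !tableE => H.
by apply: (eq_from_sub (esym H)); ring.
Qed.

Let dE := (der_add der1, der_add der2, der_mul der1, der_mul der2,
  der_opp der1, der_opp der2).

(** The e1 component of the bitension field contains f times the divergence of h. By Codazzi that
    divergence is grad f, and an equation linear in grad f remains. *)
Lemma bitension_tangent1 : 2%:R * (D1 f * h11 + D2 f * h12) + f * D1 f = 0.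
Proof.
have /(congr1 (fun v => <<v, e1>>)) := biharmonic.
rewrite frame_bitensionE // !derE !structureE !bformE !tableE !dE => H.
by apply: (eq_from_sub2 (k := 1) (l := f) H codazzi2); rewrite !dE; ring.
Qed.

Lemma bitension_tangent2 : 2%:R * (D1 f * h12 + D2 f * h22) + f * D2 f = 0.
Proof.
have /(congr1 (fun v => <<v, e2>>)) := biharmonic.
rewrite frame_bitensionE // !derE !structureE !bformE !tableE !dE => H.
by apply: (eq_from_sub2 (k := 1) (l := - f) H codazzi1); rewrite !dE; ring.
Qed.

(** Here h is f/2 times the metric, so the derivatives of [f *: xi] are f^2/2 = 2 times those of F.
    The vector is twice the w of the overview, which avoids dividing by 2. *)
Lemma frame_umbilic :
  D1 f = 0 -> D2 f = 0 -> f ^+ 2 = 4%:R -> h11 = h22 -> h12 = 0 ->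
  (2%:R *: F - f *: xi)^1 = 0 /\ (2%:R *: F - f *: xi)^2 = 0.
Proof.
move=> f1 f2 ff hh h0.
have D1_2 : D1 2%:R = 0 by rewrite mulr2n (der_add der1) d1_1 addr0.
have D2_2 : D2 2%:R = 0 by rewrite mulr2n (der_add der2) d2_1 addr0.
have fh : f * h22 = 2%:R.
  apply/eqP; rewrite -subr_eq0; apply/eqP/(@torsion_free 1); rewrite -mulr_natl.
  by apply: (eq_from_sub ff); rewrite hh; ring.
have fh1 : f * h11 = 2%:R by rewrite -fh -hh.
split; rewrite !derE ?f1 ?f2 ?D1_2 ?D2_2 ?F1 ?F2 ?frame_xi_1 ?frame_xi_2 h0.
  by rewrite !scale0r add0r addr0 add0r scalerA fh1 subrr.
by rewrite !scale0r !add0r scalerA fh subrr.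
Qed.

End Frame.

(** The substitute for a function without zeros, by which an equation may be divided. *)
Definition regular (A : comNzRingType) (a : A) := forall b, a * b = 0 -> b = 0.

(** * Consequences of the Codazzi, Gauss and biharmonic equations *)

Section CompatibilityEquations.
Variables (A : comNzRingType) (D1 D2 : A -> A).
Hypotheses (der1 : derivation D1) (der2 : derivation D2).
Hypothesis torsion_free : forall n (a : A), a *+ n.+1 = 0 -> a = 0.
Variables p q h11 h12 h22 : A.
Hypothesis bracket : forall a, D1 (D2 a) - D2 (D1 a) = - (p * D1 a + q * D2 a).
Local Notation f := (h11 + h22).
Hypothesis codazzi1 : D1 h12 - D2 h11 = p * (h22 - h11) - 2%:R * q * h12.
Hypothesis codazzi2 : D1 h22 - D2 h12 = q * (h11 - h22) - 2%:R * p * h12.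
Hypothesis gauss : D1 q - D2 p + p ^+ 2 + q ^+ 2 = h11 * h22 - h12 ^+ 2 + 1.
Hypothesis bitension_normal :
  D1 (D1 f) + D2 (D2 f) - p * D2 f + q * D1 f
  + f * (h11 ^+ 2 + 2%:R * h12 ^+ 2 + h22 ^+ 2) = 2%:R * f.

Let natr_regular n : @regular A n.+1%:R.
Proof. by move=> b; rewrite mulr_natl; exact: torsion_free. Qed.

Let D1_nat n : D1 n%:R = 0.
Proof.
by elim: n => [|n IHn];
  rewrite ?(der_0 der1) // mulrS (der_add der1) IHn (der_1 der1) addr0.
Qed.

Let D2_nat n : D2 n%:R = 0.
Proof.
by elim: n => [|n IHn];
  rewrite ?(der_0 der2) // mulrS (der_add der2) IHn (der_1 der2) addr0.
Qed.

Let dE := (D1_nat, D2_nat, der_add der1, der_add der2, der_mul der1, der_mul der2,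
  der_opp der1, der_opp der2).

(* Here f = -2 h11.  With q the geodesic curvature of the level lines of f, the
   Codazzi, Gauss and normal equations give 8 q^2 = 15 - 63 h11^2, whose
   derivative along the gradient of f gives 8 q^2 = 8 - 108 h11^2. *)
Lemma frame_no_gradient :
  2%:R * (D1 f * h11 + D2 f * h12) + f * D1 f = 0 ->
  2%:R * (D1 f * h12 + D2 f * h22) + f * D2 f = 0 ->
  regular f -> regular (D1 f) -> D2 f = 0 ->
  45%:R * f ^+ 2 + 28%:R = 0.
Proof.
move=> tangent1 tangent2 rf rf1 f2.
(* With D2 f = 0 the tangential equations read D1 f (3 h11 + h22) = 0 and 2 D1 f h12 = 0. *)
have h22E : h22 = - 3%:R * h11.
  apply/eqP; rewrite -subr_eq0; apply/eqP/rf1.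
  by apply: (eq_from_sub tangent1); rewrite f2; ring.
have h12E : h12 = 0.
  apply/(natr_regular (n := 1))/rf1.
  by apply: (eq_from_sub tangent2); rewrite f2; ring.
have fE : f = - (h11 + h11) by rewrite h22E; ring.
have d1h22 : D1 h22 = - 3%:R * D1 h11.
  by apply: (addrI (D1 h11)); rewrite -(der_add der1) fE !dE; ring.
have d2h11 : D2 h11 = 0.
  by apply: (natr_regular (n := 1)); apply: (eq_from_sub (esym f2)); rewrite fE !dE; ring.
have rh : regular h11 by move=> b hb; apply: rf; rewrite fE; ring: hb.
have rh1 : regular (D1 h11).
  by move=> b hb; apply: rf1; rewrite fE !dE; ring: hb.
(* The gradient lines of f are geodesics. The equations [E1] to [E3] form the differential system
   for [h11] and [q] along them. *)
have p0 : p = 0.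
  apply/rh/(natr_regular (n := 3)); apply: (eq_from_sub codazzi1).
  by rewrite h12E (der_0 der1) d2h11 h22E; ring.
have E1 : 3%:R * D1 h11 = - 4%:R * q * h11.
  apply: (eq_from_sub (esym codazzi2)).
  by rewrite h12E (der_0 der2) d1h22 h22E; ring.
have E2 : D1 q = 1 - 3%:R * h11 ^+ 2 - q ^+ 2.
  by apply: (eq_from_sub gauss); rewrite h12E p0 (der_0 der2) h22E; ring.
have E3 : D1 (D1 h11) = - q * D1 h11 - 10%:R * h11 ^+ 3 + 2%:R * h11.
  apply/eqP; rewrite -subr_eq0; apply/eqP/(natr_regular (n := 1)).
  apply: (eq_from_sub (esym bitension_normal)).
  by rewrite f2 (der_0 der2) p0 h12E fE h22E !dE; ring.
(* The derivative of [E1], from which [E2] and [E3] remove the derivatives of [q] and of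
   [D1 h11]. *)
have E4 : 8%:R * q ^+ 2 + 63%:R * h11 ^+ 2 - 15%:R = 0.
  apply/rh/(natr_regular (n := 1)).
  have := congr1 D1 E1; rewrite !dE E2 E3 => H.
  by apply: (eq_from_sub2 (k := - 3%:R) (l := q) H E1); ring.
(* The derivative of [E4] is multiplied by [h11], so that [E1] trades [q * h11] for [D1 h11]; the
   latter then factors out. *)
have E5 : 8%:R * q ^+ 2 + 108%:R * h11 ^+ 2 - 8%:R = 0.
  apply/rh1/(natr_regular (n := 5)).
  have := congr1 D1 E4; rewrite !expr2 !dE (der_0 der1) E2 => H.
  by  apply: (eq_from_sub2 (k := 4%:R * h11)
    (l := - 16%:R * (1 - 3%:R * h11 ^+ 2 - q ^+ 2)) H E1); ring.
rewrite fE; apply: (eq_from_sub2 (k := 4%:R) (l := - 4%:R) E5 E4); ring.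
Qed.

(* The traceless part a + i b of the second fundamental form has constant
   modulus and rotates at twice the speed of the frame, so the surface is flat;
   but then the Gauss equation makes f vanish. *)
Lemma frame_constant_mean_curvature (c : A) :
  regular f -> D1 f = 0 -> D2 f = 0 -> c * (4%:R - f ^+ 2) = 1 -> f ^+ 2 = 0.
Proof.
move=> rf f1 f2 cE.
have normE : h11 ^+ 2 + 2%:R * h12 ^+ 2 + h22 ^+ 2 = 2%:R.
  apply/eqP; rewrite -subr_eq0; apply/eqP/rf.
  apply: (eq_from_sub bitension_normal).
  by rewrite f1 f2 (der_0 der1) (der_0 der2); ring.
(* a + i b is twice the traceless part of h. Its squared modulus 4 - f^2 is invertible by
   hypothesis, with inverse [c]. *)
pose a := h11 - h22; pose b := 2%:R * h12.
have ab : a ^+ 2 + b ^+ 2 = 4%:R - f ^+ 2.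
  by rewrite /a /b; apply: (eq_from_sub2 (k := 2%:R) (l := 0) normE (erefl 0)); ring.
have aE : a = 2%:R * h11 - f by rewrite /a; ring.
have aE' : a = f - 2%:R * h22 by rewrite /a; ring.
have c1 : D1 b - D2 a = - 2%:R * p * a - 2%:R * q * b.
  rewrite aE /b (der_add der2) (der_opp der2) f2 !dE /a.
  by apply: (eq_from_sub2 (k := 2%:R) (l := 0) codazzi1 (erefl 0)); ring.
have c2 : D1 a + D2 b = 2%:R * p * b - 2%:R * q * a.
  rewrite aE' /b (der_add der1) (der_opp der1) f1 !dE.
  by apply: (eq_from_sub2 (k := - 2%:R) (l := 0) codazzi2 (erefl 0)); ring.
have n1 : a * D1 a + b * D1 b = 0.
  apply: (natr_regular (n := 1)).
  have := congr1 D1 ab; rewrite !expr2 (der_add der1 (a * a)) (der_add der1 4%:R).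
  rewrite (der_opp der1) (der_mul der1 f f) f1 !(der_mul der1 a) !(der_mul der1 b) D1_nat => H.
  by apply: (eq_from_sub H); ring.
have n2 : a * D2 a + b * D2 b = 0.
  apply: (natr_regular (n := 1)).
  have := congr1 D2 ab; rewrite !expr2 (der_add der2 (a * a)) (der_add der2 4%:R).
  rewrite (der_opp der2) (der_mul der2 f f) f2 !(der_mul der2 a) !(der_mul der2 b) D2_nat => H.
  by apply: (eq_from_sub H); ring.
have regc x : (a ^+ 2 + b ^+ 2) * x = 0 -> x = 0.
  by rewrite ab => H; rewrite -[x]mul1r -cE -mulrA H mulr0.
pose C := a ^+ 2 + b ^+ 2.
(* These are C times the derivatives of the argument of a + i b; no angle function is introduced. *)
pose t1 := a * D1 b - b * D1 a; pose t2 := a * D2 b - b * D2 a.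
have a1 : C * D1 a = - b * t1
  by apply: (eq_from_sub2 (k := a) (l := 0) n1 (erefl 0)); rewrite /C /t1 /t2; ring.
have b1 : C * D1 b = a * t1
  by apply: (eq_from_sub2 (k := b) (l := 0) n1 (erefl 0)); rewrite /C /t1 /t2; ring.
have a2 : C * D2 a = - b * t2
  by apply: (eq_from_sub2 (k := a) (l := 0) n2 (erefl 0)); rewrite /C /t1 /t2; ring.
have b2 : C * D2 b = a * t2
  by apply: (eq_from_sub2 (k := b) (l := 0) n2 (erefl 0)); rewrite /C /t1 /t2; ring.
have A1 : a * t1 + b * t2 = C * (- 2%:R * p * a - 2%:R * q * b).
  by rewrite -c1 (mulrBr C) b1 a2; ring.
have A2 : a * t2 - b * t1 = C * (2%:R * p * b - 2%:R * q * a).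
  by rewrite -c2 (mulrDr C) a1 b2; ring.
have t1E : t1 = - 2%:R * p * C.
  apply/eqP; rewrite -subr_eq0; apply/eqP/regc.
  by apply: (eq_from_sub2 (k := a) (l := - b) A1 A2); rewrite /C; ring.
have t2E : t2 = - 2%:R * q * C.
  apply/eqP; rewrite -subr_eq0; apply/eqP/regc.
  by apply: (eq_from_sub2 (k := b) (l := a) A1 A2); rewrite /C; ring.
have cancelC x y : C * x = C * y -> x = y.
  move=> xy; apply/eqP; rewrite -subr_eq0; apply/eqP/regc.
  by rewrite -/C mulrBr xy subrr.
have {a1}a1 : D1 a = 2%:R * p * b by apply: cancelC; rewrite a1 t1E; ring.
have {b1}b1 : D1 b = - 2%:R * p * a by apply: cancelC; rewrite b1 t1E; ring.
have {a2}a2 : D2 a = 2%:R * q * b by apply: cancelC; rewrite a2 t2E; ring.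
have {b2}b2 : D2 b = - 2%:R * q * a by apply: cancelC; rewrite b2 t2E; ring.
pose K := D1 q - D2 p + p ^+ 2 + q ^+ 2.
(* Since a + i b rotates at speed -2p along e1 and -2q along e2, the commutator identity for [a] and
   [b] measures the curvature [K]. *)
have Kb : K * b = 0.
  apply: (natr_regular (n := 1)).
  have := bracket a; rewrite a1 a2 -!mulrA !(der_mul der1 2%:R) !(der_mul der2 2%:R).
  rewrite (der_mul der1 q) (der_mul der2 p) b1 b2 D1_nat D2_nat => H.
  by apply: (eq_from_sub H); rewrite /K; ring.
have Ka : K * a = 0.
  apply: (natr_regular (n := 1)).
  have := bracket b; rewrite b1 b2 -!mulrA !(der_mul der1 (- 2%:R)) !(der_mul der2 (- 2%:R)).
  rewrite (der_mul der1 q) (der_mul der2 p) a1 a2 (der_opp der1) (der_opp der2) D1_nat D2_nat => H.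
  by apply: (eq_from_sub (esym H)); rewrite /K; ring.
have K0 : K = 0.
  by apply: regc; apply: (eq_from_sub2 (k := a) (l := b) Ka Kb); ring.
(* Flatness gives det h = -1 by Gauss, hence f^2 = |h|^2 + 2 det h = 2 - 2. *)
apply: (natr_regular (n := 1)).
move: gauss; rewrite -/K K0 => H.
by apply: (eq_from_sub2 (k := - 4%:R) (l := 2%:R) H normE); rewrite /a; ring.
Qed.

End CompatibilityEquations.

(** * From coordinate derivations to an orthonormal frame *)

Section Coordinates.
Variables (A : comNzRingType) (d0 d1 : A -> A).
Hypotheses (der0 : derivation d0) (der1 : derivation d1).
Hypothesis d01 : forall a, d0 (d1 a) = d1 (d0 a).
Hypothesis torsion_free : forall n (a : A), a *+ n.+1 = 0 -> a = 0.
Variables F xi : 'rV[A]_4.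
Variables a0 a1 b0 b1 : A.
Definition combine_der (c0 c1 : A) (x : A) : A := c0 * d0 x + c1 * d1 x.
Local Notation D1 := (combine_der a0 a1).
Local Notation D2 := (combine_der b0 b1).
Local Notation "<< v , w >>" := (bform v w) (format "<< v ,  w >>").
Local Notation F0 := (map_mx d0 F).
Local Notation F1 := (map_mx d1 F).
Local Notation e1 := (map_mx D1 F).
Local Notation e2 := (map_mx D2 F).
Hypotheses (e11 : <<e1, e1>> = 1) (e22 : <<e2, e2>> = 1)
  (xixi : <<xi, xi>> = -1) (FF : <<F, F>> = -1) (e12 : <<e1, e2>> = 0)
  (F0xi : <<F0, xi>> = 0) (F1xi : <<F1, xi>> = 0) (Fxi : <<F, xi>> = 0).

Lemma combine_derivation c0 c1 : derivation (combine_der c0 c1).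
Proof.
by split=> x y; rewrite /combine_der ?(der_add der0) ?(der_add der1)
  ?(der_mul der0) ?(der_mul der1); ring.
Qed.

Lemma combine_derv c0 c1 n (v : 'rV[A]_n) :
  map_mx (combine_der c0 c1) v = c0 *: map_mx d0 v + c1 *: map_mx d1 v.
Proof. by apply/rowP => i; rewrite !mxE. Qed.

Let F0F : <<F0, F>> = 0.
Proof.
apply: (@torsion_free 1); rewrite mulr2n {2}bformC -(der_bform der0) FF.
by rewrite (der_opp der0) (der_1 der0) oppr0.
Qed.

Let F1F : <<F1, F>> = 0.
Proof.
apply: (@torsion_free 1); rewrite mulr2n {2}bformC -(der_bform der1) FF.
by rewrite (der_opp der1) (der_1 der1) oppr0.
Qed.

Let e1xi : <<e1, xi>> = 0.
Proof. by rewrite combine_derv !bformE F0xi F1xi !mulr0 addr0. Qed.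
Let e2xi : <<e2, xi>> = 0.
Proof. by rewrite combine_derv !bformE F0xi F1xi !mulr0 addr0. Qed.
Let Fe1 : <<F, e1>> = 0.
Proof. by rewrite bformC combine_derv !bformE F0F F1F !mulr0 addr0. Qed.
Let Fe2 : <<F, e2>> = 0.
Proof. by rewrite bformC combine_derv !bformE F0F F1F !mulr0 addr0. Qed.

(** Orthonormality says that the matrix of coefficients of the frame is a left inverse of the matrix
    of products <d_k F, e_j>. For square matrices it is also a right inverse, and this expresses the
    coordinate fields in the frame. *)
Lemma frame_dual : [/\ <<F0, e1>> * a0 + <<F0, e2>> * b0 = 1,
  <<F0, e1>> * a1 + <<F0, e2>> * b1 = 0,
  <<F1, e1>> * a0 + <<F1, e2>> * b0 = 0 &
  <<F1, e1>> * a1 + <<F1, e2>> * b1 = 1].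
Proof.
pose C : 'M[A]_2 := \matrix_(i, k) if i == 0 then if k == 0 then a0 else a1
  else if k == 0 then b0 else b1.
pose Q : 'M[A]_2 := \matrix_(k, j) <<if k == 0 then F0 else F1,
  if j == 0 then e1 else e2>>.
have /mulmx1C CQ : C *m Q = 1%:M.
  apply/matrixP => i j; rewrite mxE !big_ord_recl big_ord0 addr0 !mxE /=.
  rewrite -!bformZl -bformDl.
  by case: i => [[|[|//]] ?]; case: j => [[|[|//]] ?];
    rewrite /= -combine_derv ?e11 ?e22 ?e12 // bformC.
have E (k l : 'I_2) := congr1 (fun X : 'M[A]_2 => X k l) CQ.
by split; [have := E 0 0|have := E 0 1|have := E 1 0|have := E 1 1];
  rewrite mxE !big_ord_recl big_ord0 addr0 !mxE.
Qed.

Local Notation p := (frame_p D1 e1 e2).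
Local Notation q := (frame_q D2 e1 e2).
Local Notation f := (frame_h11 D1 e1 xi + frame_h22 D2 e2 xi).

Let tangentD (D : A -> A) (v : 'rV[A]_4) : derivation D ->
  <<v, v>> = 1 -> <<map_mx D v, v>> = 0.
Proof.
move=> Dd vv; apply: (@torsion_free 1).
by rewrite mulr2n {2}bformC -(der_bform Dd) vv der_1.
Qed.

Let antiD (D : A -> A) (v w : 'rV[A]_4) : derivation D ->
  <<v, w>> = 0 -> <<map_mx D w, v>> = - <<map_mx D v, w>>.
Proof.
move=> Dd vw; apply/eqP; rewrite -addr_eq0 addrC [X in _ + X]bformC.
by rewrite -(der_bform Dd) vw der_0.
Qed.

Let coef_eq (c0 c1 x y : A) :
  <<c0 *: F0 + c1 *: F1, e1>> = x -> <<c0 *: F0 + c1 *: F1, e2>> = y ->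
  c0 = x * a0 + y * b0 /\ c1 = x * a1 + y * b1.
Proof.
have [D00 D01 D10 D11] := frame_dual.
move=> <- <-; rewrite !bformE; split; apply/esym.
  have -> : c0 = c0 * 1 + c1 * 0 by ring.
  by rewrite -[in RHS]D00 -[in RHS]D10; ring.
have -> : c1 = c0 * 0 + c1 * 1 by ring.
by rewrite -[in RHS]D01 -[in RHS]D11; ring.
Qed.

(** The commutator is again a combination of [d0] and [d1], and a combination is determined by the
    products of its value on F with e1 and e2. These products are -p and -q. *)
Lemma frame_bracket x : D1 (D2 x) - D2 (D1 x) = - (p * D1 x + q * D2 x).
Proof.
pose c0 := D1 b0 - D2 a0; pose c1 := D1 b1 - D2 a1.
have brE y : D1 (D2 y) - D2 (D1 y) = c0 * d0 y + c1 * d1 y.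
  rewrite /c0 /c1 /combine_der !(der_add der0, der_add der1).
  by rewrite !(der_mul der0, der_mul der1) d01; ring.
have cF : c0 *: F0 + c1 *: F1 = map_mx D1 e2 - map_mx D2 e1.
  by apply/rowP => i; rewrite !mxE brE.
have D1d := combine_derivation a0 a1; have D2d := combine_derivation b0 b1.
have [||c0E c1E] := @coef_eq c0 c1 (- p) (- q).
- rewrite cF bformDl bformNl (tangentD D2d e11) subr0 /frame_p.
  by rewrite (antiD D1d e12).
- by rewrite cF bformDl bformNl (tangentD D1d e22) sub0r.
by rewrite brE c0E c1E /combine_der; ring.
Qed.

Definition coord_nabla (d : A -> A) (V : 'rV[A]_4) : 'rV[A]_4 :=
  map_mx d V + <<map_mx d V, F>> *: F.

(* The trace of (k, l) |-> G k l for the inverse metric a_k a_l + b_k b_l. *)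
Definition frame_trace (G00 G01 G10 G11 : 'rV[A]_4) : 'rV[A]_4 :=
  (a0 * a0 + b0 * b0) *: G00 + (a0 * a1 + b0 * b1) *: G01
  + (a1 * a0 + b1 * b0) *: G10 + (a1 * a1 + b1 * b1) *: G11.

(* c0, c1 are the contracted Christoffel symbols. *)
Definition coord_laplacian c0 c1 (V : 'rV[A]_4) : 'rV[A]_4 :=
  frame_trace (coord_nabla d0 (coord_nabla d0 V)) (coord_nabla d0 (coord_nabla d1 V))
              (coord_nabla d1 (coord_nabla d0 V)) (coord_nabla d1 (coord_nabla d1 V))
  - (c0 *: coord_nabla d0 V + c1 *: coord_nabla d1 V).

Definition coord_tension c0 c1 : 'rV[A]_4 :=
  frame_trace (coord_nabla d0 F0) (coord_nabla d0 F1)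
              (coord_nabla d1 F0) (coord_nabla d1 F1)
  - (c0 *: F0 + c1 *: F1).

Variables c0 c1 : A.
Local Notation trF := (frame_trace (map_mx d0 F0) (map_mx d0 F1)
                                   (map_mx d1 F0) (map_mx d1 F1)).
(** These two equations characterise [c0] and [c1]: they are the coordinates of the tangential part
    of [trF], the trace of the second derivatives of F. *)
Hypothesis christoffel0 : <<c0 *: F0 + c1 *: F1, F0>> = <<trF, F0>>.
Hypothesis christoffel1 : <<c0 *: F0 + c1 *: F1, F1>> = <<trF, F1>>.

(** The first-order terms that appear when the derivatives of e1 and e2 are expanded in
    coordinates. *)
Let k0 := D1 a0 + D2 b0.
Let k1 := D1 a1 + D2 b1.

Let trFE : map_mx D1 e1 + map_mx D2 e2 = trF + (k0 *: F0 + k1 *: F1).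
Proof.
apply/rowP => i; rewrite !mxE /k0 /k1 /combine_der.
by rewrite !(der_add der0, der_add der1) !(der_mul der0, der_mul der1); ring.
Qed.

Let coord_tensionE' :
  coord_tension c0 c1 = trF + <<trF, F>> *: F - (c0 *: F0 + c1 *: F1).
Proof.
rewrite /coord_tension /coord_nabla /frame_trace !bformE.
by apply/rowP => i; rewrite !mxE; ring.
Qed.

(** The choice of [c0] and [c1] makes the tension field orthogonal to the surface, and the
    projection makes it orthogonal to F, so only the component along [xi] is left. *)
Lemma coord_tensionE : coord_tension c0 c1 = f *: xi.
Proof.
have D1d := combine_derivation a0 a1; have D2d := combine_derivation b0 b1.
have T0 : <<coord_tension c0 c1, F0>> = 0.
  rewrite coord_tensionE'; move: trF (c0 *: F0 + c1 *: F1) christoffel0 => t w wt.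
  by rewrite !bformDl bformNl bformZl (bformC F) F0F wt; ring.
have T1 : <<coord_tension c0 c1, F1>> = 0.
  rewrite coord_tensionE'; move: trF (c0 *: F0 + c1 *: F1) christoffel1 => t w wt.
  by rewrite !bformDl bformNl bformZl (bformC F) F1F wt; ring.
rewrite [LHS](orthonormal_expand e11 e22 xixi FF e12 e1xi e2xi Fe1 Fe2 Fxi).
have -> : <<coord_tension c0 c1, e1>> = 0.
  by rewrite combine_derv !(bformDr, bformZr) T0 T1; ring.
have -> : <<coord_tension c0 c1, e2>> = 0.
  by rewrite combine_derv !(bformDr, bformZr) T0 T1; ring.
have -> : <<coord_tension c0 c1, F>> = 0.
  rewrite coord_tensionE'; move: trF => t.
  by rewrite !bformE FF F0F F1F; ring.
have -> : <<coord_tension c0 c1, xi>> = - f.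
  have := congr1 (fun v => <<v, xi>>) trFE.
  rewrite coord_tensionE'; move: trF => t.
  rewrite !(bformDl, bformZl, bformNl) F0xi F1xi Fxi.
  by rewrite /frame_h11 /frame_h22 => H; apply: (eq_from_sub (esym H)); ring.
by apply/rowP => i; rewrite !mxE; ring.
Qed.

(** Both sides are the coordinates of p e2 - q e1, the sum of the covariant derivatives of e1 along
    e1 and of e2 along e2. This matches the first-order terms of the coordinate Laplacian with those
    of the frame Laplacian. *)
Let contractedE : c0 + k0 = - q * a0 + p * b0 /\ c1 + k1 = - q * a1 + p * b1.
Proof.
have D1d := combine_derivation a0 a1; have D2d := combine_derivation b0 b1.
have split_form u : <<(c0 + k0) *: F0 + (c1 + k1) *: F1, u>> =
    <<c0 *: F0 + c1 *: F1, u>> + <<k0 *: F0 + k1 *: F1, u>>.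
  by rewrite !bformE; ring.
have christoffelE u0 u1 :
    <<c0 *: F0 + c1 *: F1, u0 *: F0 + u1 *: F1>> = <<trF, u0 *: F0 + u1 *: F1>>.
  by rewrite [LHS]bformDr [RHS]bformDr !bformZr christoffel0 christoffel1.
apply: coef_eq; rewrite split_form {1}combine_derv christoffelE -combine_derv -bformDl -trFE bformDl.
  by rewrite (tangentD D1d e11) add0r (antiD D2d e12).
by rewrite [X in _ + X](tangentD D2d e22) addr0.
Qed.

Lemma coord_laplacianE V :
  coord_laplacian c0 c1 V - 2%:R *: V =
  frame_bitension D1 D2 F e1 e2 V.
Proof.
have [k0E k1E] := contractedE.
have nabla_perp d W : derivation d -> <<map_mx d F, F>> = 0 ->  <<coord_nabla d W, F>> = 0.
  by move=> dd dFF; rewrite /coord_nabla bformDl bformZl FF; ring.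
have nablaE u v W : map_mx (combine_der u v) W + <<map_mx (combine_der u v) W, F>> *: F
   = u *: coord_nabla d0 W + v *: coord_nabla d1 W.
  by rewrite combine_derv /coord_nabla !bformE; apply/rowP => i; rewrite !mxE; ring.
rewrite /frame_bitension /frame_nabla1 /frame_nabla2 !nablaE /coord_laplacian.
set N0 := coord_nabla d0 V; set N1 := coord_nabla d1 V.
have N0F : <<N0, F>> = 0 by exact: nabla_perp.
have N1F : <<N1, F>> = 0 by exact: nabla_perp.
move: N0 N1 N0F N1F => N0 N1 N0F N1F.
have nabla_lin u v d : derivation d -> coord_nabla d (u *: N0 + v *: N1) =
    d u *: N0 + d v *: N1 + u *: coord_nabla d N0 + v *: coord_nabla d N1.
  move=> dd; rewrite /coord_nabla (der_addv dd) !(der_scalev dd) !bformE N0F N1F.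
  by apply/rowP => i; rewrite !mxE; ring.
rewrite !nabla_lin // /frame_trace.
have -> : c0 = - q * a0 + p * b0 - k0 by rewrite -k0E addrK.
have -> : c1 = - q * a1 + p * b1 - k1 by rewrite -k1E addrK.
by apply/rowP => i; rewrite !mxE /k0 /k1 /combine_der; ring.
Qed.

End Coordinates.

(** * An orthonormal frame with a prescribed direction, and the unit normal *)

Section FrameConstruction.
Variable A : comNzRingType.
Local Notation "<< v , w >>" := (bform v w) (format "<< v ,  w >>").

Definition minor3 (x y z : 'rV[A]_4) (i j k : 'I_4) : A :=
  x 0 i * (y 0 j * z 0 k - y 0 k * z 0 j)
  - x 0 j * (y 0 i * z 0 k - y 0 k * z 0 i)
  + x 0 k * (y 0 i * z 0 j - y 0 j * z 0 i).

(* The Hodge dual of x /\ y /\ z. *)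
Definition cross (x y z : 'rV[A]_4) : 'rV[A]_4 :=
  \row_i [:: minor3 x y z 1 2%:R 3%:R; - minor3 x y z 0 2%:R 3%:R;
             - minor3 x y z 0 1 3%:R; minor3 x y z 0 1 2%:R]`_i.

Lemma cross_perp (x y z : 'rV[A]_4) :
  [/\ <<cross x y z, x>> = 0, <<cross x y z, y>> = 0 & <<cross x y z, z>> = 0].
Proof. by split; rewrite bform4 !mxE /= /minor3; ring. Qed.

(** The right side is the Gram determinant of x, y, z. It has the sign +, because the form has an
    even number of negative directions. *)
Lemma cross_norm (x y z : 'rV[A]_4) : <<cross x y z, cross x y z>> =
  <<x, x>> * (<<y, y>> * <<z, z>> - <<y, z>> ^+ 2)
  - <<x, y>> * (<<x, y>> * <<z, z>> - <<y, z>> * <<x, z>>)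
  + <<x, z>> * (<<x, y>> * <<y, z>> - <<y, y>> * <<x, z>>).
Proof. by rewrite !bform4 !mxE /= /minor3; ring. Qed.

Variables (x y : 'rV[A]_4) (r s u0 u1 : A).
Local Notation gxx := <<x, x>>.
Local Notation gxy := <<x, y>>.
Local Notation gyy := <<y, y>>.
(** [r] is the reciprocal of the area element of x and y, and [s] that of the length of u0 x + u1 y.
    A ring does not provide such roots. *)
Hypothesis rE : r ^+ 2 * (gxx * gyy - gxy ^+ 2) = 1.
Hypothesis sE : s ^+ 2 * (u0 ^+ 2 * gxx + 2%:R * u0 * u1 * gxy + u1 ^+ 2 * gyy) = 1.

(* The rotation by a right angle of s (u0 x + u1 y) in the plane of x and y. *)
Definition rot0 := - (s * r * (gxy * u0 + gyy * u1)).
Definition rot1 := s * r * (gxx * u0 + gxy * u1).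

Lemma rot_frame (e1 := rot0 *: x + rot1 *: y)
    (e2 := (s * u0) *: x + (s * u1) *: y) :
  [/\ <<e1, e1>> = 1, <<e2, e2>> = 1 & <<e1, e2>> = 0].
Proof.
have yx : <<y, x>> = gxy by rewrite bformC.
rewrite /e1 /e2 !bformE yx /rot0 /rot1; split.
- have -> : 1 = (r ^+ 2 * (gxx * gyy - gxy ^+ 2)) *
      (s ^+ 2 * (u0 ^+ 2 * gxx + 2%:R * u0 * u1 * gxy + u1 ^+ 2 * gyy)).
    by rewrite rE sE mulr1.
  by ring.
- by rewrite -[RHS]sE; ring.
by ring.
Qed.

End FrameConstruction.

(** * The biharmonic equation in coordinates, read in an orthonormal frame *)

Section BiharmonicFrame.
Variables (A : comNzRingType) (d0 d1 : A -> A).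
Hypotheses (der0 : derivation d0) (der1 : derivation d1).
Hypothesis d01 : forall a, d0 (d1 a) = d1 (d0 a).
Hypothesis torsion_free : forall n (a : A), a *+ n.+1 = 0 -> a = 0.
Variables F xi : 'rV[A]_4.
Variables a0 a1 b0 b1 : A.
Local Notation D1 := (combine_der d0 d1 a0 a1).
Local Notation D2 := (combine_der d0 d1 b0 b1).
Local Notation "<< v , w >>" := (bform v w) (format "<< v ,  w >>").
Local Notation F0 := (map_mx d0 F).
Local Notation F1 := (map_mx d1 F).
Local Notation e1 := (map_mx D1 F).
Local Notation e2 := (map_mx D2 F).
Hypotheses (e11 : <<e1, e1>> = 1) (e22 : <<e2, e2>> = 1)
  (xixi : <<xi, xi>> = -1) (FF : <<F, F>> = -1) (e12 : <<e1, e2>> = 0)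
  (F0xi : <<F0, xi>> = 0) (F1xi : <<F1, xi>> = 0) (Fxi : <<F, xi>> = 0).
Variables c0 c1 : A.
Local Notation trF := (frame_trace a0 a1 b0 b1 (map_mx d0 F0) (map_mx d0 F1)
                                   (map_mx d1 F0) (map_mx d1 F1)).
Hypothesis christoffel0 : <<c0 *: F0 + c1 *: F1, F0>> = <<trF, F0>>.
Hypothesis christoffel1 : <<c0 *: F0 + c1 *: F1, F1>> = <<trF, F1>>.

(** [f] is the coefficient of the tension field and not the sum h11 + h22, because the frame is
    later chosen in terms of [f]. Their equality is [fE]. *)
Variable f : A.
Local Notation T := (coord_tension d0 d1 F a0 a1 b0 b1 c0 c1).
Hypothesis tensionE : T = f *: xi.
Hypothesis biharmonic :
  coord_laplacian d0 d1 F a0 a1 b0 b1 c0 c1 T - 2%:R *: T = 0.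

Let D1d := combine_derivation der0 der1 a0 a1.
Let D2d := combine_derivation der0 der1 b0 b1.
Let h11 := frame_h11 D1 e1 xi.
Let h12 := frame_h12 D2 e1 xi.
Let h22 := frame_h22 D2 e2 xi.

Let fE : f = h11 + h22.
Proof.
have := coord_tensionE der0 der1 torsion_free e11 e22 xixi FF e12 F0xi F1xi Fxi
  christoffel0 christoffel1.
rewrite tensionE => /(congr1 (fun v => - <<v, xi>>)).
by rewrite !bformZl xixi !mulrN1 !opprK.
Qed.

Let bracket := frame_bracket der0 der1 d01 torsion_free e11 e22 e12.
Let FdF d : derivation d -> <<map_mx d F, F>> = 0.
Proof.
move=> dd; apply: (@torsion_free 1); rewrite mulr2n {2}bformC -(der_bform dd) FF.
by rewrite (der_opp dd) (der_1 dd) oppr0.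
Qed.
Let Fe1 : <<F, e1>> = 0. Proof. by rewrite bformC FdF. Qed.
Let Fe2 : <<F, e2>> = 0. Proof. by rewrite bformC FdF. Qed.
Let combinev c c' (v : 'rV[A]_4) :
  map_mx (combine_der d0 d1 c c') v = c *: map_mx d0 v + c' *: map_mx d1 v.
Proof. by apply/rowP => i; rewrite !mxE. Qed.
Let e1xi : <<e1, xi>> = 0.
Proof. by rewrite combinev !bformE F0xi F1xi !mulr0 addr0. Qed.
Let e2xi : <<e2, xi>> = 0.
Proof. by rewrite combinev !bformE F0xi F1xi !mulr0 addr0. Qed.

Let bitension0 : frame_bitension D1 D2 F e1 e2 ((h11 + h22) *: xi) = 0.
Proof.
by rewrite -fE -tensionE -(coord_laplacianE der0 der1 torsion_free e11 e22 FF e12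
  christoffel0 christoffel1).
Qed.

Let Ecodazzi1 := codazzi1 D1d D2d torsion_free (erefl _) (erefl _) e11 e22 xixi
  FF e12 e1xi e2xi Fe1 Fe2 Fxi bracket.
Let Ecodazzi2 := codazzi2 D1d D2d torsion_free (erefl _) (erefl _) e11 e22 xixi
  FF e12 e1xi e2xi Fe1 Fe2 Fxi bracket.
Let Egauss := gauss D1d D2d torsion_free (erefl _) (erefl _) e11 e22 xixi
  FF e12 e1xi e2xi Fe1 Fe2 Fxi bracket.
Let Enormal := bitension_normal D1d D2d torsion_free (erefl _) (erefl _) e11 e22
  xixi FF e12 e1xi e2xi Fe1 Fe2 Fxi bracket bitension0.
Let Etangent1 := bitension_tangent1 D1d D2d torsion_free (erefl _) (erefl _) e11
  e22 xixi FF e12 e1xi e2xi Fe1 Fe2 Fxi bracket bitension0.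
Let Etangent2 := bitension_tangent2 D1d D2d torsion_free (erefl _) (erefl _) e11
  e22 xixi FF e12 e1xi e2xi Fe1 Fe2 Fxi bracket bitension0.

Theorem biharmonic_no_gradient :
  regular f -> regular (D1 f) -> D2 f = 0 -> 45%:R * f ^+ 2 + 28%:R = 0.
Proof.
rewrite fE; exact: (frame_no_gradient D1d D2d torsion_free Ecodazzi1 Ecodazzi2
  Egauss Enormal Etangent1 Etangent2).
Qed.

Theorem biharmonic_constant_mean_curvature c :
  regular f -> D1 f = 0 -> D2 f = 0 -> c * (4%:R - f ^+ 2) = 1 -> f ^+ 2 = 0.
Proof.
rewrite fE; exact: (frame_constant_mean_curvature D1d D2d torsion_free bracket
  Ecodazzi1 Ecodazzi2 Egauss Enormal).
Qed.

(** From |h|^2 = 2 and f^2 = 4 the traceless part (a, b) of h satisfies a^2 + b^2 = 0. Only for real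
    values does this mean a = b = 0, so that step is left to the ring of functions. *)
Theorem biharmonic_umbilic :
  regular f -> D1 f = 0 -> D2 f = 0 -> f ^+ 2 = 4%:R ->
  exists a b : A, a ^+ 2 + b ^+ 2 = 0 /\ (a = 0 -> b = 0 ->
    map_mx D1 (2%:R *: F - f *: xi) = 0 /\ map_mx D2 (2%:R *: F - f *: xi) = 0).
Proof.
rewrite fE => rf f1 f2 ff.
have normE : h11 ^+ 2 + 2%:R * h12 ^+ 2 + h22 ^+ 2 = 2%:R.
  apply/eqP; rewrite -subr_eq0; apply/eqP/rf.
  move: Enormal; rewrite -/h11 -/h22 -/h12 f1 f2 (der_0 D1d) (der_0 D2d) => H.
  by apply: (eq_from_sub H); ring.
exists (h11 - h22), (2%:R * h12); split.
  by apply: (eq_from_sub2 (k := 2%:R) (l := -1) normE ff); ring.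
move=> /eqP; rewrite subr_eq0 => /eqP hh h0.
have {}h0 : h12 = 0.
  by apply: (@torsion_free 1); rewrite -mulr_natl.
exact: (frame_umbilic D1d D2d torsion_free (erefl _) (erefl _) e11 e22
  xixi FF e12 e1xi e2xi Fe1 Fe2 Fxi bracket f1 f2 ff hh h0).
Qed.

End BiharmonicFrame.

Lemma sum_ord2 (V : nmodType) (f : 'I_2 -> V) : \sum_k f k = f 0 + f 1.
Proof.
by rewrite !big_ord_recl big_ord0 addr0; congr (_ + f _); apply/val_inj.
Qed.

Lemma ord2_ind (P : 'I_2 -> Prop) : P 0 -> P 1 -> forall i, P i.
Proof.
move=> P0 P1 [[|[|//]] ?].
  by rewrite (_ : Ordinal _ = 0) //; exact/val_inj.
by rewrite (_ : Ordinal _ = 1) //; exact/val_inj.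
Qed.

(** * Christoffel symbols of an immersion *)

Section Christoffel.
Variables (A : comNzRingType) (d : 'I_2 -> A -> A).
Hypothesis der : forall k, derivation (d k).
Hypothesis dC : forall k l a, d k (d l a) = d l (d k a).
Variable F : 'rV[A]_4.
Variables a0 a1 b0 b1 : A.
Local Notation D1 := (combine_der (d 0) (d 1) a0 a1).
Local Notation D2 := (combine_der (d 0) (d 1) b0 b1).
Local Notation "<< v , w >>" := (bform v w) (format "<< v ,  w >>").
Local Notation e1 := (map_mx D1 F).
Local Notation e2 := (map_mx D2 F).
Hypotheses (e11 : <<e1, e1>> = 1) (e22 : <<e2, e2>> = 1) (e12 : <<e1, e2>> = 0).

Definition gram (k l : 'I_2) := <<map_mx (d k) F, map_mx (d l) F>>.
(** The inverse metric g^kl = a_k a_l + b_k b_l, obtained from the frame without a determinant. *)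
Definition inv_gram (k l : 'I_2) : A :=
  (if k == 0 then a0 else a1) * (if l == 0 then a0 else a1)
  + (if k == 0 then b0 else b1) * (if l == 0 then b0 else b1).

Lemma inv_gramC k l : inv_gram k l = inv_gram l k.
Proof. by rewrite /inv_gram; congr (_ + _); rewrite mulrC. Qed.

Lemma gram_inv k m : \sum_l gram k l * inv_gram l m = (k == m)%:R.
Proof.
have [D00 D01 D10 D11] := frame_dual e11 e22 e12.
have E (v : 'rV[A]_4) (c0 c1 : A) :
    <<v, map_mx (combine_der (d 0) (d 1) c0 c1) F>>
    = <<v, map_mx (d 0) F>> * c0 + <<v, map_mx (d 1) F>> * c1.
  rewrite (_ : map_mx _ F = c0 *: map_mx (d 0) F + c1 *: map_mx (d 1) F).
    by rewrite bformDr !bformZr (mulrC c0) (mulrC c1).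
  by apply/rowP => i; rewrite !mxE.
move: D00 D01 D10 D11; rewrite !E => D00 D01 D10 D11.
rewrite sum_ord2 /gram /inv_gram /=.
elim/ord2_ind: k; elim/ord2_ind: m => /=.
- by rewrite -[RHS]D00; ring.
- by rewrite -[RHS]D01; ring.
- by rewrite -[RHS]D10; ring.
- by rewrite -[RHS]D11; ring.
Qed.

Definition second_der k l := map_mx (d k) (map_mx (d l) F).
(** Along an immersion the Christoffel symbols are the coordinates of the tangential part of the
    second derivatives; [der_gram] links this with the formula in derivatives of the metric. *)
Definition christoffel_sym m k l : A :=
  \sum_n inv_gram m n * <<second_der k l, map_mx (d n) F>>.

Lemma der_gram n k l :
  d k (gram n l) + d l (gram n k) - d n (gram k l)
  = 2%:R * <<second_der k l, map_mx (d n) F>>.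
Proof.
have F2C i j : second_der i j = second_der j i.
  by apply/rowP => r; rewrite !mxE dC.
rewrite /gram !(der_bform (der _)) -!/(second_der _ _).
rewrite (F2C k n) (F2C l n) (F2C l k) [<<_, second_der n l>>]bformC.
by rewrite ![<<map_mx (d n) F, second_der _ _>>]bformC; ring.
Qed.

Definition contracted_christoffel m :=
  \sum_k \sum_l inv_gram k l * christoffel_sym m k l.

Lemma inv_gram_trace (G : 'I_2 -> 'I_2 -> 'rV[A]_4) (N : 'I_2 -> 'rV[A]_4) :
  \sum_k \sum_l inv_gram k l *: (G k l - \sum_m christoffel_sym m k l *: N m)
  = frame_trace a0 a1 b0 b1 (G 0 0) (G 0 1) (G 1 0) (G 1 1)
    - (contracted_christoffel 0 *: N 0 + contracted_christoffel 1 *: N 1).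
Proof.
rewrite /contracted_christoffel; move: (christoffel_sym) => Gam.
rewrite !sum_ord2 /frame_trace /inv_gram /=.
by apply/rowP => i; rewrite !mxE; ring.
Qed.

Lemma contracted_christoffelE j :
  <<contracted_christoffel 0 *: map_mx (d 0) F
    + contracted_christoffel 1 *: map_mx (d 1) F, map_mx (d j) F>>
  = <<frame_trace a0 a1 b0 b1 (second_der 0 0) (second_der 0 1)
       (second_der 1 0) (second_der 1 1), map_mx (d j) F>>.
Proof.
have gramE k l : \sum_m christoffel_sym m k l * gram m j
    = <<second_der k l, map_mx (d j) F>>.
  rewrite /christoffel_sym; under eq_bigr do rewrite mulr_suml.
  rewrite exchange_big /=.
  transitivity (\sum_n (j == n)%:R * <<second_der k l, map_mx (d n) F>>).
    apply: eq_bigr => n _; rewrite -gram_inv mulr_suml; apply: eq_bigr => m _.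
    by rewrite /gram (bformC (map_mx (d j) F)); ring.
  rewrite (bigD1 j) //= eqxx mul1r big1 ?addr0 // => n.
  by rewrite eq_sym => /negPf ->; rewrite mul0r.
have cE m : contracted_christoffel m * gram m j =
    \sum_k \sum_l inv_gram k l * (christoffel_sym m k l * gram m j).
  rewrite mulr_suml; apply: eq_bigr => k _; rewrite mulr_suml.
  by apply: eq_bigr => l _; rewrite mulrA.
rewrite !bformDl !bformZl -!/(gram _ j) !cE -big_split /=.
transitivity (\sum_k \sum_l inv_gram k l * <<second_der k l, map_mx (d j) F>>).
  apply: eq_bigr => k _; rewrite -big_split; apply: eq_bigr => l _ /=.
  by rewrite -mulrDr -(gramE k l) sum_ord2.
by rewrite !sum_ord2 /inv_gram /= !addrA.
Qed.

End Christoffel.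

Lemma umbilic_normal_products (A : comNzRingType) n (F xi : 'rV[A]_n) f :
  bform F F = -1 -> bform xi xi = -1 -> bform F xi = 0 -> f ^+ 2 = 4%:R ->
  bform (2%:R *: F - f *: xi) (2%:R *: F - f *: xi) = - 8%:R /\
  bform F (2%:R *: F - f *: xi) = - 2%:R.
Proof.
move=> FF xixi Fxi ff; rewrite !bformE FF xixi (bformC xi F) Fxi; split; last by ring.
by apply: (eq_from_sub2 (k := -1) (l := 0) ff (erefl 0)); ring.
Qed.

(** * Frames adapted to a direction field *)

Section AdaptedFrame.
Variables (A : comNzRingType) (d : 'I_2 -> A -> A).
Hypothesis der : forall k, derivation (d k).
Hypothesis dC : forall k l a, d k (d l a) = d l (d k a).
Hypothesis torsion_free : forall n (a : A), a *+ n.+1 = 0 -> a = 0.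
Variable F : 'rV[A]_4.
Local Notation "<< v , w >>" := (bform v w) (format "<< v ,  w >>").
Local Notation F0 := (map_mx (d 0) F).
Local Notation F1 := (map_mx (d 1) F).
Hypothesis FF : <<F, F>> = -1.

Lemma position_perp k : <<F, map_mx (d k) F>> = 0.
Proof.
apply: (@torsion_free 1); rewrite mulr2n {1}bformC -(der_bform (der k)) FF.
by rewrite (der_opp (der k)) (der_1 (der k)) oppr0.
Qed.

Definition unit_normal (xi : 'rV[A]_4) :=
  [/\ <<xi, xi>> = -1, <<F, xi>> = 0, <<F0, xi>> = 0 & <<F1, xi>> = 0].

(* The direction of e2 is u0 d_0 + u1 d_1. *)
Record adapted_frame (u0 u1 : A) := AdaptedFrame {
  frame_a0 : A; frame_a1 : A; frame_b0 : A; frame_b1 : A; frame_s : A;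
  frame_b0E : frame_b0 = frame_s * u0;
  frame_b1E : frame_b1 = frame_s * u1;
  frame_e11 : let e1 := map_mx (combine_der (d 0) (d 1) frame_a0 frame_a1) F in
    <<e1, e1>> = 1;
  frame_e22 : let e2 := map_mx (combine_der (d 0) (d 1) frame_b0 frame_b1) F in
    <<e2, e2>> = 1;
  frame_e12 : <<map_mx (combine_der (d 0) (d 1) frame_a0 frame_a1) F,
    map_mx (combine_der (d 0) (d 1) frame_b0 frame_b1) F>> = 0 }.

Variable r : A.
Hypothesis rE : r ^+ 2 * (<<F0, F0>> * <<F1, F1>> - <<F0, F1>> ^+ 2) = 1.

Lemma unit_normal_cross : unit_normal (r *: cross F F0 F1).
Proof.
have [cF c0 c1] := cross_perp F F0 F1.
split; rewrite !bformZr ?bformZl.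
- rewrite cross_norm FF !position_perp.
  by apply: (eq_from_sub2 (k := -1) (l := 0) rE (erefl 0)); ring.
- by rewrite bformC cF mulr0.
- by rewrite bformC c0 mulr0.
by rewrite bformC c1 mulr0.
Qed.

Lemma adapted_frame_exists (u0 u1 s : A) :
  s ^+ 2 * (u0 ^+ 2 * <<F0, F0>> + 2%:R * u0 * u1 * <<F0, F1>>
            + u1 ^+ 2 * <<F1, F1>>) = 1 -> adapted_frame u0 u1.
Proof.
move=> sE; have [e11 e22 e12] := rot_frame rE sE.
apply: (@AdaptedFrame u0 u1 (rot0 F0 F1 r s u0 u1) (rot1 F0 F1 r s u0 u1)
  (s * u0) (s * u1) s) => //; by rewrite /= !combine_derv.
Qed.

Section InFrame.
Variables (u0 u1 : A) (fr : adapted_frame u0 u1).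
Local Notation a0 := (frame_a0 fr).
Local Notation a1 := (frame_a1 fr).
Local Notation b0 := (frame_b0 fr).
Local Notation b1 := (frame_b1 fr).
Local Notation D1 := (combine_der (d 0) (d 1) a0 a1).
Local Notation D2 := (combine_der (d 0) (d 1) b0 b1).
Let e11 := frame_e11 fr.
Let e22 := frame_e22 fr.
Let e12 := frame_e12 fr.

Lemma coord_der_frame f k : d k f =
  <<map_mx (d k) F, map_mx D1 F>> * D1 f + <<map_mx (d k) F, map_mx D2 F>> * D2 f.
Proof.
have [D00 D01 D10 D11] := frame_dual e11 e22 e12.
rewrite {2 4}/combine_der; elim/ord2_ind: k.
  transitivity (1 * d 0 f + 0 * d 1 f); first by rewrite mul1r mul0r addr0.
  by rewrite -D00 -D01; ring.
transitivity (0 * d 0 f + 1 * d 1 f); first by rewrite mul1r mul0r add0r.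
by rewrite -D10 -D11; ring.
Qed.

Lemma frame_der_level f : u0 * d 0 f + u1 * d 1 f = 0 -> D2 f = 0.
Proof.
by rewrite /combine_der (frame_b0E fr) (frame_b1E fr) -!mulrA -mulrDr => ->; rewrite mulr0.
Qed.

Lemma frame_der_const f : (forall k, d k f = 0) -> D1 f = 0 /\ D2 f = 0.
Proof. by move=> f0; rewrite /combine_der !f0; split; ring. Qed.

Lemma frame_der_eq0 f : D1 f = 0 -> D2 f = 0 -> forall k, d k f = 0.
Proof. by move=> f1 f2 k; rewrite coord_der_frame f1 f2 !mulr0 addr0. Qed.

Lemma frame_derv_eq0 n (v : 'rV[A]_n) : map_mx D1 v = 0 -> map_mx D2 v = 0 ->
  forall k, map_mx (d k) v = 0.
Proof.
move=> v1 v2 k; apply/rowP => i; rewrite !mxE; apply: frame_der_eq0.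
  by have := congr1 (fun w : 'rV_n => w 0 i) v1; rewrite !mxE.
by have := congr1 (fun w : 'rV_n => w 0 i) v2; rewrite !mxE.
Qed.

(** Since [D2 f = 0], both coordinate derivatives of [f] are multiples of [D1 f]; whatever
    annihilates [D1 f] annihilates the gradient. *)
Lemma frame_regular f : D2 f = 0 ->
  (forall b, d 0 f * b = 0 -> d 1 f * b = 0 -> b = 0) -> regular (D1 f).
Proof.
move=> f2 reg b fb; apply: reg; rewrite coord_der_frame f2 mulr0 addr0;
  by rewrite -mulrA fb mulr0.
Qed.

Local Notation c := (contracted_christoffel d F a0 a1 b0 b1).
Definition frame_tension := coord_tension (d 0) (d 1) F a0 a1 b0 b1 (c 0) (c 1).
Definition frame_bilaplacian :=
  coord_laplacian (d 0) (d 1) F a0 a1 b0 b1 (c 0) (c 1) frame_tension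
  - 2%:R *: frame_tension.

Variable xi : 'rV[A]_4.
Hypothesis xi_normal : unit_normal xi.

Let c0E : << c 0 *: F0 + c 1 *: F1, F0>> =
  <<frame_trace a0 a1 b0 b1 (map_mx (d 0) F0) (map_mx (d 0) F1)
    (map_mx (d 1) F0) (map_mx (d 1) F1), F0>>.
Proof. exact: contracted_christoffelE e11 e22 e12 0. Qed.
Let c1E : << c 0 *: F0 + c 1 *: F1, F1>> =
  <<frame_trace a0 a1 b0 b1 (map_mx (d 0) F0) (map_mx (d 0) F1)
    (map_mx (d 1) F0) (map_mx (d 1) F1), F1>>.
Proof. exact: contracted_christoffelE e11 e22 e12 1. Qed.

Lemma frame_tension_normal : exists f, frame_tension = f *: xi.
Proof.
have [xixi Fxi F0xi F1xi] := xi_normal.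
have := coord_tensionE (der 0) (der 1) torsion_free e11 e22 xixi FF e12 F0xi F1xi Fxi c0E c1E.
by rewrite -/frame_tension => ->; eexists.
Qed.

(** Differentiating <F, W> = -1 once and twice makes W orthogonal to the first and second
    derivatives of F. Of the second fundamental form only the component - g_kl F remains to be
    paired with W, and the trace of g is 2. *)
Lemma frame_tension_parallel W : (forall k, map_mx (d k) W = 0) ->
  <<F, W>> = -1 -> <<frame_tension, W>> = 2%:R.
Proof.
move=> dW FW.
have dFW k : <<map_mx (d k) F, W>> = 0.
  have := der_bform (der k) F W; rewrite FW (der_opp (der k)) (der_1 (der k)).
  by rewrite dW bform0r addr0 oppr0.
have ddFW k l : <<map_mx (d k) (map_mx (d l) F), W>> = 0.
  have := der_bform (der k) (map_mx (d l) F) W; rewrite dFW (der_0 (der k)).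
  by rewrite dW bform0r addr0.
have ddFF k l : <<map_mx (d k) (map_mx (d l) F), F>> = - gram d F k l.
  have := der_bform (der k) (map_mx (d l) F) F.
  rewrite bformC position_perp (der_0 (der k)) /gram (bformC (map_mx (d k) F)).
  by move=> H; apply: (eq_from_sub2 (k := -1) (l := 0) H (erefl 0)); ring.
have nE k l : <<coord_nabla F (d k) (map_mx (d l) F), W>> = gram d F k l.
  by rewrite /coord_nabla bformDl bformZl ddFW ddFF FW; ring.
rewrite /frame_tension /coord_tension.
rewrite bformDl bformNl (bformDl (c 0 *: _)) !bformZl !dFW !mulr0 addr0 subr0.
rewrite /frame_trace !bformDl !bformZl !nE.
have two : <<map_mx D1 F, map_mx D1 F>> + <<map_mx D2 F, map_mx D2 F>> = 2%:R :> A.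
  by rewrite e11 e22.
rewrite -two !combine_derv !bformDl !bformDr !bformZl !bformZr /gram; ring.
Qed.

Lemma parallel_unique W W' :
  (forall k, map_mx (d k) W = 0) -> (forall k, map_mx (d k) W' = 0) ->
  <<F, W>> = -1 -> <<F, W'>> = -1 -> W = W'.
Proof.
move=> dW dW' FW FW'; have [f tE] := frame_tension_normal.
have [xixi Fxi F0xi F1xi] := xi_normal.
have dFW k V : (forall k, map_mx (d k) V = 0) -> <<F, V>> = -1 ->
    <<map_mx (d k) F, V>> = 0.
  move=> dV FV; have := der_bform (der k) F V.
  by rewrite FV (der_opp (der k)) (der_1 (der k)) dV bform0r addr0 oppr0.
have e_perp x0 x1 V : (forall k, map_mx (d k) V = 0) -> <<F, V>> = -1 ->
    <<V, map_mx (combine_der (d 0) (d 1) x0 x1) F>> = 0.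
  move=> dV FV; rewrite combine_derv bformC bformDl !bformZl !dFW //.
  by rewrite !mulr0 addr0.
have xiW : f * <<xi, W>> = 2%:R by rewrite -bformZl -tE frame_tension_parallel.
have xiW' : f * <<xi, W'>> = 2%:R by rewrite -bformZl -tE frame_tension_parallel.
(* [f] is cancelled without assuming it regular: 2 = f <xi, W> turns twice the difference into a
   multiple of f (<xi, W> - <xi, W'>) = 0. *)
have xi_eq : <<xi, W>> = <<xi, W'>>.
  apply/eqP; rewrite -subr_eq0; apply/eqP; apply: (@torsion_free 1).
  rewrite -mulr_natl -xiW mulrAC mulrBr xiW xiW' subrr.
  by rewrite mul0r.
have Fe x0 x1 : <<F, map_mx (combine_der (d 0) (d 1) x0 x1) F>> = 0.
  by rewrite combine_derv bformDr !bformZr !position_perp !mulr0 addr0.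
have exi x0 x1 : <<map_mx (combine_der (d 0) (d 1) x0 x1) F, xi>> = 0.
  by rewrite combine_derv bformDl !bformZl F0xi F1xi !mulr0 addr0.
have expand := orthonormal_expand e11 e22 xixi FF e12 (exi _ _) (exi _ _)
  (Fe _ _) (Fe _ _) Fxi.
rewrite [LHS]expand [RHS]expand !e_perp // !(bformC _ xi) xi_eq.
by rewrite !(bformC _ F) FW FW'.
Qed.

Variable f : A.
Hypothesis tensionE : frame_tension = f *: xi.
Hypothesis biharmonic : frame_bilaplacian = 0.

Lemma frame_tension_perp :
  <<frame_tension, F>> = 0 /\ forall k, <<frame_tension, map_mx (d k) F>> = 0.
Proof.
have [xixi Fxi F0xi F1xi] := xi_normal; rewrite tensionE.
split=> [|k]; first by rewrite bformZl bformC Fxi mulr0.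
by elim/ord2_ind: k; rewrite bformZl bformC ?F0xi ?F1xi mulr0.
Qed.

Lemma adapted_no_gradient :
  regular f -> regular (D1 f) -> D2 f = 0 -> 45%:R * f ^+ 2 + 28%:R = 0.
Proof.
have [xixi Fxi F0xi F1xi] := xi_normal.
exact: (biharmonic_no_gradient (der 0) (der 1) (dC 0 1) torsion_free e11 e22
  xixi FF e12 F0xi F1xi Fxi c0E c1E tensionE biharmonic).
Qed.

Lemma adapted_constant_mean_curvature x :
  regular f -> D1 f = 0 -> D2 f = 0 -> x * (4%:R - f ^+ 2) = 1 -> f ^+ 2 = 0.
Proof.
have [xixi Fxi F0xi F1xi] := xi_normal.
exact: (biharmonic_constant_mean_curvature (der 0) (der 1) (dC 0 1)
  torsion_free e11 e22 xixi FF e12 F0xi F1xi Fxi c0E c1E tensionE biharmonic).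
Qed.

Lemma adapted_umbilic :
  regular f -> D1 f = 0 -> D2 f = 0 -> f ^+ 2 = 4%:R ->
  exists a b : A, a ^+ 2 + b ^+ 2 = 0 /\ (a = 0 -> b = 0 ->
    forall k, map_mx (d k) (2%:R *: F - f *: xi) = 0).
Proof.
have [xixi Fxi F0xi F1xi] := xi_normal.
move=> rf f1 f2 ff.
have [a [b [ab W]]] := biharmonic_umbilic (der 0) (der 1) (dC 0 1)
  torsion_free e11 e22 xixi FF e12 F0xi F1xi Fxi c0E c1E tensionE biharmonic
  rf f1 f2 ff.
exists a, b; split=> // a_eq0 b_eq0; have [W1 W2] := W a_eq0 b_eq0.
exact: frame_derv_eq0.
Qed.

End InFrame.
End AdaptedFrame.

(** * Functions of class C^k *)

Section Smooth.
Variable R : realType.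

Lemma near_eq_differentiable (V W : normedModType R) (f g : V -> W) x :
  (\near x, f x = g x) -> differentiable f x -> differentiable g x.
Proof.
move=> fg df; have [dfc dfE] := (diff_locallyP _ _).1 df.
have gE : g \o shift x = cst (g x) + 'd f x +o_ 0 id.
  apply/eqaddoP => e e0.
  have /eqaddoP/(_ e e0) := dfE; apply: filter_app.
  have : \forall h \near 0, f (h + x) = g (h + x).
    by move: fg; rewrite (near_shift 0 x) /=; apply: filterS => h; rewrite subr0.
  apply: filterS => h fgh.
  by rewrite /= !fctE /= fgh (nbhs_singleton fg).
by apply/diff_locallyP; rewrite (diff_unique dfc gE).
Qed.

Variables V W : normedModType R.
Implicit Types (f g : V -> W) (U : set V) (k : nat).

Lemma class_C_ext k U f g : open U -> (forall x, U x -> f x = g x) ->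
  class_C k U f -> class_C k U g.
Proof.
move=> oU; elim: k f g => [|k IH] f g fg /=.
  move=> fc x Ux; have near_fg : \near x, f x = g x.
    by have := open_nbhs_nbhs (conj oU Ux); apply: filterS => y /fg.
  rewrite /prop_for /continuous_at -fg //.
  apply: cvg_trans (fc x Ux); exact: near_eq_cvg.
move=> [fd fD]; split.
  move=> x Ux; apply: near_eq_differentiable (fd x Ux).
  by have := open_nbhs_nbhs (conj oU Ux); apply: filterS => y /fg.
move=> v; apply: IH (fD v) => x Ux; apply: near_eq_derive.
by have := open_nbhs_nbhs (conj oU Ux); apply: filterS => y /fg.
Qed.

Lemma class_C_subset k U U' f : U' `<=` U -> class_C k U f -> class_C k U' f.
Proof.
move=> sU; elim: k f => [|k IH] f /=; first by move=> fc x /sU; exact: fc.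
by move=> [fd fD]; split=> [x /sU/fd//|v]; apply: IH (fD v).
Qed.

Lemma class_CS k U f : class_C k.+1 U f -> class_C k U f.
Proof.
elim: k f => [|k IH] f [fd fD]; last by split=> // v; exact: IH (fD v).
by move=> x /fd; exact: differentiable_continuous.
Qed.

Lemma class_C_cst k U (w : W) : class_C k U (cst w).
Proof.
elim: k w => [|k IH] w /=; first by move=> x _; exact: cvg_cst.
split=> [x _|v]; first exact: differentiable_cst.
rewrite (_ : 'D_v (cst w) = cst 0); first exact: IH.
by apply/funext => x; rewrite derive_cst.
Qed.

Lemma class_CD k U f g : open U -> class_C k U f -> class_C k U g ->
  class_C k U (f \+ g).
Proof.
move=> oU; elim: k f g => [|k IH] f g /=.
  by move=> fc gc x Ux; apply: continuousD; [exact: fc|exact: gc].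
move=> [fd fD] [gd gD]; split=> [x Ux|v].
  by apply: differentiableD; [exact: fd|exact: gd].
apply: class_C_ext (IH _ _ (fD v) (gD v)) => // x Ux.
by rewrite /= -deriveD //; apply: diff_derivable; [exact: fd|exact: gd].
Qed.

Lemma class_CN k U f : open U -> class_C k U f -> class_C k U (\- f).
Proof.
move=> oU; elim: k f => [|k IH] f /=.
  by move=> fc x Ux; apply: continuousN; exact: fc.
move=> [fd fD]; split=> [x Ux|v]; first by apply: differentiableN; exact: fd.
apply: class_C_ext (IH _ (fD v)) => // x Ux.
by rewrite /= -deriveN //; apply: diff_derivable; exact: fd.
Qed.

End Smooth.

Section SmoothReal.
Variables (R : realType) (V : normedModType R).
Implicit Types (f g : V -> R) (U : set V) (k : nat).

Lemma class_CM k U f g : open U -> class_C k U f -> class_C k U g ->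
  class_C k U (f \* g).
Proof.
move=> oU; elim: k f g => [|k IH] f g.
  by move=> fc gc x Ux; apply: continuousM; [exact: fc|exact: gc].
move=> fC gC; have [fd fD] := fC; have [gd gD] := gC; split=> [x Ux|v].
  by apply: differentiableM; [exact: fd|exact: gd].
have := class_CD oU (IH _ _ (class_CS fC) (gD v)) (IH _ _ (class_CS gC) (fD v)).
apply: class_C_ext => // x Ux.
apply/esym; apply: (deriveM (f := f) (g := g)); apply: diff_derivable.
  exact: fd.
exact: gd.
Qed.

Lemma class_CV k U f : open U -> (forall x, U x -> f x != 0) ->
  class_C k U f -> class_C k U (fun x => (f x)^-1).
Proof.
move=> oU f0; elim: k => [|k IH].
  by move=> fc x Ux; apply: continuousV; [exact: f0|exact: fc].
move=> fC; have [fd fD] := fC; split=> [x Ux|v].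
  by apply: differentiableV; [exact: fd|exact: f0].
have fVC := IH (class_CS fC).
have := class_CN oU (class_CM oU (class_CM oU fVC fVC) (fD v)).
apply: class_C_ext => // x Ux.
rewrite deriveV ?f0 //; last by apply: diff_derivable; exact: fd.
by rewrite /= scaleNr expr2 invfM.
Qed.

Lemma class_C_sqrt k U f : open U -> (forall x, U x -> 0 < f x) ->
  class_C k U f -> class_C k U (fun x => Num.sqrt (f x)).
Proof.
move=> oU f0; elim: k => [|k IH].
  move=> fc x Ux; apply: continuous_comp; first exact: fc.
  exact: sqrt_continuous.
move=> fC; have [fd fD] := fC.
have sqrtd (y : R) : 0 < y -> differentiable (@Num.sqrt R) y.
  by move=> y0; apply/derivable1_diffP; have [] := is_derive1_sqrt y0.
split=> [x Ux|v].
  by apply: differentiable_comp; [exact: fd|apply/sqrtd/f0].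
have sC := IH (class_CS fC).
have s0 x : U x -> Num.sqrt (f x) != 0 by move=> Ux; rewrite gt_eqF // sqrtr_gt0 f0.
have := class_CM oU (class_CM oU (class_C_cst k U (2^-1 : R)) (class_CV oU s0 sC)) (fD v).
apply: class_C_ext => // x Ux /=.
have fdx := fd _ Ux; have sdx := sqrtd _ (f0 _ Ux).
rewrite [RHS]deriveE; last exact: differentiable_comp.
have E (y : R) : 'd (@Num.sqrt R) (f x) y = y * 'D_1 (@Num.sqrt R) (f x).
  rewrite deriveE // -[in LHS](mulr1 y).
  by rewrite [LHS]linearZ.
by rewrite diff_comp // /= E -deriveE // derive_sqrt ?f0 // invfM mulrC.
Qed.

End SmoothReal.

Lemma class_C_coord (R : realType) (V : normedModType R) n k (U : set V)
    (f : V -> 'rV[R]_n) (i : 'I_n) : open U ->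
  class_C k U f -> class_C k U (fun x => f x 0 i).
Proof.
move=> oU; elim: k f => [|k IH] f.
  move=> fc x Ux.
  apply: (@continuous_comp _ _ _ f (fun N : 'rV[R]_n => N 0 i)); first exact: fc.
  exact: coord_continuous.
move=> [fd fD]; split=> [x Ux|v].
  apply: (@differentiable_comp _ _ _ _ f (fun N : 'rV[R]_n => N 0 i)).
    exact: fd.
  exact: differentiable_coord.
apply: class_C_ext (IH _ (fD v)) => // x Ux.
by rewrite derive_mx ?mxE //; apply: diff_derivable; exact: fd.
Qed.

(** * Mean values and the symmetry of second derivatives *)

Section MeanValue.
Variables (R : realType) (V : normedModType R).
Implicit Types (f : V -> R) (U : set V).

Lemma derive_line f (x v : V) (t : R) : derivable f (t *: v + x) v ->
  is_derive t 1 (fun s : R => f (s *: v + x)) ('D_v f (t *: v + x)).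
Proof.
move=> fd; have fdE := fd; move: fd; rewrite /derivable.
suff E : (fun h : R => h^-1 *: (((fun s : R => f (s *: v + x)) \o shift t) (h *: 1)
     - f (t *: v + x))) =
   (fun h : R => h^-1 *: ((f \o shift (t *: v + x)) (h *: v) - f (t *: v + x))).
  by move=> fd; apply: DeriveDef; rewrite /derivable /derive /= E.
apply/funext => h /=; congr (_ *: (f _ - _)).
by rewrite -[h *: 1]/(h * 1) mulr1 scalerDl addrA.
Qed.

Lemma mean_value_line f (x v : V) (h : R) : 0 < h ->
  (forall t, 0 <= t <= h -> differentiable f (t *: v + x)) ->
  exists2 t, 0 < t < h & f (h *: v + x) - f x = h * 'D_v f (t *: v + x).
Proof.
move=> h0 fd.
have dl t : 0 <= t <= h -> is_derive t 1 (fun s : R => f (s *: v + x)) ('D_v f (t *: v + x)).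
  by move=> th; apply/derive_line/diff_derivable/fd.
have [||t tI] := @MVT R (fun s => f (s *: v + x)) (fun t => 'D_v f (t *: v + x)) 0 h h0.
- by move=> t; rewrite in_itv /= => /andP[t0 th]; apply: dl; rewrite !ltW.
- apply: derivable_within_continuous => t; rewrite in_itv /= => tI.
  by have [] := dl t tI.
rewrite subr0 scale0r add0r mulrC => E.
by exists t => //; move: tI; rewrite in_itv.
Qed.

(** The mean value theorem is used twice: for the difference of [f] between the two sides of the
    parallelogram parallel to v, then for the derivative along v as a function of the position along
    w. *)
Lemma second_difference U f (x v w : V) (h : R) : 0 < h -> class_C 2 U f ->
  (forall s t, 0 <= s <= h -> 0 <= t <= h -> U (t *: w + (s *: v + x))) ->
  exists s t, [/\ 0 <= s <= h, 0 <= t <= h &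
    f (h *: w + (h *: v + x)) - f (h *: v + x) - f (h *: w + x) + f x
    = h * (h * 'D_w ('D_v f) (t *: w + (s *: v + x)))].
Proof.
move=> h0 [fd fD] hU; have [fvd _] := fD v.
have hh : 0 <= h <= h by rewrite lexx ltW.
have oh : 0 <= (0 : R) <= h by rewrite lexx ltW.
pose g (t s : R) := f (s *: v + (t *: w + x)).
have gd t s : 0 <= t <= h -> 0 <= s <= h ->
    is_derive s 1 (g t) ('D_v f (s *: v + (t *: w + x))).
  by move=> th sh; apply/derive_line/diff_derivable/fd; rewrite addrCA; exact: hU.
pose dg s := 'D_v f (s *: v + (h *: w + x)) - 'D_v f (s *: v + (0 *: w + x)).
have [||s sI] := @MVT R (g h \- g 0) dg 0 h h0.
- move=> s; rewrite in_itv /= => /andP[s0 sh].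
  by apply: is_deriveB; apply: gd; rewrite ?(ltW s0) ?(ltW sh).
- apply: derivable_within_continuous => s; rewrite in_itv /= => sI.
  by apply: derivableB; [have [] := gd h s hh sI|have [] := gd 0 s oh sI].
rewrite in_itv /= in sI; case/andP: sI => /ltW s0 /ltW sh.
rewrite subr0 /g /dg /= !scale0r !add0r => E.
have [t /andP[/ltW t0 /ltW th]] := @mean_value_line ('D_v f) (s *: v + x) w h h0
  (fun t tI => fvd _ (hU s t (introT andP (conj s0 sh)) tI)).
rewrite [in X in X -> _](addrCA (h *: w)) => E2; rewrite E2 in E.
exists s, t; rewrite s0 sh t0 th; split => //.
by rewrite (mulrC h (h * _)) -E addrCA [in f (h *: v + x)]addrC; ring.
Qed.

(* Both sides are limits of the second difference quotient of f at x. *)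
Lemma derive_comm U f x v w : open U -> U x -> class_C 2 U f ->
  'D_v ('D_w f) x = 'D_w ('D_v f) x.
Proof.
move=> oU Ux fC; apply/eqP; apply: contraT => neq.
set a := 'D_v ('D_w f) x; set b := 'D_w ('D_v f) x.
pose e := `|a - b| / 2.
have e0 : 0 < e by rewrite divr_gt0 // normr_gt0 subr_eq0.
have D2c v' w' : {for x, continuous ('D_v' ('D_w' f))}.
  by have [_ /(_ w') [_ /(_ v')]] := fC; exact.
have : nbhs x [set y | [/\ U y, `|a - 'D_v ('D_w f) y| < e & `|b - 'D_w ('D_v f) y| < e]].
  have N1 := open_nbhs_nbhs (conj oU Ux).
  have N2 : nbhs x [set y | `|a - 'D_v ('D_w f) y| < e].
    by have /cvgrPdist_lt/(_ e e0) := D2c v w.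
  have N3 : nbhs x [set y | `|b - 'D_w ('D_v f) y| < e].
    by have /cvgrPdist_lt/(_ e e0) := D2c w v.
  have FF : Filter (nbhs x) by exact: nbhs_filter.
  have N := @filterI _ (nbhs x) FF _ _ (@filterI _ (nbhs x) FF _ _ N1 N2) N3.
  apply: (@filterS _ (nbhs x) FF _ _ _ N).
  move=> y [[Uy Ny] Ny'].
  split. exact: Uy. exact: Ny. exact: Ny'.
case/nbhs_ballP => r /= r0 rP.
(* With this [h] the parallelogram at x spanned by h v and h w lies in the ball of radius [r]; the 1
   keeps the denominator positive. *)
pose h := r / (1 + `|v| + `|w|).
have den0 : 0 < 1 + `|v| + `|w| by rewrite -addrA ltr_wpDr // addr_ge0.
have h0 : 0 < h by rewrite divr_gt0.
have inball s t v' w' : 0 <= s <= h -> 0 <= t <= h -> `|v'| + `|w'| = `|v| + `|w| ->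
    ball x r (t *: w' + (s *: v' + x)).
  move=> /andP[s0 sh] /andP[t0 th] vw; rewrite -ball_normE /= addrA opprD addrCA subrr addr0 normrN.
  apply: le_lt_trans (ler_normD _ _) _; rewrite !normrZ !ger0_norm //.
  have hr : h * (`|v| + `|w|) < r.
    by rewrite /h mulrAC ltr_pdivrMr // ltr_pM2l // -addrA ltrDr.
  apply: le_lt_trans hr; rewrite -vw mulrDr addrC.
  by apply: lerD; apply: ler_wpM2r.
have [s [t [sI tI E1]]] := @second_difference U f x v w h h0 fC
  (fun s t sI tI => let: And3 u _ _ := rP _ (inball s t v w sI tI erefl) in u).
have [s' [t' [sI' tI' E2]]] := @second_difference U f x w v h h0 fC
  (fun s t sI tI => let: And3 u _ _ := rP _ (inball s t w v sI tI (addrC _ _)) in u).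
have [_ _ B1] := rP _ (inball s t v w sI tI erefl).
have [_ A1 _] := rP _ (inball s' t' w v sI' tI' (addrC _ _)).
(* The second difference is symmetric in v and w, so the two mixed derivatives take a common value,
   each at its own nearby point. Each of [a] and [b] is within half of their distance of that
   value. *)
have eqAB : 'D_v ('D_w f) (t' *: v + (s' *: w + x)) = 'D_w ('D_v f) (t *: w + (s *: v + x)).
  apply: (@mulfI _ h); first by rewrite gt_eqF.
  apply: (@mulfI _ h); first by rewrite gt_eqF.
  rewrite -[RHS]E1 -[LHS]E2 (addrCA (h *: v)).
  by rewrite -!addrA; congr (_ + _); rewrite addrCA.
rewrite -eqAB distrC in B1.
have := ltrD A1 B1; rewrite -splitr => /(le_lt_trans (ler_distD _ _ _)).
by rewrite ltxx.
Qed.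

End MeanValue.

(** * The ring of smooth functions on an open set *)

(** The point witnesses that the set is nonempty, which makes 1 differ from 0 in the ring of
    functions on it. *)
Record pointed_open (V : topologicalType) := PointedOpen {
  open_carrier :> set V;
  open_carrierP : open open_carrier;
  open_point : V;
  open_pointP : open_carrier open_point }.

Section SmoothRing.
Variables (R : realType) (V : normedModType R) (U : pointed_open V).
Local Notation C := (open_carrier U).

(* Vanishing outside U makes equality of these functions Leibniz equality. *)
Record smooth_fun := SmoothFun {
  smooth_val :> V -> R;
  smooth_valP : smooth C smooth_val;
  smooth_out : forall x, ~ C x -> smooth_val x = 0 }.

Lemma smooth_funP (f g : smooth_fun) : (forall x, C x -> f x = g x) -> f = g.
Proof.
case: f g => [f fs f0] [g gs g0] /= fg.
have {}fg : f = g.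
  by apply/funext => x; have [/fg//|nUx] := pselect (C x); rewrite f0 // g0.
by subst g; congr SmoothFun; exact: Prop_irrelevance.
Qed.

HB.instance Definition _ := gen_eqMixin smooth_fun.
HB.instance Definition _ := gen_choiceMixin smooth_fun.

Let oU : open C := open_carrierP U.

Definition cutoff (f : V -> R) (x : V) : R := if pselect (C x) then f x else 0.

Lemma cutoffE f x : C x -> cutoff f x = f x.
Proof. by rewrite /cutoff; case: pselect. Qed.

Lemma cutoff_out f x : ~ C x -> cutoff f x = 0.
Proof. by rewrite /cutoff; case: pselect. Qed.

Lemma cutoff_smooth f : smooth C f -> smooth C (cutoff f).
Proof.
by move=> fs k; apply: class_C_ext (fs k) => // x Ux; rewrite cutoffE.
Qed.

(* Opacity keeps unification from unfolding the ring operations below. *)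
Fact smooth_lift f : smooth C f ->
  {g : smooth_fun | forall x, C x -> g x = f x}.
Proof.
move=> fs; exists (SmoothFun (cutoff_smooth fs) (@cutoff_out f)) => x Cx.
exact: cutoffE.
Qed.

Definition mk_smooth f (fs : smooth C f) : smooth_fun := sval (smooth_lift fs).

Lemma mk_smoothE f (fs : smooth C f) x : C x -> mk_smooth fs x = f x.
Proof. exact: (svalP (smooth_lift fs)). Qed.

Fact add_lift : {op : smooth_fun -> smooth_fun -> smooth_fun |
  forall f g x, C x -> op f g x = f x + g x}.
Proof.
have lift (f g : smooth_fun) : {h : smooth_fun | forall x, C x -> h x = f x + g x}.
  by apply: smooth_lift => k; apply: class_CD => //; exact: smooth_valP.
by exists (fun f g => sval (lift f g)) => f g; exact: (svalP (lift f g)).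
Qed.

Fact opp_lift : {op : smooth_fun -> smooth_fun |
  forall f x, C x -> op f x = - f x}.
Proof.
have lift (f : smooth_fun) : {h : smooth_fun | forall x, C x -> h x = - f x}.
  by apply: smooth_lift => k; apply: class_CN => //; exact: smooth_valP.
by exists (fun f => sval (lift f)) => f; exact: (svalP (lift f)).
Qed.

Fact mul_lift : {op : smooth_fun -> smooth_fun -> smooth_fun |
  forall f g x, C x -> op f g x = f x * g x}.
Proof.
have lift (f g : smooth_fun) : {h : smooth_fun | forall x, C x -> h x = f x * g x}.
  by apply: smooth_lift => k; apply: class_CM => //; exact: smooth_valP.
by exists (fun f g => sval (lift f g)) => f g; exact: (svalP (lift f g)).
Qed.

Fact cst_lift (c : R) : {h : smooth_fun | forall x, C x -> h x = c}.
Proof. by apply: smooth_lift => k; exact: class_C_cst. Qed.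

Let add := sval add_lift.
Let opp := sval opp_lift.
Let mul := sval mul_lift.
Let zero := sval (cst_lift 0).
Let one := sval (cst_lift 1).
Let addE f g x : C x -> add f g x = f x + g x. Proof. exact: (svalP add_lift). Qed.
Let oppE f x : C x -> opp f x = - f x. Proof. exact: (svalP opp_lift). Qed.
Let mulE f g x : C x -> mul f g x = f x * g x. Proof. exact: (svalP mul_lift). Qed.
Let zeroE x : C x -> zero x = 0. Proof. exact: (svalP (cst_lift 0)). Qed.
Let oneE x : C x -> one x = 1. Proof. exact: (svalP (cst_lift 1)). Qed.

Let addA : associative add.
Proof. by move=> f g h; apply: smooth_funP => x Ux; rewrite !addE // addrA. Qed.
Let addC : commutative add.
Proof. by move=> f g; apply: smooth_funP => x Ux; rewrite !addE // addrC. Qed.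
Let add0 : left_id zero add.
Proof. by move=> f; apply: smooth_funP => x Ux; rewrite addE // zeroE // add0r. Qed.
Let addN : left_inverse zero opp add.
Proof. by move=> f; apply: smooth_funP => x Ux; rewrite addE // oppE // zeroE // addNr. Qed.
Let mulA : associative mul.
Proof. by move=> f g h; apply: smooth_funP => x Ux; rewrite !mulE // mulrA. Qed.
Let mulC : commutative mul.
Proof. by move=> f g; apply: smooth_funP => x Ux; rewrite !mulE // mulrC. Qed.
Let mul1 : left_id one mul.
Proof. by move=> f; apply: smooth_funP => x Ux; rewrite mulE // oneE // mul1r. Qed.
Let mulD : left_distributive mul add.
Proof.
by move=> f g h; apply: smooth_funP => x Ux; rewrite addE // !mulE // addE // mulrDl.
Qed.
Let one_neq0 : one != zero.
Proof.
apply/eqP => /(congr1 (fun f : smooth_fun => f (open_point U))).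
have Up := open_pointP U.
by rewrite oneE // zeroE //; apply/eqP; exact: oner_neq0.
Qed.

HB.instance Definition _ := GRing.isZmodule.Build smooth_fun addA addC add0 addN.
HB.instance Definition _ :=
  GRing.Zmodule_isComNzRing.Build smooth_fun mulA mulC mul1 mulD one_neq0.

Implicit Types f g : smooth_fun.

Lemma smooth_addE f g x : (f + g) x = f x + g x.
Proof.
have [Ux|nUx] := pselect (C x); first exact: addE.
by rewrite !smooth_out // addr0.
Qed.

Lemma smooth_oppE f x : (- f) x = - f x.
Proof.
have [Ux|nUx] := pselect (C x); first exact: oppE.
by rewrite !smooth_out // oppr0.
Qed.

Lemma smooth_mulE f g x : (f * g) x = f x * g x.
Proof.
have [Ux|nUx] := pselect (C x); first exact: mulE.
by rewrite !smooth_out // mulr0.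
Qed.

Lemma smooth_0E x : (0 : smooth_fun) x = 0.
Proof.
by have [Ux|nUx] := pselect (C x); [exact: zeroE|rewrite smooth_out].
Qed.

Lemma smooth_1E x : C x -> (1 : smooth_fun) x = 1.
Proof. exact: oneE. Qed.

Lemma smooth_mulrnE f n x : (f *+ n) x = f x *+ n.
Proof.
elim: n => [|n IH]; first by rewrite !mulr0n smooth_0E.
by rewrite !mulrS smooth_addE IH.
Qed.

Lemma smooth_natE n x : C x -> (n%:R : smooth_fun) x = n%:R.
Proof. by move=> Ux; rewrite smooth_mulrnE smooth_1E. Qed.

Lemma smooth_expE f n x : C x -> (f ^+ n) x = f x ^+ n.
Proof.
move=> Ux; elim: n => [|n IH]; first by rewrite !expr0 smooth_1E.
by rewrite !exprS smooth_mulE IH.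
Qed.

Lemma smooth_sumE (I : Type) (r : seq I) (F : I -> smooth_fun) x :
  (\sum_(i <- r) F i) x = \sum_(i <- r) F i x.
Proof.
elim: r => [|i r IH]; first by rewrite !big_nil smooth_0E.
by rewrite !big_cons smooth_addE IH.
Qed.

Lemma smooth_torsion_free n f : f *+ n.+1 = 0 -> f = 0.
Proof.
move=> fn; apply: smooth_funP => x _; rewrite smooth_0E; apply/eqP.
have := congr1 (fun g : smooth_fun => g x) fn.
by rewrite smooth_mulrnE smooth_0E => /eqP; rewrite mulrn_eq0.
Qed.

Lemma smooth_inverse f : (forall x, C x -> f x != 0) -> exists g, g * f = 1.
Proof.
move=> f0; have gs : smooth C (fun x => (f x)^-1).
  by move=> k; apply: class_CV => //; exact: smooth_valP.
exists (mk_smooth gs); apply: smooth_funP => x Ux.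
by rewrite smooth_mulE mk_smoothE // smooth_1E // mulVf // f0.
Qed.

Lemma smooth_sqrt f : (forall x, C x -> 0 < f x) -> exists g, g ^+ 2 * f = 1.
Proof.
move=> f0; have gs : smooth C (fun x => (Num.sqrt (f x))^-1).
  move=> k; apply: class_CV => //.
    by move=> x Ux; rewrite gt_eqF // sqrtr_gt0 f0.
  by apply: class_C_sqrt => //; exact: smooth_valP.
exists (mk_smooth gs); apply: smooth_funP => x Ux.
rewrite smooth_mulE smooth_expE // mk_smoothE // smooth_1E // exprVn.
by rewrite sqr_sqrtr ?ltW ?f0 // mulVf // gt_eqF // f0.
Qed.

Fact derive_lift : {D : V -> smooth_fun -> smooth_fun |
  forall v f x, C x -> D v f x = 'D_v f x}.
Proof.
have lift v (f : smooth_fun) : {h : smooth_fun | forall x, C x -> h x = 'D_v f x}.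
  by apply: smooth_lift => k; have [_ /(_ v)] := smooth_valP f k.+1.
by exists (fun v f => sval (lift v f)) => v f; exact: (svalP (lift v f)).
Qed.

Definition smooth_derive := sval derive_lift.

Lemma smooth_deriveE v f x : C x -> smooth_derive v f x = 'D_v f x.
Proof. exact: (svalP derive_lift). Qed.

Lemma smooth_derivable v f x : C x -> derivable f x v.
Proof.
by move=> Ux; apply: diff_derivable; have [fd _] := smooth_valP f 1; exact: fd.
Qed.

Lemma smooth_derivation v : derivation (smooth_derive v).
Proof.
split=> f g; apply: smooth_funP => x Ux.
  rewrite smooth_addE !smooth_deriveE // -deriveD; try exact: smooth_derivable.
  by congr ('D_v _ x); apply/funext => y; rewrite smooth_addE.
rewrite smooth_addE !smooth_mulE !smooth_deriveE //.
have -> : (f * g : smooth_fun) = (f \* g) :> (V -> R).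
  by apply/funext => y; rewrite smooth_mulE.
rewrite addrC [_ * g x]mulrC.
by apply: (deriveM (f := f) (g := g)); exact: smooth_derivable.
Qed.

Lemma smooth_derive_comm v w f :
  smooth_derive v (smooth_derive w f) = smooth_derive w (smooth_derive v f).
Proof.
have nearU y u : C y -> \near y, smooth_derive u f y = 'D_u f y.
  move=> Uy; have := open_nbhs_nbhs (conj oU Uy).
  by apply: filterS => z Uz; rewrite smooth_deriveE.
apply: smooth_funP => x Ux.
apply: etrans (smooth_deriveE v (smooth_derive w f) Ux) _.
apply: etrans (esym (smooth_deriveE w (smooth_derive v f) Ux)).
apply: etrans (near_eq_derive v (nearU x w Ux)) _.
apply: etrans (esym (near_eq_derive w (nearU x v Ux))).
exact: (derive_comm v w oU Ux (smooth_valP f 2)).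
Qed.

End SmoothRing.

(** * Tension fields in an adapted frame *)

Lemma form_bform (R : realType) n (x y : 'rV[R]_n) : form x y = bform x y.
Proof. by []. Qed.

Section DeriveForm.
Variables (R : realType) (V : normedModType R).

Lemma is_derive_mx m n (M : V -> 'M[R]_(m, n)) (dM : 'M[R]_(m, n)) x v :
  (forall i j, is_derive x v (fun y => M y i j) (dM i j)) -> is_derive x v M dM.
Proof.
move=> H; have dMx : derivable M x v.
  by apply/derivable_mxP => i j; have [] := H i j.
apply: DeriveDef => //; rewrite derive_mx //; apply/matrixP => i j.
by rewrite mxE; have [_ ->] := H i j.
Qed.

Lemma is_derive_coord m n (M : V -> 'M[R]_(m, n)) (dM : 'M[R]_(m, n)) x v i j :
  is_derive x v M dM -> is_derive x v (fun y => M y i j) (dM i j).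
Proof.
move=> [dMx <-]; apply: DeriveDef; first by move/derivable_mxP: dMx; exact.
by rewrite derive_mx // mxE.
Qed.

Lemma is_derive_scale n (a : V -> R) (f : V -> 'rV[R]_n) x v da df :
  is_derive x v a da -> is_derive x v f df ->
  is_derive x v (fun y => a y *: f y) (da *: f x + a x *: df).
Proof.
move=> Ha Hf; apply: is_derive_mx => i j; rewrite !mxE.
under eq_fun do rewrite mxE.
have Hij := is_derive_coord i j Hf.
have H : is_derive x v (fun y => a y * f y i j) _ := is_deriveM Ha Hij.
by apply: is_derive_eq H _; rewrite addrC [da * _]mulrC.
Qed.

Lemma is_derive_form n (f g : V -> 'rV[R]_n) x v df dg :
  is_derive x v f df -> is_derive x v g dg ->
  is_derive x v (fun y => form (f y) (g y)) (form df (g x) + form (f x) dg).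
Proof.
move=> Hf Hg; rewrite /form -big_split /=.
pose h (i : 'I_n) y := if (i < 2)%N then f y 0 i * g y 0 i else - (f y 0 i * g y 0 i).
rewrite (_ : (fun y => _) = \sum_(i < n) h i); last first.
  by apply/funext => y; rewrite fct_sumE.
apply: is_derive_sum => i; have Hfi := is_derive_coord 0 i Hf.
have Hgi := is_derive_coord 0 i Hg;
have Hm : is_derive x v (fun y => f y 0 i * g y 0 i) _ := is_deriveM Hfi Hgi.
rewrite /h; case: ifP => _.
  by apply: is_derive_eq Hm _; rewrite addrC [df _ _ * _]mulrC.
by apply: is_derive_eq (is_deriveN Hm) _; rewrite opprD addrC [df _ _ * _]mulrC.
Qed.

End DeriveForm.

(** * Curvature of the anti de Sitter space *)

Section Curvature.
Variable R : realType.
Implicit Types (p u v w x y : 'rV[R]_4).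

Let is_derive_form_l u x y : is_derive x y (form u) (form u y).
Proof.
apply: is_derive_eq (is_derive_form (is_derive_cst u x y) (is_derive_id x y)) _.
by rewrite form_bform bform0l add0r.
Qed.

Lemma is_derive_tproj u x y :
  is_derive x y (fun z => tproj z u) (form u y *: x + form u x *: y).
Proof.
have H := is_derive_scale (is_derive_form_l u x y) (is_derive_id x y).
by apply: is_derive_eq (is_deriveD (is_derive_cst u x y) H) _; rewrite add0r.
Qed.

(** Constant curvature -1. The chosen extensions have zero Lie bracket at [p], so only the two
    second covariant derivatives contribute, each a single term. *)
Lemma RN_tangent p u v w : form p p = -1 ->
  form p u = 0 -> form p v = 0 -> form p w = 0 ->
  RN p u v w = form u w *: v - form v w *: u.
Proof.
move=> pp pu pv pw; rewrite /RN /curvature_op.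
have tprojp z : form p z = 0 -> tproj p z = z.
  by rewrite /tproj form_bform bformC -form_bform => ->; rewrite scale0r addr0.
(* The flat derivative of the extension of w along that of v, as a polynomial in x. It is written
   for all x in R^4, because it is differentiated once more at [p]. *)
pose D v x := (form w v + 2%:R * (form v x * form w x)) *: x + form w x *: v.
have nablaE v' : nabla (fun x => tproj x v') (fun x => tproj x w) =
    fun x => D v' x + form (D v' x) x *: x.
  apply/funext => x; rewrite /nabla; have [_ ->] := is_derive_tproj w x (tproj x v').
  rewrite {1}/tproj /D; set E := _ + _ *: tproj x v'; suff -> : E = D v' x by [].
  rewrite /E /D /tproj !form_bform !bformE; apply/rowP => i; rewrite !mxE; ring.
have second u' v' : form p u' = 0 -> form p v' = 0 ->
    nabla (fun x => tproj x u') (nabla (fun x => tproj x v') (fun x => tproj x w)) p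
    = form w u' *: v'.
  move=> pu' pv'; rewrite nablaE {1}/nabla (tprojp _ pu').
  have dv' : is_derive p u' (form v') (form v' u') by exact: is_derive_form_l.
  have dw : is_derive p u' (form w) (form w u') by exact: is_derive_form_l.
  have v'p : form v' p = 0 by rewrite form_bform bformC.
  have wp : form w p = 0 by rewrite form_bform bformC.
  have dD : is_derive p u' (D v') (form w v' *: u' + form w u' *: v').
    have d1 : is_derive p u' (fun x => 2%:R * (form v' x * form w x)) _ :=
      is_deriveM (is_derive_cst (2%:R : R) p u') (is_deriveM dv' dw).
    have d2 : is_derive p u' (fun x => form w v' + 2%:R * (form v' x * form w x)) _ :=
      is_deriveD (is_derive_cst (form w v') p u') d1.
    have d3 := is_deriveD (is_derive_scale d2 (is_derive_id p u'))
      (is_derive_scale dw (is_derive_cst v' p u')).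
    apply: is_derive_eq d3 _ => /=.
    by rewrite v'p wp !(mul0r, mulr0, scale0r, scaler0, add0r, addr0).
  have [_ ->] : is_derive p u' (fun x => D v' x + form (D v' x) x *: x)
      (form w u' *: v').
    have d3 := is_deriveD dD (is_derive_scale (is_derive_form dD (is_derive_id p u')) (is_derive_id p u')).
    apply: is_derive_eq d3 _ => /=.
    rewrite /D v'p wp !form_bform !bformE -!form_bform pp.
    rewrite (_ : form u' p = 0) ?v'p; last by rewrite form_bform bformC.
    by rewrite pu'; apply/rowP => i; rewrite !mxE; ring.
  apply: tprojp; rewrite form_bform bformZr -form_bform pv' mulr0.
  by [].
rewrite !second // !(form_bform w) !(bformC w) -!form_bform.
have LB : lie_bracket (fun x => tproj x u) (fun x => tproj x v) p = 0.
  rewrite /lie_bracket (tprojp _ pu) (tprojp _ pv).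
  have [_ ->] := is_derive_tproj v p u; have [_ ->] := is_derive_tproj u p v.
  rewrite (_ : form v p = 0) 1?(_ : form u p = 0); last 2 first.
    by rewrite form_bform bformC.
    by rewrite form_bform bformC.
  by rewrite !scale0r !addr0 !form_bform bformC subrr.
by rewrite /nabla LB derive0 /tproj (form_bform 0) bform0l scale0r addr0 subr0.
Qed.

End Curvature.

(** * Evaluation of vectors over the ring of functions *)

Section Evaluation.
Variables (R : realType) (V : normedModType R) (U : pointed_open V).
Local Notation A := (smooth_fun U).

Fact evalv_lift n : {ev : V -> 'rV[A]_n -> 'rV[R]_n |
  forall x v i, ev x v 0 i = v 0 i x}.
Proof. by exists (fun x (v : 'rV[A]_n) => \row_i v 0 i x) => x v i; rewrite mxE. Qed.

Definition evalv n := sval (evalv_lift n).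

Lemma evalvE n x (v : 'rV[A]_n) i : evalv x v 0 i = v 0 i x.
Proof. exact: (svalP (evalv_lift n)). Qed.

Lemma evalvD n x (v w : 'rV[A]_n) : evalv x (v + w) = evalv x v + evalv x w.
Proof. by apply/rowP => i; rewrite evalvE !mxE !evalvE smooth_addE. Qed.

Lemma evalvN n x (v : 'rV[A]_n) : evalv x (- v) = - evalv x v.
Proof. by apply/rowP => i; rewrite evalvE !mxE !evalvE smooth_oppE. Qed.

Lemma evalvZ n x a (v : 'rV[A]_n) : evalv x (a *: v) = a x *: evalv x v.
Proof. by apply/rowP => i; rewrite evalvE !mxE !evalvE smooth_mulE. Qed.

Lemma evalv0 n x : evalv x (0 : 'rV[A]_n) = 0.
Proof. by apply/rowP => i; rewrite evalvE !mxE smooth_0E. Qed.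

Lemma evalv_sum n x (I : Type) (r : seq I) (f : I -> 'rV[A]_n) :
  evalv x (\sum_(i <- r) f i) = \sum_(i <- r) evalv x (f i).
Proof.
elim: r => [|i r IH]; first by rewrite !big_nil evalv0.
by rewrite !big_cons evalvD IH.
Qed.

Lemma form_evalv n x (v w : 'rV[A]_n) :
  form (evalv x v) (evalv x w) = (bform v w) x.
Proof.
rewrite /form /bform smooth_sumE; apply: eq_bigr => i _; rewrite !evalvE.
by case: ifP => _; rewrite ?smooth_oppE smooth_mulE.
Qed.

Lemma evalv_derive n u x (v : 'rV[A]_n) (G : V -> 'rV[R]_n) :
  open_carrier U x -> (forall y, open_carrier U y -> G y = evalv y v) ->
  'D_u G x = evalv x (map_mx (smooth_derive u) v).
Proof.
move=> Ux GE.
have H : is_derive x u (fun y => evalv y v) (evalv x (map_mx (smooth_derive u) v)).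
  apply: is_derive_mx => i j; rewrite ord1 evalvE mxE smooth_deriveE //.
  rewrite (_ : (fun y => _) = v 0 j :> (V -> R)).
    exact/derivableP/smooth_derivable.
  by apply/funext => y; rewrite evalvE.
have [_ <-] := H; apply: near_eq_derive.
have := open_nbhs_nbhs (conj (open_carrierP U) Ux).
by apply: filterS => y /GE.
Qed.

Lemma scalar_derive u x (a : A) (g : V -> R) :
  open_carrier U x -> (forall y, open_carrier U y -> g y = a y) ->
  'D_u g x = smooth_derive u a x.
Proof.
move=> Ux gE; rewrite smooth_deriveE //; apply: near_eq_derive.
have := open_nbhs_nbhs (conj (open_carrierP U) Ux).
by apply: filterS => y /gE.
Qed.

End Evaluation.

(** * Identification of the coordinate formulas with those over the ring *)

Section Immersion.
Variables (R : realType) (U : pointed_open 'rV[R]_2).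
Variable F : 'rV[R]_2 -> 'rV[R]_4.
Local Notation A := (smooth_fun U).
Local Notation C := (open_carrier U).
Hypothesis FC : smooth C F.
Hypothesis FAdS : forall x, C x -> form (F x) (F x) = -1.

Let coord_smooth (i : 'I_4) : smooth C (fun x => F x 0 i).
Proof. by move=> k; apply: class_C_coord (FC k); exact: open_carrierP. Qed.

Definition immersion_vec : 'rV[A]_4 := \row_i mk_smooth (coord_smooth i).
Local Notation Fv := immersion_vec.

Fact pd_lift : {D : 'I_2 -> A -> A |
  forall k a, D k a = smooth_derive (delta_mx 0 k) a}.
Proof. by exists (fun k => smooth_derive (delta_mx 0 k)). Qed.

Definition smooth_pd := sval pd_lift.

Lemma smooth_pdE k a : smooth_pd k a = smooth_derive (delta_mx 0 k) a.
Proof. exact: (svalP pd_lift). Qed.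

Lemma map_smooth_pdE k n (v : 'rV[A]_n) :
  map_mx (smooth_pd k) v = map_mx (smooth_derive (delta_mx 0 k)) v.
Proof. by apply/rowP => i; rewrite !mxE smooth_pdE. Qed.

Lemma smooth_pd_derivation k : derivation (smooth_pd k).
Proof.
have [dD dM] := smooth_derivation U (delta_mx 0 k : 'rV[R]_2).
by split=> a b; rewrite !smooth_pdE ?dD ?dM.
Qed.

Lemma smooth_pdC k l a :
  smooth_pd k (smooth_pd l a) = smooth_pd l (smooth_pd k a).
Proof. rewrite !smooth_pdE; exact: smooth_derive_comm. Qed.

Local Notation d := smooth_pd.
Local Notation d0 := (d 0).
Local Notation d1 := (d 1).
Local Notation "<< v , w >>" := (bform v w) (format "<< v ,  w >>").

Lemma immersion_vecE x : C x -> F x = evalv x Fv.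
Proof. by move=> Cx; apply/rowP => i; rewrite evalvE mxE mk_smoothE. Qed.

Lemma immersion_vec_norm : <<Fv, Fv>> = -1.
Proof.
apply: smooth_funP => x Cx.
by rewrite -form_evalv -immersion_vecE // FAdS // smooth_oppE smooth_1E.
Qed.

Lemma immersion_pd k x : C x -> pd k F x = evalv x (map_mx (d k) Fv).
Proof. by move=> Cx; rewrite map_smooth_pdE; apply: evalv_derive Cx _; exact: immersion_vecE. Qed.

Lemma evalv_tproj x (w : 'rV[A]_4) : C x ->
  tproj (F x) (evalv x w) = evalv x (w + <<w, Fv>> *: Fv).
Proof.
by move=> Cx; rewrite /tproj immersion_vecE // form_evalv -evalvZ -evalvD.
Qed.

Lemma evalv_pnabla k x (w : 'rV[A]_4) (G : 'rV[R]_2 -> 'rV[R]_4) : C x ->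
  (forall y, C y -> G y = evalv y w) ->
  pnabla F G k x = evalv x (coord_nabla Fv (d k) w).
Proof.
move=> Cx GE; rewrite /pnabla /pd (evalv_derive _ Cx GE) -map_smooth_pdE.
exact: evalv_tproj.
Qed.

Lemma metricE k l x : C x ->
  metric F x k l = <<map_mx (d k) Fv, map_mx (d l) Fv>> x.
Proof. by move=> Cx; rewrite mxE !immersion_pd // form_evalv. Qed.

Variables a0 a1 b0 b1 : A.
Local Notation D1 := (combine_der d0 d1 a0 a1).
Local Notation D2 := (combine_der d0 d1 b0 b1).
Local Notation e1 := (map_mx D1 Fv).
Local Notation e2 := (map_mx D2 Fv).
Hypotheses (e11 : <<e1, e1>> = 1) (e22 : <<e2, e2>> = 1) (e12 : <<e1, e2>> = 0).

Local Notation gi := (inv_gram a0 a1 b0 b1).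

Let der := smooth_pd_derivation.
Let dC := smooth_pdC.

Lemma invmx_metricE k l x : C x -> invmx (metric F x) k l = gi k l x.
Proof.
move=> Cx; pose G : 'M[R]_2 := \matrix_(k, l) gi k l x.
have MG : metric F x *m G = 1%:M.
  apply/matrixP => i j; rewrite !mxE.
  transitivity ((\sum_l gram d Fv i l * gi l j) x).
    rewrite smooth_sumE; apply: eq_bigr => m _.
    by rewrite metricE // mxE smooth_mulE.
  by rewrite (gram_inv e11 e22 e12) smooth_natE.
have [Mu _] := mulmx1_unit MG.
have -> : invmx (metric F x) = G by rewrite -[LHS]mulmx1 -MG mulKmx.
by rewrite mxE.
Qed.

Local Notation Gam := (christoffel_sym d Fv a0 a1 b0 b1).

Lemma christoffelE m k l x : C x -> christoffel F m k l x = Gam m k l x.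
Proof.
move=> Cx; rewrite /christoffel smooth_sumE mulr_sumr; apply: eq_bigr => n _.
have pdg i j h : pd i (fun y => metric F y j h : R) x = d i (gram d Fv j h) x.
  rewrite smooth_pdE; apply: (@scalar_derive R _ U (delta_mx 0 i) x (gram d Fv j h) _ Cx) => y Cy.
  by rewrite metricE.
rewrite !pdg invmx_metricE // smooth_mulE -smooth_addE -smooth_oppE -smooth_addE.
rewrite (der_gram der dC) smooth_mulE smooth_natE // mulrCA; congr (_ * _).
by rewrite mulrA mulVf ?mul1r // pnatr_eq0.
Qed.

Local Notation c := (contracted_christoffel d Fv a0 a1 b0 b1).

Lemma laplacianE (G H : 'I_2 -> 'I_2 -> 'rV[A]_4) (N : 'I_2 -> 'rV[A]_4) x : C x ->
  \sum_k \sum_l invmx (metric F x) k l *: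
    (evalv x (G k l) - \sum_m christoffel F m k l x *: evalv x (N m))
  = evalv x (frame_trace a0 a1 b0 b1 (G 0 0) (G 0 1) (G 1 0) (G 1 1)
             - (c 0 *: N 0 + c 1 *: N 1)).
Proof.
move=> Cx; transitivity (evalv x
   (\sum_k \sum_l gi k l *: (G k l - \sum_m Gam m k l *: N m))).
  rewrite evalv_sum; apply: eq_bigr => k _; rewrite evalv_sum.
  apply: eq_bigr => l _; rewrite evalvZ invmx_metricE //; congr (_ *: _).
  rewrite evalvD evalvN evalv_sum; congr (_ - _).
  by apply: eq_bigr => m _; rewrite evalvZ christoffelE.
by rewrite inv_gram_trace.
Qed.

Local Notation T := (coord_tension d0 d1 Fv a0 a1 b0 b1 (c 0) (c 1)).

Lemma tensionE x : C x -> tension F x = evalv x T.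
Proof.
move=> Cx; rewrite /tension /coord_tension.
rewrite -(laplacianE (fun k l => coord_nabla Fv (d k) (map_mx (d l) Fv))
  (fun k l => 0) (fun m => map_mx (d m) Fv) Cx).
apply: eq_bigr => k _; apply: eq_bigr => l _; congr (_ *: (_ - _)).
  by apply: evalv_pnabla Cx _ => y Cy; exact: immersion_pd.
by apply: eq_bigr => m _; rewrite immersion_pd.
Qed.

(** For a normal T the curvature formula gives R(d_k F, T) d_l F = g_kl T, and the trace of g_kl
    with the inverse metric is 2. *)
Lemma bitensionE x : C x -> <<T, Fv>> = 0 ->
  (forall k, <<T, map_mx (d k) Fv>> = 0) ->
  bitension F x = evalv x
    (coord_laplacian d0 d1 Fv a0 a1 b0 b1 (c 0) (c 1) T - 2%:R *: T).
Proof.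
move=> Cx TF TFk; rewrite evalvD /bitension; congr (_ + _).
  rewrite /rough_laplacian opprK /coord_laplacian.
  rewrite -(laplacianE (fun k l => coord_nabla Fv (d k) (coord_nabla Fv (d l) T))
    (fun k l => 0) (fun m => coord_nabla Fv (d m) T) Cx).
  have nT k y : C y -> pnabla F (tension F) k y = evalv y (coord_nabla Fv (d k) T).
    by move=> Cy; apply: evalv_pnabla Cy _; exact: tensionE.
  apply: eq_bigr => k _; apply: eq_bigr => l _; congr (_ *: (_ - _)).
    by apply: evalv_pnabla Cx _ => y Cy; exact: nT.
  by apply: eq_bigr => m _; rewrite nT.
rewrite evalvN evalvZ smooth_natE //; congr (- _).
have FkF k : <<Fv, map_mx (d k) Fv>> = 0.
  apply: (@smooth_torsion_free _ _ U 1).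
  rewrite mulr2n {1}bformC -(der_bform (der k)) immersion_vec_norm.
  by rewrite (der_opp (der k)) (der_1 (der k)) oppr0.
have RNE k l : RN (F x) (pd k F x) (tension F x) (pd l F x) =
    gram d Fv k l x *: evalv x T.
  have ev0 (v w : 'rV[A]_4) : <<v, w>> = 0 -> form (evalv x v) (evalv x w) = 0.
    by move=> vw; rewrite form_evalv vw smooth_0E.
  rewrite RN_tangent ?FAdS // ?tensionE // ?immersion_pd // ?immersion_vecE //.
  - by rewrite (ev0 _ _ (TFk l)) scale0r subr0 form_evalv.
  - exact: (ev0 _ _ (FkF k)).
  - by apply: ev0; rewrite bformC.
  - exact: (ev0 _ _ (FkF l)).
transitivity (\sum_k (\sum_l gram d Fv k l * gi l k) x *: evalv x T).
  apply: eq_bigr => k _; rewrite smooth_sumE scaler_suml; apply: eq_bigr => l _.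
  by rewrite RNE invmx_metricE // scalerA smooth_mulE mulrC inv_gramC.
rewrite sum_ord2 !(gram_inv e11 e22 e12) !eqxx /= smooth_natE //.
by rewrite -scalerDl.
Qed.

End Immersion.

Lemma form_comb (R : realType) n (u0 u1 : R) (x y : 'rV[R]_n) :
  form (u0 *: x + u1 *: y) (u0 *: x + u1 *: y)
  = u0 ^+ 2 * form x x + 2%:R * u0 * u1 * form x y + u1 ^+ 2 * form y y.
Proof. by rewrite !form_bform !bformE (bformC y x); ring. Qed.

Lemma rV2_delta (R : realType) (v : 'rV[R]_2) :
  v = v 0 0 *: delta_mx 0 0 + v 0 1 *: delta_mx 0 1.
Proof. by rewrite {1}[v]row_sum_delta sum_ord2. Qed.

Lemma derive_pd (R : realType) (W : normedModType R) (F : 'rV[R]_2 -> W) x v :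
  differentiable F x -> 'D_v F x = v 0 0 *: pd 0 F x + v 0 1 *: pd 1 F x.
Proof.
move=> Fd; rewrite /pd !deriveE // {1}[v]rV2_delta.
by rewrite linearD !linearZ.
Qed.

(** The value of the form at (-g01, g00) is g00 times the determinant. *)
Lemma quadratic_form_det (R : realFieldType) (g00 g01 g11 : R) :
  (forall u0 u1, ~ (u0 = 0 /\ u1 = 0) ->
    0 < u0 ^+ 2 * g00 + 2%:R * u0 * u1 * g01 + u1 ^+ 2 * g11) ->
  0 < g00 * g11 - g01 ^+ 2.
Proof.
move=> H; have g00_gt0 : 0 < g00.
  have := H 1 0; rewrite expr1n mul1r !mulr0 !mul0r expr0n /= mul0r !addr0.
  by apply => -[/eqP]; rewrite oner_eq0.
rewrite -(pmulr_rgt0 _ g00_gt0).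
have -> : g00 * (g00 * g11 - g01 ^+ 2) =
  (- g01) ^+ 2 * g00 + 2%:R * (- g01) * g00 * g01 + g00 ^+ 2 * g11 by ring.
by apply: H => -[_ g00E]; rewrite g00E ltxx in g00_gt0.
Qed.

Lemma smooth_quadraticE (R : realType) (V : normedModType R) (U : pointed_open V)
    (u0 u1 g00 g01 g11 : smooth_fun U) x : open_carrier U x ->
  (u0 ^+ 2 * g00 + 2%:R * u0 * u1 * g01 + u1 ^+ 2 * g11) x
  = u0 x ^+ 2 * g00 x + 2%:R * u0 x * u1 x * g01 x + u1 x ^+ 2 * g11 x.
Proof.
move=> Ux; rewrite 2!smooth_addE (smooth_mulE (u0 ^+ 2)) (smooth_mulE (u1 ^+ 2)).
by rewrite !(smooth_expE _ _ Ux) 3!smooth_mulE (smooth_natE _ Ux).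
Qed.

(** * Frames and normals of a space-like immersion *)

Section LocalFrame.
Variables (R : realType) (U : pointed_open 'rV[R]_2).
Variable F : 'rV[R]_2 -> 'rV[R]_4.
Local Notation A := (smooth_fun U).
Local Notation C := (open_carrier U).
Hypothesis FC : smooth C F.
Hypothesis FAdS : forall x, C x -> form (F x) (F x) = -1.
Hypothesis Fspace : forall x v, C x -> v != 0 -> 0 < form ('D_v F x) ('D_v F x).
Local Notation Fv := (immersion_vec FC).
Local Notation d := (@smooth_pd R U).
Local Notation d0 := (@smooth_pd R U 0).
Local Notation d1 := (@smooth_pd R U 1).
Local Notation "<< v , w >>" := (bform v w) (format "<< v ,  w >>").
Local Notation F0 := (map_mx d0 Fv).
Local Notation F1 := (map_mx d1 Fv).

Let FvFv : <<Fv, Fv>> = -1 := immersion_vec_norm FC FAdS.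

Let metric_pos (u0 u1 : R) x : C x -> ~ (u0 = 0 /\ u1 = 0) ->
  0 < u0 ^+ 2 * <<F0, F0>> x + 2 * u0 * u1 * <<F0, F1>> x + u1 ^+ 2 * <<F1, F1>> x.
Proof.
move=> Cx u_neq0.
have [v [v00 v01]] : exists v : 'rV[R]_2, v 0 0 = u0 /\ v 0 1 = u1.
  exists (u0 *: delta_mx 0 0 + u1 *: delta_mx 0 1).
  by split; rewrite !mxE /=; ring.
have v0 : v != 0.
  by apply/eqP => v0; apply: u_neq0; rewrite -v00 -v01 v0 !mxE.
have := Fspace Cx v0; rewrite derive_pd; last by have [+ _] := FC 1; apply.
rewrite v00 v01.
rewrite !(immersion_pd FC _ Cx).
rewrite form_comb !form_evalv.
exact.
Qed.

Let det_exists : exists r : A, r ^+ 2 * (<<F0, F0>> * <<F1, F1>> - <<F0, F1>> ^+ 2) = 1.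
Proof.
apply: smooth_sqrt => x Cx.
rewrite smooth_addE smooth_mulE smooth_oppE smooth_expE //.
by apply: quadratic_form_det => u0 u1; exact: metric_pos.
Qed.

Let der := @smooth_pd_derivation R U.
Let dC := @smooth_pdC R U.
Let torsion_free n (f : A) : f *+ n.+1 = 0 -> f = 0.
Proof. exact: smooth_torsion_free. Qed.

Lemma smooth_vec_eq (v w : 'rV[A]_4) :
  (forall x, C x -> evalv x v = evalv x w) -> v = w.
Proof.
move=> vw; apply/rowP => i; apply: smooth_funP => x Cx.
by rewrite -!evalvE vw.
Qed.

Lemma adapted_frame_smooth (u0 u1 : A) :
  (forall x, C x -> ~ (u0 x = 0 /\ u1 x = 0)) -> exists fr : adapted_frame d Fv u0 u1, True.
Proof.
move=> u_neq0; have [r rE] := det_exists.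
have [s sE] : exists s : A, s ^+ 2 * (u0 ^+ 2 * <<F0, F0>>
    + 2%:R * u0 * u1 * <<F0, F1>> + u1 ^+ 2 * <<F1, F1>>) = 1.
  apply: smooth_sqrt => x Cx; rewrite smooth_quadraticE //.
  exact: metric_pos Cx (u_neq0 x Cx).
by exists (adapted_frame_exists rE sE).
Qed.

Lemma unit_normal_smooth : exists xi : 'rV[A]_4, unit_normal d Fv xi.
Proof.
have [r rE] := det_exists.
by exists (r *: cross Fv F0 F1); exact: (unit_normal_cross der torsion_free FvFv rE).
Qed.

(** [tension F] does not refer to a frame, so the [f] found with one auxiliary frame, whose e2 has
    the direction d_0, serves every frame, including those constructed from [f] itself. *)
Lemma tension_normal : exists xi f,
  [/\ unit_normal d Fv xi,
      forall u0 u1 (fr : adapted_frame d Fv u0 u1), frame_tension fr = f *: xi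
    & forall x, C x -> tension F x = f x *: evalv x xi].
Proof.
have [xi xiN] := unit_normal_smooth.
have [|fr0 _] := @adapted_frame_smooth 1 0.
  by move=> x Cx [/eqP]; rewrite smooth_1E // oner_eq0.
have [f fE] := frame_tension_normal der torsion_free FvFv fr0 xiN.
have frE u0 u1 (fr : adapted_frame d Fv u0 u1) x : C x ->
    tension F x = evalv x (frame_tension fr).
  move=> Cx; exact: (tensionE (frame_e11 fr) (frame_e22 fr) (frame_e12 fr) Cx).
exists xi, f; split=> [|u0 u1 fr|x Cx]; first exact: xiN.
  apply: etrans fE; apply: smooth_vec_eq => x Cx.
  exact: etrans (esym (frE _ _ fr x Cx)) (frE _ _ fr0 x Cx).
apply: etrans (frE _ _ fr0 x Cx) _; rewrite fE; exact: evalvZ.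
Qed.

Hypothesis Fbih : forall x, C x -> bitension F x = 0.

Lemma frame_biharmonic u0 u1 (fr : adapted_frame d Fv u0 u1) :
  frame_bilaplacian fr = 0.
Proof.
have [xi [f [xiN tE _]]] := tension_normal.
have [TF TFk] := frame_tension_perp xiN (tE _ _ fr).
apply: smooth_vec_eq => x Cx; apply: etrans (esym (evalv0 _ 4 x)).
apply: etrans (Fbih Cx); apply/esym;
  exact: (bitensionE FAdS (frame_e11 fr) (frame_e22 fr) (frame_e12 fr) Cx TF TFk).
Qed.

End LocalFrame.

(** * Local classification *)

Section Dichotomy.
Variables (R : realType) (U : pointed_open 'rV[R]_2).
Variable F : 'rV[R]_2 -> 'rV[R]_4.
Local Notation A := (smooth_fun U).
Local Notation C := (open_carrier U).
Local Notation d := (@smooth_pd R U).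
Local Notation "<< v , w >>" := (bform v w) (format "<< v ,  w >>").

(** This is -f^2. Unlike f it depends neither on a choice of normal nor on the open set over which a
    normal was constructed. *)
Definition tension_sq x := form (tension F x) (tension F x).
Local Notation q := tension_sq.

Hypothesis FC : smooth C F.
Hypothesis FAdS : forall x, C x -> form (F x) (F x) = -1.
Hypothesis Fspace : forall x v, C x -> v != 0 -> 0 < form ('D_v F x) ('D_v F x).
Hypothesis Fbih : forall x, C x -> bitension F x = 0.
Local Notation Fv := (immersion_vec FC).

Lemma formZZ n a (v w : 'rV[R]_n) : form (a *: v) (a *: w) = a ^+ 2 * form v w.
Proof. by rewrite !form_bform !bformE mulrA expr2. Qed.

Lemma smooth_regular (f : A) : (forall x, C x -> f x != 0) -> regular f.
Proof.
move=> f0 b fb; apply: smooth_funP => x Cx.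
have /eqP := congr1 (fun g : A => g x) fb.
by rewrite smooth_mulE smooth_0E mulf_eq0 (negPf (f0 x Cx)) => /eqP.
Qed.

Lemma tension_sqE : exists xi f, [/\ unit_normal d Fv xi,
  forall u0 u1 (fr : adapted_frame d Fv u0 u1), frame_tension fr = f *: xi,
  forall x, C x -> tension F x = f x *: evalv x xi,
  forall x, C x -> q x = - (f x) ^+ 2
  & forall k x, C x -> pd k q x = - (2 * (f x * d k f x))].
Proof.
have [xi [f [xiN tE tFE]]] := tension_normal FC FAdS Fspace.
have [xixi _ _ _] := xiN.
have qE x : C x -> q x = - (f x) ^+ 2.
  move=> Cx; rewrite /q (tFE x Cx) formZZ form_evalv xixi.
  by rewrite smooth_oppE smooth_1E // mulrN1.
exists xi, f; split.
- exact: xiN.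
- exact: tE.
- exact: tFE.
- exact: qE.
move=> k x Cx.
have qE' y : C y -> q y = (- (f * f)) y.
  by move=> Cy; rewrite (qE y Cy) smooth_oppE smooth_mulE expr2.
have := scalar_derive (delta_mx 0 k) Cx qE'.
have [dD dM] := smooth_derivation U (delta_mx 0 k : 'rV[R]_2).
rewrite /pd => ->; rewrite (der_opp (smooth_derivation U _)) dM -smooth_pdE.
by rewrite smooth_oppE smooth_addE !smooth_mulE; congr (- _); ring.
Qed.

Lemma tension_sq_no_gradient : (forall x, C x -> q x != 0) ->
  ~ (forall x, C x -> pd 0 q x != 0 \/ pd 1 q x != 0).
Proof.
have [xi [f [xiN tE _ qE dqE]]] := tension_sqE => q0 dq0.
have f0 x : C x -> f x != 0.
  by move=> Cx; have := q0 x Cx; rewrite qE // oppr_eq0 expf_eq0.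
have df0 x : C x -> ~ (d 1 f x = 0 /\ d 0 f x = 0).
  move=> Cx [f1 f00]; have := dq0 x Cx.
  by rewrite !(dqE _ _ Cx) f1 f00 !mulr0 oppr0 eqxx => -[].
(* (d_1 f, - d_0 f) is tangent to the level lines of f, hence [D2 f = 0] in the resulting frame. *)
have [|fr _] := @adapted_frame_smooth _ _ _ FC Fspace (d 1 f) (- d 0 f).
  move=> x Cx [f1 /eqP]; rewrite smooth_oppE oppr_eq0 => /eqP f00.
  exact: df0 Cx (conj f1 f00).
have f2 : combine_der (d 0) (d 1) (frame_b0 fr) (frame_b1 fr) f = 0.
  by apply: frame_der_level; rewrite mulNr mulrC subrr.
have rf := smooth_regular f0.
have rf1 : regular (combine_der (d 0) (d 1) (frame_a0 fr) (frame_a1 fr) f).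
  apply: (frame_regular f2) => b b0 b1; apply: smooth_funP => x Cx.
  have := congr1 (fun g : A => g x) b0; have := congr1 (fun g : A => g x) b1.
  rewrite /= !smooth_mulE !smooth_0E => /eqP; rewrite mulf_eq0 => /orP[/eqP f1|/eqP //].
  move=> /eqP; rewrite mulf_eq0 => /orP[/eqP f00|/eqP //].
  by case: (df0 x Cx).
have := adapted_no_gradient (@smooth_pd_derivation R U) (@smooth_pdC R U)
  (@smooth_torsion_free _ _ U) (immersion_vec_norm FC FAdS) xiN (tE _ _ fr)
  (frame_biharmonic FAdS Fspace Fbih fr) rf rf1 f2.
move=> /(congr1 (fun g : A => g (open_point U))).
have Cp := open_pointP U.
rewrite /= smooth_addE smooth_mulE !smooth_natE // smooth_expE // smooth_0E.
move=> /eqP; rewrite gt_eqF // ltr_wpDl //.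
by rewrite mulr_ge0 // sqr_ge0.
Qed.

Lemma tension_sq_constant (c : R) : c != 0 -> (forall x, C x -> q x = c) ->
  exists W : 'rV[A]_4, (forall k, map_mx (d k) W = 0) /\
    forall x, C x -> form (evalv x W) (evalv x W) = -8 /\ form (F x) (evalv x W) = -2.
Proof.
have [xi [f [xiN tE _ qE dqE]]] := tension_sqE => c0 qc.
have f0 x : C x -> f x != 0.
  by move=> Cx; have := c0; rewrite -(qc x Cx) qE // oppr_eq0 expf_eq0.
have df k : d k f = 0.
  apply: smooth_funP => x Cx; rewrite smooth_0E.
  have : pd k q x = 0.
    rewrite -(derive_cst c x (delta_mx 0 k)); apply: near_eq_derive.
    have := open_nbhs_nbhs (conj (open_carrierP U) Cx).
    by apply: filterS => y /qc.
  rewrite dqE // => /eqP; rewrite oppr_eq0 !mulf_eq0 pnatr_eq0 /= (negPf (f0 x Cx)).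
  by move/eqP.
have ff x : C x -> f x ^+ 2 = - c by move=> Cx; rewrite -(qc x Cx) qE // opprK.
have rf := smooth_regular f0.
have [|fr _] := @adapted_frame_smooth _ _ _ FC Fspace 1 0.
  by move=> x Cx [/eqP]; rewrite smooth_1E // oner_eq0.
have [f1 f2] := frame_der_const fr df.
(* f^2 is constant, so if it differs from 4 at one point then 4 - f^2 is invertible on the whole
   set, and the case of constant mean curvature gives f = 0. *)
have f4 : f ^+ 2 = 4%:R.
  apply: smooth_funP => x Cx; rewrite smooth_expE // smooth_natE //.
  apply/eqP; apply: contraT => ne4.
  have [y|y yE] := @smooth_inverse _ _ U (4%:R - f ^+ 2).
    move=> Cy; rewrite smooth_addE smooth_natE // smooth_oppE smooth_expE //.
    by rewrite subr_eq0 eq_sym ff // -(ff x Cx).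
  have := adapted_constant_mean_curvature (@smooth_pd_derivation R U) (@smooth_pdC R U)
    (@smooth_torsion_free _ _ U) (immersion_vec_norm FC FAdS) xiN (tE _ _ fr)
    (frame_biharmonic FAdS Fspace Fbih fr) rf f1 f2 yE.
  move=> /(congr1 (fun g : A => g x)).
  by rewrite /= smooth_expE // smooth_0E => /eqP; rewrite expf_eq0 (negPf (f0 x Cx)).
have [a [b [ab WE]]] := adapted_umbilic (@smooth_pd_derivation R U) (@smooth_pdC R U)
    (@smooth_torsion_free _ _ U) (immersion_vec_norm FC FAdS) xiN (tE _ _ fr)
    (frame_biharmonic FAdS Fspace Fbih fr) rf f1 f2 f4.
have ab0 x : C x -> a x = 0 /\ b x = 0.
  move=> Cx; have := congr1 (fun g : A => g x) ab.
  rewrite /= smooth_addE !smooth_expE // smooth_0E => /eqP.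
  by rewrite paddr_eq0 ?sqr_ge0 // !expf_eq0 /= => /andP[/eqP -> /eqP ->].
exists (2%:R *: Fv - f *: xi); split.
  apply: WE; apply: smooth_funP => x Cx; rewrite smooth_0E.
    by have [] := ab0 x Cx.
  by have [] := ab0 x Cx.
have [xixi Fxi _ _] := xiN.
move=> x Cx; rewrite (immersion_vecE FC Cx) !form_evalv.
have FF := immersion_vec_norm FC FAdS.
have [-> ->] : <<2%:R *: Fv - f *: xi, 2%:R *: Fv - f *: xi>> = - 8%:R /\
    <<Fv, 2%:R *: Fv - f *: xi>> = - 2%:R.
  exact: umbilic_normal_products FF xixi Fxi f4.
by rewrite !smooth_oppE !smooth_natE.
Qed.

End Dichotomy.

Lemma smooth_subset (R : realType) (V W : normedModType R) (U U' : set V)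
  (f : V -> W) : U' `<=` U -> smooth U f -> smooth U' f.
Proof. by move=> sU fs k; exact: class_C_subset sU (fs k). Qed.

Section Ball.
Variables (R : realType) (x0 : 'rV[R]_2) (r : R) (r0 : 0 < r).
Definition pointed_ball : pointed_open 'rV[R]_2 :=
  PointedOpen (ball_open x0 r) (ballxx x0 r0).
Local Notation A := (smooth_fun pointed_ball).
Local Notation d := (@smooth_pd R pointed_ball).

Lemma ball_constant (f : A) : (forall k, d k f = 0) ->
  forall x, ball x0 r x -> f x = f x0.
Proof.
move=> df x xB; apply/eqP; rewrite -subr_eq0; apply/eqP.
have fd y : ball x0 r y -> differentiable f y.
  by move=> yB; have [fd _] := smooth_valP f 1; exact: fd.
have segB t : 0 <= t <= 1 -> ball x0 r (t *: (x - x0) + x0).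
  move=> /andP[t0 t1]; move: xB; rewrite -!ball_normE /= opprD addrCA subrr addr0.
  rewrite normrN normrZ ger0_norm // distrC; apply: le_lt_trans.
  by rewrite ler_piMl.
have [t tI] := @mean_value_line R _ f x0 (x - x0) 1 ltr01 (fun t tI => fd _ (segB t tI)).
rewrite scale1r subrK => ->; rewrite mul1r.
have tB : ball x0 r (t *: (x - x0) + x0).
  by apply: segB; case/andP: tI => t0 t1; rewrite !ltW.
rewrite derive_pd; last exact: fd.
have pd0 k : pd k f (t *: (x - x0) + x0) = 0.
  rewrite /pd -(@smooth_deriveE _ _ pointed_ball _ f _ tB) -smooth_pdE df.
  exact: smooth_0E.
by rewrite !pd0 !scaler0 addr0.
Qed.

Lemma ball_constantv n (v : 'rV[A]_n) : (forall k, map_mx (d k) v = 0) ->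
  forall x, ball x0 r x -> evalv x v = evalv x0 v.
Proof.
move=> dv x xB; apply/rowP => i; rewrite !evalvE; apply: ball_constant xB => k.
by have := congr1 (fun w : 'rV_n => w 0 i) (dv k); rewrite !mxE.
Qed.

End Ball.

Section Local.
Variables (R : realType) (U : set 'rV[R]_2) (F : 'rV[R]_2 -> 'rV[R]_4).
Hypothesis oU : open U.
Hypothesis FC : smooth U F.
Hypothesis FAdS : forall x, U x -> form (F x) (F x) = -1.
Hypothesis Fspace : forall x v, U x -> v != 0 -> 0 < form ('D_v F x) ('D_v F x).
Hypothesis Fbih : forall x, U x -> bitension F x = 0.
Local Notation q := (tension_sq F).

(** Otherwise f and grad f are nonzero on an open set [U'] around x, and restricting the immersion
    to [U'] contradicts [tension_sq_no_gradient]. *)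
Lemma tension_sq_stationary x : U x -> q x != 0 -> forall k, pd k q x = 0.
Proof.
move=> Ux qx k; apply/eqP; apply: contraT => dqx.
pose PU := PointedOpen oU Ux.
have [xi [f [_ _ _ qE dqE]]] :=
  @tension_sqE _ PU F FC FAdS Fspace.
have fc g : U `<=` [set y | {for y, continuous (g : smooth_fun PU)}].
  by move=> y Uy; exact: (smooth_valP g 0).
pose d := @smooth_pd R PU.
pose U' : set 'rV[R]_2 := [set y | U y /\ f y != 0 /\ (d 0 f y != 0 \/ d 1 f y != 0)].
have near_neq (g : smooth_fun PU) y : U y -> g y != 0 -> \forall z \near y, g z != 0.
  move=> Uy gy; exact: (cvgr_neq0 (g y) (fc g y Uy) gy).
have oU' : open U'.
  rewrite openE => y [Uy [fy dfy]]; rewrite /interior.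
  have N1 := open_nbhs_nbhs (conj oU Uy); have N2 := near_neq f y Uy fy.
  have N3 : \forall z \near y, d 0 f z != 0 \/ d 1 f z != 0.
    case: dfy => dfy; have := near_neq _ y Uy dfy; apply: filterS => z dz.
      by left.
    by right.
  by apply: filterS3 N1 N2 N3.
have qf y : U y -> q y != 0 -> f y != 0.
  by move=> Uy; rewrite qE // oppr_eq0 expf_eq0.
have fq y : U y -> f y != 0 -> q y != 0.
  by move=> Uy; rewrite qE // oppr_eq0 expf_eq0.
have U'x : U' x.
  split=> //; split; first exact: qf.
  have : d k f x != 0.
    by apply: contra_neq dqx => dfx; rewrite dqE // -/d dfx !mulr0 oppr0.
  by elim/ord2_ind: (k); [left|right].
have sU : U' `<=` U by move=> y [].
pose PU' := PointedOpen oU' U'x.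
have := @tension_sq_no_gradient R PU' F (smooth_subset sU FC)
  (fun y U'y => FAdS (sU y U'y)) (fun y v U'y => Fspace (sU y U'y))
  (fun y U'y => Fbih (sU y U'y)).
case=> [y [Uy [fy _]]|y [Uy [fy dfy]]]; first exact: fq.
rewrite !(dqE _ _ Uy) !oppr_eq0 !mulf_eq0 pnatr_eq0 /= (negPf fy) /=.
exact: dfy.
Qed.

Theorem biharmonic_local x0 : U x0 -> exists2 r, 0 < r & ball x0 r `<=` U /\
  ((forall x, ball x0 r x -> tension F x = 0) \/
   exists w, form w w = -2 /\ forall x, ball x0 r x -> form (F x) w = -1).
Proof.
move=> Ux0; have /nbhs_ballP[r /= r0 rU] := open_nbhs_nbhs (conj oU Ux0).
exists r => //; split=> //.
pose B := pointed_ball x0 r0.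
have FCB : smooth (open_carrier B) F := smooth_subset rU FC.
have FB x : open_carrier B x -> form (F x) (F x) = -1 by move=> /rU; exact: FAdS.
have FspB x v : open_carrier B x -> v != 0 -> 0 < form ('D_v F x) ('D_v F x).
  by move=> /rU; exact: Fspace.
have FbihB x : open_carrier B x -> bitension F x = 0 by move=> /rU; exact: Fbih.
have [xi [f [_ _ tE qE dqE]]] := tension_sqE FCB FB FspB.
pose d := @smooth_pd R B.
(* The derivatives of f^4 carry a factor f, so they vanish where f = 0 as well as where grad f = 0.
   Hence f^4 is constant, and f vanishes everywhere or nowhere in the ball, without any unique
   continuation. *)
pose g : smooth_fun B := (f * f) * (f * f).
have gE x : g x = f x ^+ 4 by rewrite !smooth_mulE; ring.
have ffE x : ball x0 r x -> q x != 0 -> forall k, d k f x = 0.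
  move=> xB qx k; have := tension_sq_stationary (rU x xB) qx k.
  rewrite dqE // => /eqP; rewrite oppr_eq0 !mulf_eq0 pnatr_eq0 /= => /orP[|/eqP//].
  by move=> /eqP fx; move: qx; rewrite qE // fx expr0n /= oppr0 eqxx.
have dg k : d k g = 0.
  have [dD dM] := @smooth_pd_derivation R B k.
  apply: smooth_funP => x xB; rewrite /g /d !dM -/d.
  rewrite !(smooth_addE, smooth_mulE) smooth_0E.
  have [qx|qx] := eqVneq (q x) 0.
    have -> : f x = 0.
      by apply/eqP; move/eqP: qx; rewrite qE // oppr_eq0 expf_eq0.
    by ring.
  by rewrite (ffE x xB qx); ring.
have gconst x : ball x0 r x -> f x ^+ 4 = f x0 ^+ 4.
  by move=> xB; rewrite -!gE; exact: (@ball_constant R x0 r r0 g dg x xB).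
have [f0|f0] := eqVneq (f x0) 0.
  left=> x xB; rewrite tE //.
  have /eqP := gconst x xB; rewrite f0 expr0n /= expf_eq0 /= => /eqP ->.
  by rewrite scale0r.
right; have fn0 x : ball x0 r x -> f x != 0.
  move=> xB; have := expf_neq0 4 f0; rewrite -(gconst x xB).
  by rewrite expf_eq0.
have df k : d k f = 0.
  apply: smooth_funP => x xB; rewrite smooth_0E; apply: ffE => //.
  by rewrite qE // oppr_eq0 expf_eq0 /=; exact: fn0.
have qc x : open_carrier B x -> q x = - f x0 ^+ 2.
  by move=> xB; rewrite qE // (ball_constant df xB).
have [|W [dW WE]] := tension_sq_constant FCB FB FspB FbihB _ qc.
  by rewrite oppr_eq0 expf_eq0.
have [WW _] := WE x0 (ballxx x0 r0).
(* [W] is twice the vector w, which explains -8 and -2 in [WE]. *)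
exists (2^-1 *: evalv x0 W); split.
  by rewrite formZZ WW; lra.
move=> x xB; have [_ FW] := WE x xB.
rewrite -(ball_constantv dW xB) form_bform bformZr -form_bform FW; lra.
Qed.

End Local.

(** * A surface in a hyperplane <x, w> = -1 determines w and is not minimal *)

Section ParallelNormal.
Variables (R : realType) (U : pointed_open 'rV[R]_2).
Variable F : 'rV[R]_2 -> 'rV[R]_4.
Local Notation A := (smooth_fun U).
Local Notation C := (open_carrier U).
Local Notation d := (@smooth_pd R U).
Hypothesis FC : smooth C F.
Hypothesis FAdS : forall x, C x -> form (F x) (F x) = -1.
Hypothesis Fspace : forall x v, C x -> v != 0 -> 0 < form ('D_v F x) ('D_v F x).
Local Notation Fv := (immersion_vec FC).

Definition const_vec n (w : 'rV[R]_n) : 'rV[A]_n := \row_i sval (cst_lift U (w 0 i)).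

Lemma const_vecE n (w : 'rV[R]_n) x : C x -> evalv x (const_vec w) = w.
Proof.
move=> Cx; apply/rowP => i; rewrite evalvE mxE.
exact: (svalP (cst_lift U (w 0 i))).
Qed.

Lemma const_vec_parallel n (w : 'rV[R]_n) k : map_mx (d k) (const_vec w) = 0.
Proof.
apply/rowP => i; rewrite !mxE smooth_pdE; apply: smooth_funP => x Cx.
rewrite smooth_0E -(derive_cst (w 0 i) x (delta_mx 0 k)).
apply/esym; apply: (scalar_derive _ Cx) => y Cy.
by rewrite (svalP (cst_lift U (w 0 i)) y Cy).
Qed.

Let const_form w : (forall x, C x -> form (F x) w = -1) -> bform Fv (const_vec w) = -1.
Proof.
move=> Fw; apply: smooth_funP => x Cx.
rewrite -form_evalv -(immersion_vecE FC Cx) const_vecE // Fw //.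
by rewrite smooth_oppE smooth_1E.
Qed.

Let one_frame : exists fr : adapted_frame d Fv 1 0, True.
Proof.
apply: (@adapted_frame_smooth _ _ _ FC Fspace) => x Cx [/eqP].
by rewrite smooth_1E // oner_eq0.
Qed.

(** The product of the tension field with [w] is 2. *)
Lemma parallel_tension w : (forall x, C x -> form (F x) w = -1) ->
  tension F (open_point U) != 0.
Proof.
move=> Fw; have [fr _] := one_frame; have Cp := open_pointP U.
have := frame_tension_parallel (@smooth_pd_derivation R U)
  (@smooth_torsion_free _ _ U) (immersion_vec_norm FC FAdS) fr (const_vec_parallel w)
  (const_form Fw).
move=> /(congr1 (fun g : A => g (open_point U))).
rewrite /= -form_evalv smooth_natE // => T2.
have TE := tensionE (frame_e11 fr) (frame_e22 fr) (frame_e12 fr) Cp.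
apply/eqP => T0; move: T2.
have -> : evalv (open_point U) (frame_tension fr) = 0 by apply: etrans (esym TE) T0.
by rewrite form_bform bform0l => /eqP; rewrite eq_sym pnatr_eq0.
Qed.

Lemma parallel_unique_smooth w w' : (forall x, C x -> form (F x) w = -1) ->
  (forall x, C x -> form (F x) w' = -1) -> w = w'.
Proof.
move=> Fw Fw'; have [fr _] := one_frame.
have [xi xiN] := unit_normal_smooth FC FAdS Fspace.
have Cp := open_pointP U.
have := parallel_unique (@smooth_pd_derivation R U) (@smooth_torsion_free _ _ U)
  (immersion_vec_norm FC FAdS) fr xiN (const_vec_parallel w)
  (const_vec_parallel w') (const_form Fw) (const_form Fw').
by move=> /(congr1 (evalv (open_point U))); rewrite !const_vecE.
Qed.

End ParallelNormal.

Section NearParallel.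
Variables (R : realType) (U : set 'rV[R]_2) (F : 'rV[R]_2 -> 'rV[R]_4).
Hypothesis oU : open U.
Hypothesis FC : smooth U F.
Hypothesis FAdS : forall x, U x -> form (F x) (F x) = -1.
Hypothesis Fspace : forall x v, U x -> v != 0 -> 0 < form ('D_v F x) ('D_v F x).
Variable x : 'rV[R]_2.
Hypothesis Ux : U x.

Let small_ball (P : set 'rV[R]_2) : (\near x, P x) ->
  exists2 r, 0 < r & forall y, ball x r y -> U y /\ P y.
Proof.
move=> NP; have NU := open_nbhs_nbhs (conj oU Ux).
have /nbhs_ballP[r /= r0 rP] : nbhs x (U `&` P) by exact: filterI NU NP.
by exists r => // y /rP.
Qed.

Lemma near_parallel_tension w : (\near x, form (F x) w = -1) -> tension F x != 0.
Proof.
move=> /small_ball[r r0 B].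
pose PB := pointed_ball x r0.
have sB : open_carrier PB `<=` U by move=> y /B[].
apply: (@parallel_tension R PB F (smooth_subset sB FC) _ _ w).
- by move=> y /sB; exact: FAdS.
- by move=> y v /sB; exact: Fspace.
by move=> y /B[].
Qed.

Lemma near_parallel_unique w w' :
  (\near x, form (F x) w = -1) -> (\near x, form (F x) w' = -1) -> w = w'.
Proof.
move=> N N'; have [r r0 B] := small_ball (filterI N N').
pose PB := pointed_ball x r0.
have sB : open_carrier PB `<=` U by move=> y /B[].
apply: (@parallel_unique_smooth R PB F (smooth_subset sB FC)).
- by move=> y /sB; exact: FAdS.
- by move=> y v /sB; exact: Fspace.
- by move=> y /B[_ []].
by move=> y /B[_ []].
Qed.

End NearParallel.

(** * Globalization *)

Lemma connected_clopen (T : topologicalType) (B : set T) :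
  connected [set: T] -> open B -> open (~` B) -> B !=set0 -> B = setT.
Proof.
move=> cT oB oC B0; apply: cT => //; first by exists B; rewrite ?setTI.
by exists B; rewrite ?setTI // -[B]setCK; exact: open_closedC.
Qed.

Section Atlas.
Variables (R : realType) (M : topologicalType) (S : atlas R M).

Lemma near_chart a p (P : set 'rV[R]_2) : cdom a p ->
  (\forall x \near chart a p, P x) -> \forall p' \near p, cdom (a : cindex S) p' /\ P (chart a p').
Proof.
move=> ap N; have N1 := open_nbhs_nbhs (conj (@open_cdom _ _ S a) ap).
have N2 : nbhs p [set p' | P (chart a p')] by exact: (chart_continuous ap).
exact: filterI N1 N2.
Qed.

Lemma near_param a x (P : set M) : ccod a x ->
  (\forall p \near param (a : cindex S) x, P p) ->
  \forall y \near x, ccod a y /\ P (param a y).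
Proof.
move=> ax N; have N1 := open_nbhs_nbhs (conj (@open_ccod _ _ S a) ax).
have N2 : nbhs x [set y | P (param a y)] by exact: (param_continuous ax).
exact: filterI N1 N2.
Qed.

End Atlas.

Section Hyperplane.
Variables (R : realType) (M : topologicalType) (S : atlas R M).
Variable phi : M -> 'rV[R]_4.
Hypothesis cM : connected [set: M].
Hypothesis imm : immersion_in_AdS S phi.
Hypothesis sl : spacelike S phi.
Hypothesis pb : proper_biharmonic S phi.

Let F (a : cindex S) := phi \o param a.
Let FC a : smooth (ccod a) (F a). Proof. by have [_ + _] := imm. Qed.
Let FAdS a x : ccod a x -> form (F a x) (F a x) = -1.
Proof. by move=> _; have [+ _ _] := imm; exact. Qed.
Let Fsl a x v : ccod a x -> v != 0 -> 0 < form ('D_v (F a) x) ('D_v (F a) x).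
Proof. exact: sl. Qed.
Let Fbih a x : ccod a x -> bitension (F a) x = 0.
Proof. by have [+ _] := pb; exact. Qed.

(** A condition on the germ at [p]: it defines an open set of points, and it determines [w]. *)
Let plane (w : 'rV[R]_4) (p : M) : Prop := \forall p' \near p, form (phi p') w = -1.

Let plane_chart w a x : ccod a x -> plane w (param a x) ->
  \forall y \near x, form (F a y) w = -1.
Proof.
by move=> ax /(near_param ax); apply: filterS => y [].
Qed.

Let plane_unique w w' p : plane w p -> plane w' p -> w = w'.
Proof.
have [a ap] := cdom_cover S p; have xa := chart_ccod ap.
rewrite -(chartK ap) => /(plane_chart xa) N /(plane_chart xa) N'.
exact: (near_parallel_unique (@open_ccod _ _ S a) (@FC a) (@FAdS a) (@Fsl a) xa N N').
Qed.

Let open_plane w : open (plane w).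
Proof. by rewrite openE => p; exact: nbhs_interior. Qed.

Let dichotomy p : (exists w, form w w = -2 /\ plane w p) \/
  exists2 a, cdom a p & \forall x \near chart a p, tension (F a) x = 0.
Proof.
have [a ap] := cdom_cover S p; have xa := chart_ccod ap.
have [r r0 [_ [T0|[w [ww Fw]]]]] := biharmonic_local (@open_ccod _ _ S a) (@FC a)
    (@FAdS a) (@Fsl a) (@Fbih a) xa.
  right; exists a => //; have N := nbhsx_ballx (chart a p) r r0.
  by apply: filterS N => x /T0.
left; exists w; split=> //.
have N := nbhsx_ballx (chart a p) r r0.
apply: filterS (near_chart ap N) => p' [ap' /Fw].
by rewrite /F /= chartK.
Qed.

(** The tension field is taken in a single chart. Comparison of charts goes through [planar], which
    mentions only [phi]. *)
Let minimal : set M :=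
  [set p | exists2 a, cdom a p & \forall x \near chart a p, tension (F a) x = 0].

Let planar : set M := [set p | exists w, form w w = -2 /\ plane w p].

Let disjoint p : planar p -> minimal p -> False.
Proof.
move=> [w [_ wp]] [a ap T0]; have xa := chart_ccod ap.
move: wp; rewrite -(chartK ap) => /(plane_chart xa) N.
have := near_parallel_tension (@open_ccod _ _ S a) (@FC a) (@FAdS a) (@Fsl a) xa N.
by rewrite (nbhs_singleton T0) eqxx.
Qed.

Let open_planar : open planar.
Proof.
rewrite openE => p [w [ww wp]]; have := open_plane w.
rewrite openE => /(_ p wp); apply: filterS => p' wp'; by exists w.
Qed.

Let open_minimal : open minimal.
Proof.
rewrite openE => p [a ap T0].
have N := near_chart ap (nbhs_interior T0).
by apply: filterS N => p' [ap' T0']; exists a.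
Qed.

Let planarC : ~` planar = minimal.
Proof.
apply/seteqP; split=> p; first by move=> np; have [/np|] := dichotomy p.
by move=> mp pp; exact: disjoint pp mp.
Qed.

Theorem biharmonic_hyperplane : exists2 w,
  form w w = -2 & forall p, form (phi p) w = -1.
Proof.
have planarT : planar = setT.
  apply: connected_clopen => //; first by rewrite planarC.
  apply: contrapT => /set0P/negP/negPn/eqP planar0.
  have minT p : minimal p by rewrite -planarC planar0.
  have [_ nh] := pb; apply: nh => a x ax.
  have ap := param_cdom ax; have := dichotomy (param a x).
  (* The tension field must vanish in the given chart [a], whereas minimality may be known in
     another one. The local dichotomy is applied in [a]; its planar alternative contradicts
     minimality in whatever chart. *)
  have [r r0 [_ [T0|[w [ww Fw]]]]] := biharmonic_local (@open_ccod _ _ S a) (@FC a)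
    (@FAdS a) (@Fsl a) (@Fbih a) ax.
    by move=> _; apply: T0; exact: ballxx.
  case: (@disjoint (param a x)) => //; exists w; split=> //.
  have N := nbhsx_ballx (chart a (param a x)) r r0.
  apply: filterS (near_chart ap N) => p' [ap'].
  by rewrite paramK // => /Fw; rewrite /F /= chartK.
have [p0 _] : [set: M] !=set0.
  apply/set0P/eqP => M0; have [_ nh] := pb; apply: nh => a x ax.
  have : [set: M] (param a x) by [].
  by rewrite M0.
have [w [ww wp0]] : planar p0 by rewrite planarT.
have planeT : plane w = setT.
  apply: connected_clopen => //; last by exists p0.
  rewrite openE => p np; have [w' [ww' wp']] : planar p by rewrite planarT.
  have := open_plane w'; rewrite openE => /(_ p wp'); apply: filterS => p'.
  by move=> w'p' wp'_; apply: np; rewrite (plane_unique wp'_ w'p').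
exists w => // p; have : plane w p by rewrite planeT.
by move=> /nbhs_singleton.
Qed.

End Hyperplane.

(** * Normal form *)

Lemma form4 (R : realType) (x y : 'rV[R]_4) :
  form x y = x 0 0 * y 0 0 + x 0 1 * y 0 1 - x 0 2%:R * y 0 2%:R
              - x 0 3%:R * y 0 3%:R.
Proof. exact: bform4. Qed.

Lemma form3 (R : realType) (x y : 'rV[R]_3) :
  form x y = x 0 0 * y 0 0 + x 0 1 * y 0 1 - x 0 2%:R * y 0 2%:R.
Proof.
rewrite /form !big_ord_recl big_ord0 /= addr0 !addrA.
by do !congr (_ + _); do ?congr (- _); congr (x 0 _ * y 0 _); apply/val_inj.
Qed.

Section Reflection.
Variable R : realType.
Implicit Types (x y u v w : 'rV[R]_4).

Definition reflection v : 'M[R]_4 :=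
  1%:M - (2 / form v v) *: ((\col_i (if (i < 2)%N then v 0 i else - v 0 i)) *m v).

Lemma reflectionE v x : x *m reflection v = x - (2 * form x v / form v v) *: v.
Proof.
rewrite /reflection mulmxBr mulmx1 -scalemxAr mulmxA.
have -> : x *m (\col_i (if (i < 2)%N then v 0 i else - v 0 i)) = (form x v)%:M.
  apply/matrixP => i j; rewrite !ord1 !mxE eqxx mulr1n; apply: eq_bigr => k _.
  by rewrite !mxE; case: ifP => _ //; rewrite mulrN.
by rewrite mul_scalar_mx scalerA; congr (x - _ *: v); ring.
Qed.

Lemma reflection_coord v x i :
  (x *m reflection v) 0 i = x 0 i - 2 * form x v / form v v * v 0 i.
Proof. by rewrite reflectionE !mxE. Qed.

Lemma reflection_isometry v : form v v != 0 -> linear_isometry (reflection v).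
Proof.
move=> v0 x y; rewrite !reflectionE !form_bform !bformE -!form_bform.
by rewrite (form_bform v y) bformC -form_bform; field.
Qed.

Lemma linear_isometryM (A B : 'M[R]_4) :
  linear_isometry A -> linear_isometry B -> linear_isometry (A *m B).
Proof. by move=> iA iB x y; rewrite !mulmxA iB iA. Qed.

Definition basis_vec (i : 'I_4) : 'rV[R]_4 := delta_mx 0 i.
Local Notation e3 := (basis_vec 2%:R).
Local Notation e4 := (basis_vec 3%:R).

Lemma form_e3 x : form x e3 = - x 0 2%:R.
Proof. by rewrite form4 !mxE /=; ring. Qed.

Lemma form_e4 x : form x e4 = - x 0 3%:R.
Proof. by rewrite form4 !mxE /=; ring. Qed.

Lemma coord2_e3 : e3 0 2%:R = 1. Proof. by rewrite mxE. Qed.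
Lemma coord3_e4 : e4 0 3%:R = 1. Proof. by rewrite mxE. Qed.

Lemma flip_e3 : linear_isometry (reflection e3) /\ forall x,
  (x *m reflection e3) 0 2%:R = - x 0 2%:R /\ (x *m reflection e3) 0 3%:R = x 0 3%:R.
Proof.
split=> [|x]; first by apply: reflection_isometry; rewrite form_e3 coord2_e3 oppr_eq0 oner_eq0.
rewrite reflectionE !form_e3 coord2_e3 !mxE /=.
by rewrite invrN1; split; ring.
Qed.

(** Two vectors with square -1 are exchanged by the reflection along their difference, if that is
    not isotropic. Here <n - e4, n - e4> = 2 n_4 - 2. When n_4 = 1, the reflection along n + e4, of
    square -4, takes n to -e4, and a reflection along e4 corrects the sign. *)
Lemma timelike_isometry n : form n n = -1 ->
  exists2 A : 'M[R]_4, linear_isometry A & forall x, (x *m A) 0 3%:R = - form x n.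
Proof.
move=> nn; have ne4 : form n e4 = - n 0 3%:R := form_e4 n.
have e4e4 : form e4 e4 = -1 by rewrite form_e4 coord3_e4.
have e4n : form e4 n = - n 0 3%:R by rewrite form_bform bformC.
have [n3|n3] := eqVneq (n 0 3%:R) 1.
  pose v := n + e4.
  have vv : form v v = - 4%:R.
    by rewrite /v form_bform !bformE -!form_bform nn ne4 e4n e4e4 n3; ring.
  exists (reflection v *m reflection e4).
    apply: linear_isometryM; apply: reflection_isometry.
      by rewrite vv oppr_eq0 pnatr_eq0.
    by rewrite e4e4 oppr_eq0 oner_eq0.
  move=> x; rewrite mulmxA (reflection_coord e4) coord3_e4.
  rewrite form_e4 e4e4 reflection_coord vv.
  have -> : form x v = form x n - x 0 3%:R.
    by rewrite /v form_bform !bformE -!form_bform form_e4.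
  have -> : v 0 3%:R = 2 by rewrite /v mxE coord3_e4 n3.
  by field.
pose v := n - e4.
have vv : form v v = 2%:R * n 0 3%:R - 2%:R.
  by rewrite /v form_bform !bformE -!form_bform nn ne4 e4n e4e4; ring.
have vv0 : form v v != 0.
  rewrite vv -[X in _ - X]mulr1 -mulrBr mulf_neq0 ?pnatr_eq0 // subr_eq0 //.
exists (reflection v); first exact: reflection_isometry.
move=> x; rewrite reflection_coord.
have -> : form x v = form x n + x 0 3%:R.
  by rewrite /v form_bform !bformE -!form_bform form_e4 opprK.
have -> : v 0 3%:R = n 0 3%:R - 1 by rewrite /v !mxE /=.
rewrite vv; field.
by rewrite -[X in _ - X]mulr1 -mulrBr mulf_neq0 ?pnatr_eq0 // subr_eq0.
Qed.

End Reflection.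

(** * The connected component is the upper sheet *)

Section UpperSheet.
Variable R : realType.

Lemma continuous_row (T : topologicalType) n (f : T -> 'rV[R]_n) x :
  (forall i, {for x, continuous (fun t => f t 0 i)}) -> {for x, continuous f}.
Proof.
move=> fc; apply/cvgrPdist_lt => e e0.
have : \forall t \near x, forall i, `|f x 0 i - f t 0 i| < e.
  by apply: filter_forall => i; have /cvgrPdist_lt/(_ e e0) := fc i.
apply: filterS => t Ht.
rewrite /Num.norm /= mx_normrE; apply: bigmax_lt => // -[i j] _ /=.
by rewrite !ord1 !mxE.
Qed.

(** On the quadric the third coordinate has no zero, so it keeps the sign of the base point on a
    connected subset. Conversely every point of the upper sheet is joined to the base point by a
    path. *)
Lemma H2P (r : R) (y : 'rV[R]_3) : 0 < r ->
  H2 r y <-> form y y = - r ^+ 2 /\ 0 < y 0 2%:R.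
Proof.
move=> r0; pose base : 'rV[R]_3 := \row_(i < 3) (if i == ord_max then r else 0).
have b0 : base 0 0 = 0 by rewrite mxE.
have b1 : base 0 1 = 0 by rewrite mxE.
have b2 : base 0 2%:R = r by rewrite mxE.
split.
  move=> [B [Bbase BS cB]] By; split; first exact: BS.
  have cI : connected ((fun z : 'rV[R]_3 => z 0 2%:R) @` B).
    apply: connected_continuous_connected => //.
    by apply: continuous_subspaceT => z; exact: coord_continuous.
  rewrite real_ltNge ?num_real //; apply/negP => y2.
  have [z Bz z2] : ((fun z : 'rV[R]_3 => z 0 2%:R) @` B) 0.
    apply: ((connected_intervalP _).1 cI (y 0 2%:R) r).
    - by exists y.
    - by exists base.
    - by rewrite y2 ltW.
  have := BS z Bz; rewrite /= form3 z2 => H.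
  have : 0 < r ^+ 2 by rewrite exprn_gt0.
  have := sqr_ge0 (z 0 0); have := sqr_ge0 (z 0 1); rewrite !expr2 in H *; lra.
rewrite form3 => -[yS y2].
(* The first two coordinates shrink linearly and the third is forced; the path starts at the base
   point and ends at [y]. *)
pose g (t : R) : 'rV[R]_3 := \row_i
  if i == 0 then t * y 0 0 else if i == 1 then t * y 0 1
  else Num.sqrt (t ^+ 2 * (y 0 0 ^+ 2 + y 0 1 ^+ 2) + r ^+ 2).
have g0 t : g t 0 0 = t * y 0 0 by rewrite mxE.
have g1 t : g t 0 1 = t * y 0 1 by rewrite mxE.
have g2 t : g t 0 2%:R = Num.sqrt (t ^+ 2 * (y 0 0 ^+ 2 + y 0 1 ^+ 2) + r ^+ 2) by rewrite mxE.
have row3 (u v : 'rV[R]_3) : u 0 0 = v 0 0 -> u 0 1 = v 0 1 -> u 0 2%:R = v 0 2%:R -> u = v.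
  move=> H0 H1 H2; apply/rowP => -[[|[|[|//]]] ?].
  - by rewrite (_ : Ordinal _ = 0) //; exact/val_inj.
  - by rewrite (_ : Ordinal _ = 1) //; exact/val_inj.
  - by rewrite (_ : Ordinal _ = 2%:R) //; exact/val_inj.
exists (g @` `[0, 1]); last first.
  exists 1; first by rewrite /= in_itv /= ler01 lexx.
  apply: row3; rewrite ?g0 ?g1 ?g2 ?mul1r // expr1n mul1r.
  have -> : y 0 0 ^+ 2 + y 0 1 ^+ 2 + r ^+ 2 = y 0 2%:R ^+ 2.
    by rewrite -[r ^+ 2]opprK -yS; ring.
  by rewrite sqrtr_sqr gtr0_norm.
split.
- exists 0; first by rewrite /= in_itv /= ler01 lexx.
  apply: row3; rewrite ?g0 ?g1 ?g2 ?b0 ?b1 ?b2 ?mul0r //.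
  by rewrite expr0n /= mul0r add0r sqrtr_sqr gtr0_norm.
- move=> _ [t _ <-]; rewrite /= form3 g0 g1 g2 -[X in _ - X]expr2 sqr_sqrtr; first by ring.
  by apply: addr_ge0; [apply: mulr_ge0; [|apply: addr_ge0]|]; exact: sqr_ge0.
apply: connected_continuous_connected; first exact: segment_connected.
apply: continuous_subspaceT => t; apply: continuous_row => i.
rewrite (_ : (fun u => g u 0 i) = (fun u : R => if i == 0 then u * y 0 0
    else if i == 1 then u * y 0 1
    else Num.sqrt (u ^+ 2 * (y 0 0 ^+ 2 + y 0 1 ^+ 2) + r ^+ 2))); last first.
  by apply/funext => u; rewrite mxE.
case: (i == 0); first by apply: continuousM; [exact: cvg_id|exact: cvg_cst].
case: (i == 1); first by apply: continuousM; [exact: cvg_id|exact: cvg_cst].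
apply: (@continuous_comp _ _ _ (fun t : R => t ^+ 2 * (y 0 0 ^+ 2 + y 0 1 ^+ 2) + r ^+ 2)
  (@Num.sqrt R)); last exact: sqrt_continuous.
apply: continuousD; last exact: cvg_cst.
apply: continuousM; last exact: cvg_cst.
exact: exprn_continuous.
Qed.

Lemma append_coord s (y : 'rV[R]_3) :
  [/\ append s y 0 0 = y 0 0, append s y 0 1 = y 0 1,
      append s y 0 2%:R = y 0 2%:R & append s y 0 3%:R = s].
Proof.
have L (i : 'I_3) : append s y 0 (lshift 1 i) = y 0 i.
  exact: (row_mxEl y (const_mx s) 0 i).
split.
- by rewrite -L; congr (append s y 0 _); apply/val_inj.
- by rewrite -L; congr (append s y 0 _); apply/val_inj.
- by rewrite -L; congr (append s y 0 _); apply/val_inj.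
rewrite (_ : 3%:R = rshift 3 (ord0 : 'I_1)); last exact/val_inj.
by apply: etrans (row_mxEr y (const_mx s) 0 ord0) _; rewrite mxE.
Qed.

Lemma row4 (u v : 'rV[R]_4) : u 0 0 = v 0 0 -> u 0 1 = v 0 1 ->
  u 0 2%:R = v 0 2%:R -> u 0 3%:R = v 0 3%:R -> u = v.
Proof.
move=> H0 H1 H2 H3; apply/rowP => -[[|[|[|[|//]]]] ?].
- by rewrite (_ : Ordinal _ = 0) //; exact/val_inj.
- by rewrite (_ : Ordinal _ = 1) //; exact/val_inj.
- by rewrite (_ : Ordinal _ = 2%:R) //; exact/val_inj.
- by rewrite (_ : Ordinal _ = 3%:R) //; exact/val_inj.
Qed.

Lemma natural_H2P (s : R) x : s ^+ 2 < 1 ->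
  natural_H2 s x <-> [/\ form x x = -1, x 0 3%:R = s & 0 < x 0 2%:R].
Proof.
move=> s1; have r0 : 0 < Num.sqrt (1 - s ^+ 2) by rewrite sqrtr_gt0 subr_gt0.
have rr : Num.sqrt (1 - s ^+ 2) ^+ 2 = 1 - s ^+ 2 by rewrite sqr_sqrtr // subr_ge0 ltW.
split=> [[y /(H2P _ r0)[yS y2] <-]|[xx x3 x2]].
  have [E0 E1 E2 E3] := append_coord s y.
  split=> //; last by rewrite E2.
  move: yS; rewrite form3 form4 E0 E1 E2 E3 rr => H.
  by rewrite H; ring.
pose y : 'rV[R]_3 := \row_i x 0 (widen_ord (leqnSn 3) i).
have y0 : y 0 0 = x 0 0 by rewrite mxE; congr (x 0 _); apply/val_inj.
have y1 : y 0 1 = x 0 1 by rewrite mxE; congr (x 0 _); apply/val_inj.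
have y2 : y 0 2%:R = x 0 2%:R by rewrite mxE; congr (x 0 _); apply/val_inj.
exists y; last by have [E0 E1 E2 E3] := append_coord s y; apply: row4; congruence.
apply/(H2P _ r0); rewrite y2; split=> //; rewrite form3 y0 y1 y2 rr.
by move: xx; rewrite form4 x3 => H; apply: (eq_from_sub H); ring.
Qed.

Lemma sqr_invsqrt2 : ((Num.sqrt 2)^-1 : R) ^+ 2 = 2^-1.
Proof. by rewrite exprVn sqr_sqrtr. Qed.

End UpperSheet.

Section NormalForm.
Variables (R : realType) (M : topologicalType) (S : atlas R M).
Variable phi : M -> 'rV[R]_4.
Hypothesis cM : connected [set: M].
Hypothesis imm : immersion_in_AdS S phi.
Hypothesis sl : spacelike S phi.
Hypothesis pb : proper_biharmonic S phi.

Lemma immersion_continuous : continuous phi.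
Proof.
move=> p; have [a ap] := cdom_cover S p; have [_ FC _] := imm.
have xa := chart_ccod ap.
have : {for p, continuous (phi \o param a \o chart a)}.
  apply: (@continuous_comp _ _ _ (chart a) (phi \o param a)).
    exact: chart_continuous.
  exact: (FC a 0 _ xa).
rewrite /prop_for /continuous_at /= chartK //; apply: cvg_trans.
apply: near_eq_cvg.
have := open_nbhs_nbhs (conj (@open_cdom _ _ S a) ap).
by apply: filterS => q aq /=; rewrite chartK.
Qed.

Theorem biharmonic_normal_form : exists2 A : 'M[R]_4, linear_isometry A &
  forall p, natural_H2 (Num.sqrt 2)^-1 (phi p *m A).
Proof.
have [w ww Fw] := biharmonic_hyperplane cM imm sl pb.
have sq2 := sqr_invsqrt2 R; set s : R := (Num.sqrt 2)^-1 in sq2 *.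
have s1 : s ^+ 2 < 1 by rewrite sq2 invf_lt1 ?ltr1n.
have s0 : s != 0.
  by apply/eqP => s0; move/eqP: sq2; rewrite s0 expr0n /= eq_sym invr_eq0 pnatr_eq0.
(* [s *: w] has square -1, as s^2 = 1/2 and <w, w> = -2; the product of phi with it is -s. *)
have [|A iA A3] := @timelike_isometry R (s *: w).
  by rewrite form_bform !bformE -form_bform ww mulrA -expr2 sq2; lra.
have phiA p : form (phi p *m A) (phi p *m A) = -1.
  by rewrite iA; have [+ _ _] := imm; exact.
have {}A3 p : (phi p *m A) 0 3%:R = s.
  by rewrite A3 form_bform bformZr -form_bform Fw mulrN1 opprK.
pose h (p : M) : R := (phi p *m A) 0 2%:R.
have hc : continuous h.
  move=> p; have phic : {for p, continuous phi} := @immersion_continuous p.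
  have hj j : {for p, continuous (fun q => phi q 0 j * A j 2%:R)}.
    apply: continuousM; last exact: cvg_cst.
    apply: (@continuous_comp _ _ _ phi (fun N : 'rV[R]_4 => N 0 j)) => //.
    exact: coord_continuous.
  have -> : h = (fun q => phi q 0 ord0 * A ord0 2%:R + (phi q 0 (lift ord0 ord0) *
     A (lift ord0 ord0) 2%:R + (phi q 0 (lift ord0 (lift ord0 ord0)) *
     A (lift ord0 (lift ord0 ord0)) 2%:R + phi q 0 (lift ord0 (lift ord0 (lift ord0 ord0)))
       * A (lift ord0 (lift ord0 (lift ord0 ord0))) 2%:R))).
    by apply/funext => q; rewrite /h mxE !big_ord_recl big_ord0 addr0.
  apply: cvgD; first exact: hj.
  apply: cvgD; first exact: hj.
  by apply: cvgD; exact: hj.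
(* On the slice x_4 = s the third coordinate satisfies h^2 = x_1^2 + x_2^2 + 1/2. Its sign is thus
   constant on the connected surface, and [flip_e3] corrects a negative one. *)
have h_neq0 p : h p != 0.
  apply/eqP => hp; have := phiA p; rewrite form4 A3 -/(h p) hp => H.
  have := sqr_ge0 ((phi p *m A) 0 0); have := sqr_ge0 ((phi p *m A) 0 1).
  move: sq2; rewrite !expr2 in H *; lra.
have hpos_open : open [set p | 0 < h p].
  by rewrite openE => p hp; exact: (cvgr_gt (h p) (hc p) 0 hp).
have hneg_open : open [set p | h p < 0].
  by rewrite openE => p hp; exact: (cvgr_lt (h p) (hc p) 0 hp).
have [[p0 hp0]|none] := pselect (exists p, 0 < h p).
  exists A => // p; apply/(natural_H2P _ s1); split=> //; rewrite -/(h p).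
  have hT : [set p | 0 < h p] = setT.
    apply: connected_clopen => //; last by exists p0.
    rewrite (_ : ~` _ = [set p | h p < 0]) //; apply/seteqP; split=> q /=.
      by move/negP; rewrite -leNgt le_eqVlt (negPf (h_neq0 q)).
    by move=> hq /(lt_trans hq); rewrite ltxx.
  by have : [set p | 0 < h p] p by rewrite hT.
have [iE E23] := flip_e3 R.
exists (A *m reflection (basis_vec R 2%:R)); first exact: linear_isometryM.
move=> p; apply/(natural_H2P _ s1); rewrite mulmxA.
have [-> ->] := E23 (phi p *m A); rewrite iE; split=> //.
rewrite oppr_gt0 -/(h p) lt_neqAle h_neq0 leNgt.
by apply/negP => hp; apply: none; exists p.
Qed.

End NormalForm.

(** * Local inverses *)

Section InverseFunction.
Variable R : realType.
Implicit Types (x y v : 'rV[R]_2).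

Lemma norm_coord_le v i : `|v 0 i| <= `|v|.
Proof.
rewrite [leRHS]/Num.norm /= mx_normrE.
by apply: le_trans (le_bigmax _ _ (0, i)).
Qed.

Lemma norm_row_le v (c : R) : 0 <= c -> (forall i, `|v 0 i| <= c) -> `|v| <= c.
Proof.
move=> c0 vc; rewrite /Num.norm /= mx_normrE bigmax_le // => -[i j] _ /=.
by rewrite ord1.
Qed.

Lemma mulmx_row2 v (N : 'M[R]_2) i : (v *m N) 0 i = v 0 0 * N 0 i + v 0 1 * N 1 i.
Proof. by rewrite mxE sum_ord2. Qed.

Lemma mulmx_norm_le (N : 'M[R]_2) : exists2 K, 0 < K &
  forall v, `|v *m N| <= K * `|v|.
Proof.
exists (2 * `|N| + 1) => [|v]; first by rewrite ltr_wpDl // mulr_ge0.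
apply: norm_row_le => [|i]; first by rewrite mulr_ge0 // addr_ge0 // mulr_ge0.
rewrite mulmx_row2; apply: le_trans (ler_normD _ _) _; rewrite !normrM.
have Nle k : `|N k i| <= `|N|.
  by rewrite [leRHS]/Num.norm /= mx_normrE; apply: le_trans (le_bigmax _ _ (k, i)).
have H k : `|v 0 k| * `|N k i| <= `|v| * `|N|.
  by apply: ler_pM => //; exact: norm_coord_le.
have := H 0; have := H 1; have := normr_ge0 v.
by rewrite mulrDl mul1r -mulrA [`|N| * _]mulrC; lra.
Qed.

Definition jacobian (g : 'rV[R]_2 -> 'rV[R]_2) x : 'M[R]_2 :=
  \matrix_(k, i) pd k g x 0 i.

Lemma derive_jacobian g x v : differentiable g x -> 'D_v g x = v *m jacobian g x.
Proof.
move=> gx; rewrite derive_pd //; apply/rowP => i; rewrite mulmx_row2.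
have E k : jacobian g x k i = pd k g x 0 i by rewrite mxE.
rewrite !E; move: (pd 0 g x) (pd 1 g x) => a b.
by rewrite !mxE.
Qed.

Lemma jacobian_unit g x : differentiable g x ->
  injective (fun v => 'D_v g x) -> jacobian g x \in unitmx.
Proof.
move=> gx ginj; rewrite -row_free_unit; apply: inj_row_free => v vJ.
by apply: ginj; rewrite !derive_jacobian // vJ mul0mx.
Qed.

Variables (U : set 'rV[R]_2) (g : 'rV[R]_2 -> 'rV[R]_2) (x0 : 'rV[R]_2).
Hypothesis oU : open U.
Hypothesis gC : class_C 1 U g.
Hypothesis Ux0 : U x0.
Let J := jacobian g x0.

Let gd x : U x -> differentiable g x. Proof. by have [+ _] := gC; exact. Qed.

(** Mean value inequality for the components of z J - g(z), whose partial derivatives vanish at x0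
    and are small near it. Each of the two gets [eps / 2]. *)
Lemma near_contraction eps : 0 < eps -> exists2 r, 0 < r & ball x0 r `<=` U /\
  forall x x', ball x0 r x -> ball x0 r x' ->
    `|(x - x') *m J - (g x - g x')| <= eps * `|x - x'|.
Proof.
move=> eps0; have quarter : 0 < eps / 2 by rewrite divr_gt0.
have Nk (k i : 'I_2) : nbhs x0 [set x | `|J k i - pd k g x 0 i| < eps / 2].
  have [_ /(_ (delta_mx 0 k)) hc] := gC.
  have c0 : {for x0, continuous (fun x => pd k g x 0 i)}.
    apply: (@continuous_comp _ _ _ (pd k g) (fun N : 'rV[R]_2 => N 0 i)).
      exact: (hc x0 Ux0).
    exact: coord_continuous.
  have /cvgrPdist_lt/(_ _ quarter) := c0.
  by rewrite /J mxE.
have NU : nbhs x0 U by exact: open_nbhs_nbhs.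
have Nall : \forall x \near x0,
    forall k : 'I_2 * 'I_2, `|J k.1 k.2 - pd k.1 g x 0 k.2| < eps / 2.
  apply: (@filter_forall _ _ (fun (k : 'I_2 * 'I_2) (x : 'rV[R]_2) =>
    `|J k.1 k.2 - pd k.1 g x 0 k.2| < eps / 2) (nbhs x0) (nbhs_filter x0)) => -[k i]; exact: Nk.
have N : nbhs x0 (U `&` [set x | forall k i : 'I_2, `|J k i - pd k g x 0 i| < eps / 2]).
  by apply: filterI NU _; apply: filterS Nall => x xP k i; exact: (xP (k, i)).
have /nbhs_ballP[r /= r0 rP] := N.
exists r => //; split=> [x /rP[]//|x x' xB x'B].
pose e i := fun z : 'rV[R]_2 => (z 0 0 * J 0 i + z 0 1 * J 1 i) - g z 0 i.
apply: norm_row_le => [|i]; first by rewrite mulr_ge0 // ltW.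
have -> : ((x - x') *m J - (g x - g x')) 0 i = e i x - e i x'.
  rewrite /e; move: J (g x) (g x') => L a b.
  have -> : ((x - x') *m L - (a - b)) 0 i = ((x - x') *m L) 0 i - (a 0 i - b 0 i) by rewrite !mxE.
  by rewrite mulmx_row2 !mxE; ring.
have pde k z : U z -> is_derive z (delta_mx 0 k) (e i) (J k i - pd k g z 0 i).
  move=> Uz.
  have dc j : is_derive z (delta_mx 0 k) (fun y : 'rV[R]_2 => y 0 j * J j i) ((k == j)%:R * J j i).
    have H := is_derive_coord 0 j (is_derive_id z (delta_mx 0 k : 'rV[R]_2)).
    apply: is_derive_eq (is_deriveM H (is_derive_cst (J j i) z _)) _.
    rewrite /GRing.scale /= mulr0 add0r mulrC; congr (_ * _).
    by rewrite mxE eqxx eq_sym.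
  have hdz : derivable g z (delta_mx 0 k) by apply: diff_derivable; exact: gd.
  have dhi : is_derive z (delta_mx 0 k) (fun y : 'rV[R]_2 => g y 0 i) (pd k g z 0 i).
    exact: (is_derive_coord 0 i (derivableP hdz)).
  apply: is_derive_eq (is_deriveB (is_deriveD (dc 0) (dc 1)) dhi) _.
  congr (_ - _); move: k {dc hdz dhi}.
  by apply: ord2_ind; rewrite ?mul1r ?mul0r ?addr0 ?add0r.
have ed z : ball x0 r z -> differentiable (e i) z.
  move=> /rP[Uz _]; apply: differentiableB.
    apply: differentiableD; apply: differentiableM => //; exact: differentiable_coord.
  apply: (@differentiable_comp _ _ _ _ g (fun N : 'rV[R]_2 => N 0 i)).
    exact: gd.
  exact: differentiable_coord.
have segB t : 0 <= t <= 1 -> ball x0 r (t *: (x - x') + x').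
  move=> /andP[t0 t1]; move: xB x'B; rewrite -!ball_normE /= => xB x'B.
  have -> : x0 - (t *: (x - x') + x') = t *: (x0 - x) + (1 - t) *: (x0 - x').
    by apply/rowP => j; rewrite !mxE; ring.
  apply: le_lt_trans (ler_normD _ _) _; rewrite !normrZ ger0_norm // ger0_norm ?subr_ge0 //.
  have [->|t_neq0] := eqVneq t 0; first by rewrite mul0r add0r subr0 mul1r.
  have t_gt0 : 0 < t by rewrite lt_neqAle eq_sym t_neq0.
  have -> : r = t * r + (1 - t) * r by ring.
  by apply: ltr_leD; [rewrite ltr_pM2l|apply: ler_wpM2l; rewrite ?subr_ge0 // ltW].
have [t tI] := @mean_value_line R _ (e i) x' (x - x') 1 ltr01 (fun t tI => ed _ (segB t tI)).
rewrite scale1r subrK mul1r => ->.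
have tB : ball x0 r (t *: (x - x') + x').
  by apply: segB; case/andP: tI => t0 t1; rewrite !ltW.
set z := t *: (x - x') + x' in tB *; have [Uz zP] := rP z tB.
rewrite derive_pd; last exact: ed.
apply: le_trans (ler_normD _ _) _; rewrite !normrM.
have E k : pd k (e i) z = J k i - pd k g z 0 i by have [] := pde k z Uz.
rewrite !E.
set w := x - x'; have w0 := norm_coord_le w 0; have w1 := norm_coord_le w 1.
have -> : eps * `|w| = `|w| * (eps / 2) + `|w| * (eps / 2) by field.
by apply: lerD; apply: ler_pM => //; exact: ltW.
Qed.

Hypothesis J_unit : J \in unitmx.

(** The lower bound on |g x - g x'| makes g injective. Surjectivity follows by minimising |g x - y|
    over a closed ball: a Newton step with the derivative frozen at x0 stays in that ball and at
    least halves the error, so the minimum is 0. *)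
Theorem inverse_function : exists r K, [/\ 0 < r, 0 < K, ball x0 r `<=` U,
    forall x x', ball x0 r x -> ball x0 r x' -> `|x - x'| <= K * `|g x - g x'|
    & forall y, `|y - g x0| < r / K / 2 -> exists2 x, ball x0 r x & g x = y].
Proof.
have [K K0 NK] := mulmx_norm_le (invmx J).
(* With this constant the nonlinear error, after multiplication by the inverse of J, is at most half
   of |x - x'|. *)
have K2 : 0 < (2 * K)^-1 by rewrite invr_gt0 mulr_gt0.
have [r r0 [rU rC]] := near_contraction K2.
have half a : K * ((2 * K)^-1 * a) = a / 2 by field; rewrite gt_eqF.
exists r, (2 * K); split=> //; first by rewrite mulr_gt0.
  move=> x x' xB x'B.
  have E : x - x' = ((x - x') *m J - (g x - g x')) *m invmx J + (g x - g x') *m invmx J.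
    by rewrite -mulmxDl subrK mulmxK.
  have : `|x - x'| <= K * ((2 * K)^-1 * `|x - x'|) + K * `|g x - g x'|.
    rewrite {1}E; apply: le_trans (ler_normD _ _) _; apply: lerD => //.
    by apply: le_trans (NK _) _; rewrite ler_pM2l //; exact: rC.
  by rewrite half; lra.
move=> y yB; pose D : set 'rV[R]_2 := [set x | `|x0 - x| <= r / 2].
have DB x : D x -> ball x0 r x.
  by rewrite /D -ball_normE /= => /le_lt_trans; apply; rewrite ltr_pdivrMr //; lra.
pose f x := x - (g x - y) *m invmx J.
have fD : set_fun D D f.
  move=> x Dx; rewrite /D /=.
  have -> : x0 - f x = ((x0 - x) *m J - (g x0 - g x)) *m invmx J - (y - g x0) *m invmx J.
    rewrite /f !mulmxBl !mulmxK //; move: (g x *m _) (g x0 *m _) (y *m _) => a b c.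
    by apply/rowP => j; rewrite !mxE; ring.
  apply: le_trans (ler_normB _ _) _.
  have H1 : K * `|y - g x0| < r / 4.
    move: yB; rewrite -ltr_pdivlMl //.
    by have -> : r / (2 * K) / 2 = K^-1 * (r / 4) by field; rewrite gt_eqF.
  have H2 := NK (y - g x0).
  have H3 : `|((x0 - x) *m J - (g x0 - g x)) *m invmx J| <= `|x0 - x| / 2.
    apply: le_trans (NK _) _; rewrite -half ler_pM2l //.
    exact: (rC x0 x (ballxx x0 r0) (DB x Dx)).
  by move: Dx; rewrite /D /=; lra.
have cD : compact D.
  apply: bounded_closed_compact; last exact: closed_closed_ball_.
  exists (`|x0| + r / 2); split; first by rewrite num_real.
  move=> c /= cr x Dx; apply: le_trans (ltW cr).
  rewrite -lerBlDl; apply: le_trans Dx.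
  by rewrite distrC; exact: lerB_dist.
have D0 : D !=set0 by exists x0; rewrite /D /= subrr normr0 divr_ge0 // ltW.
have gc : {within D, continuous (fun x => `|g x - y|)}.
  apply: continuous_in_subspaceT => x /set_mem Dx.
  have gx : {for x, continuous g} by apply: differentiable_continuous; apply: gd; apply: rU; exact: DB.
  have gxy : g z - y @[z --> x] --> g x - y by exact: (cvgB gx (cvg_cst y)).
  by rewrite /prop_for /continuous_at; exact: cvg_norm gxy.
have [x /set_mem Dx xmin] := EVT_min_rV D0 cD gc.
exists x; first exact: DB.
have Dfx : D (f x) by exact: fD.
have := xmin (f x) (mem_set Dfx).
have fx : f x - x = - ((g x - y) *m invmx J) by rewrite /f addrC addKr.
have -> : g (f x) - y = - ((f x - x) *m J - (g (f x) - g x)).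
  by rewrite fx mulNmx mulmxKV //; apply/rowP => j; rewrite !mxE; ring.
rewrite normrN => H1; have H2 := rC (f x) x (DB _ Dfx) (DB _ Dx).
rewrite fx in H1; rewrite fx normrN in H2.
have H3 : (2 * K)^-1 * `|(g x - y) *m invmx J| <= `|g x - y| / 2.
  by rewrite [leRHS]mulrC invfM -mulrA ler_pM2l ?invr_gt0 // ler_pdivrMl //.
have H0 : `|g x - y| <= 0 by move: H1 H2 H3; lra.
by apply/eqP; rewrite -subr_eq0 -normr_le0.
Qed.

(** Differentiability of the local inverse, in the form needed for lifts of segments. The inverse
    bound makes |c t - c t0| at most a multiple of |t - t0|, and [near_contraction] then bounds the
    error of the linear approximation. *)
Lemma is_derive_lift (c : R -> 'rV[R]_2) (t0 : R) (v y : 'rV[R]_2) : c t0 = x0 ->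
  {for t0, continuous c} -> (\forall t \near t0, g (c t) = t *: v + y) ->
  is_derive t0 1 c (v *m invmx J).
Proof.
move=> ct0 cc gct; set N := invmx J.
have [K K0 NK] := mulmx_norm_le N.
have [r [K' [r0 K'0 _ gK' _]]] := inverse_function.
have near_le e : 0 < e -> \forall t \near t0,
    `|(c t - c t0) - (t - t0) *: (v *m N)| <= e * `|t - t0|.
  move=> e0; have v1 : 0 < `|v| + 1 by rewrite ltr_wpDl.
  (* [|v| + 1] instead of the norm keeps the denominator positive for v = 0. *)
  have eps0 : 0 < e / (K * K' * (`|v| + 1)) by rewrite divr_gt0 // !mulr_gt0.
  have [r' r'0 [_ rC]] := near_contraction eps0; set eps := e / _ in rC eps0.
  have N1 : nbhs t0 (c @^-1` ball x0 r) by apply: cc; rewrite ct0; exact: nbhsx_ballx.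
  have N2 : nbhs t0 (c @^-1` ball x0 r') by apply: cc; rewrite ct0; exact: nbhsx_ballx.
  have gct0 := nbhs_singleton gct.
  apply: filterS2 (filterI N1 N2) gct => t [/= tr tr'] gt.
  have E : g (c t) - g (c t0) = (t - t0) *: v.
    by rewrite gt gct0; apply/rowP => j; rewrite !mxE; ring.
  have H1 : `|c t - c t0| <= K' * (`|t - t0| * `|v|).
    by rewrite -normrZ -E; apply: gK' => //; rewrite ct0; exact: ballxx.
  have H2 := rC (c t) (c t0) tr'.
  have {}H2 := H2 (_ : ball x0 r' (c t0)); rewrite E in H2.
  have -> : c t - c t0 - (t - t0) *: (v *m N) = ((c t - c t0) *m J - (t - t0) *: v) *m N.
    by rewrite mulmxBl mulmxK // -scalemxAl.
  apply: le_trans (NK _) _.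
  have {}H2 : `|(c t - c t0) *m J - (t - t0) *: v| <= eps * (K' * (`|t - t0| * (`|v| + 1))).
    apply: le_trans (H2 _) _; first by rewrite ct0; exact: ballxx.
    rewrite ler_pM2l //; apply: le_trans H1 _; rewrite ler_pM2l //.
    by rewrite ler_wpM2l // lerDl.
  have -> : e * `|t - t0| = K * (eps * (K' * (`|t - t0| * (`|v| + 1)))).
    by rewrite /eps; field; rewrite !gt_eqF.
  by rewrite ler_pM2l.
have H : h^-1 *: (c (h *: 1 + t0) - c t0) @[h --> 0^'] --> v *m N.
  apply/cvgrPdist_le => e /near_le near_e.
  have c0 : h * 1 + t0 @[h --> (0 : R)] --> 0 * 1 + t0.
    exact: (cvgD (cvgM cvg_id (cvg_cst (1 : R))) (cvg_cst t0)).
  rewrite mul0r add0r in c0; have {c0} N0 := nbhs_dnbhs (c0 _ near_e).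
  apply: filterS2 N0 (nbhs_dnbhs_neq (0 : R)) => h /=; rewrite addrK => hle h_neq0.
  have h1 : h *: 1 = h by exact: mulr1.
  rewrite mulr1 -{1}h1 in hle.
  rewrite distrC -(ler_pM2l (_ : 0 < `|h|)) ?normr_gt0 // -normrZ scalerBr scalerA mulfV //.
  by rewrite scale1r [leRHS]mulrC.
split; first exact: (cvgP _ H).
exact: (cvg_lim (@norm_hausdorff _ _) H).
Qed.

End InverseFunction.

(** * Local homeomorphisms with path lifting *)

Section LocalHomeomorphism.
Variables (R : realType) (M : topologicalType) (n : nat).
Implicit Types (y z v : 'rV[R]_n).
Variable psi : M -> 'rV[R]_n.
Hypothesis hM : hausdorff_space M.

(** [psi] restricts to a homeomorphism of [W] onto a ball around [psi p], with inverse [tau]. The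
    image is a whole ball, so that segments stay in it. *)
Definition local_section (p : M) (W : set M) (r : R) (tau : 'rV[R]_n -> M) :=
  [/\ open W, W p, 0 < r,
      forall q, W q -> ball (psi p) r (psi q) /\ tau (psi q) = q
    & forall y, ball (psi p) r y ->
        [/\ W (tau y), psi (tau y) = y & {for y, continuous tau}]].

Hypothesis psi_local : forall p, exists W r tau, local_section p W r tau.

Let near_injective (p : M) : exists2 W : set M, nbhs p W &
  forall q q', W q -> W q' -> psi q = psi q' -> q = q'.
Proof.
have [W [r [tau [Wo Wp _ Wtau _]]]] := psi_local p.
exists W; first exact: open_nbhs_nbhs.
by move=> q q' /Wtau[_ {2}<-] /Wtau[_ {2}<-] ->.
Qed.

(** The set where the lifts agree is open in the interval because psi is locally injective, and
    closed because M is Hausdorff. *)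
Lemma unique_lift (a b : R) (f g : R -> M) : a <= b ->
  (forall t, t \in `[a, b] -> {for t, continuous f}) ->
  (forall t, t \in `[a, b] -> {for t, continuous g}) ->
  (forall t, t \in `[a, b] -> psi (f t) = psi (g t)) ->
  f a = g a -> f b = g b.
Proof.
move=> ab fc gc fg fga.
pose B := [set` `[a, b]] `&` [set t | f t = g t].
suff BT : B = [set` `[a, b]].
  have : B b by rewrite BT /= in_itv /= lexx ab.
  by case.
have cab : connected [set` `[a, b]] by exact: segment_connected.
apply: cab.
- by exists a; split=> //=; rewrite in_itv /= lexx ab.
- exists [set t | \forall t' \near t, t' \in `[a, b] -> f t' = g t'].
    by rewrite openE => t; exact: nbhs_interior.
  apply/seteqP; split=> t [tab] /=; last first.
    by move=> /nbhs_singleton/(_ tab) tfg; split.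
  move=> tfg; split=> //.
  have [W Wp Winj] := near_injective (f t).
  have Nf : nbhs t (f @^-1` W) by exact: (fc t tab).
  have Ng : nbhs t (g @^-1` W) by apply: (gc t tab); rewrite -tfg.
  apply: filterS2 Nf Ng => t' ft' gt' t'ab; apply: Winj => //; exact: fg.
- exists (~` [set t | \forall t' \near t, t' \in `[a, b] -> f t' <> g t']).
    apply: open_closedC; rewrite openE => t; exact: nbhs_interior.
  apply/seteqP; split=> t [tab] /=.
    by move=> tfg; split=> // /nbhs_singleton/(_ tab).
  move=> H; split=> //; apply: contrapT => tfg; apply: H.
  move: hM; rewrite open_hausdorff => /(_ (f t) (g t)).
  have /eqP tfg' := tfg; move=> /(_ tfg')[[P Q] /= [/set_mem Pf /set_mem Qg] [Po Qo PQ]].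
  have Nf : nbhs t (f @^-1` P) by apply: (fc t tab); exact: open_nbhs_nbhs.
  have Ng : nbhs t (g @^-1` Q) by apply: (gc t tab); exact: open_nbhs_nbhs.
  apply: filterS2 Nf Ng => t' ft' gt' t'ab fgt'.
  by move/eqP/seteqP: PQ => [/(_ (f t'))]; case; split=> //; rewrite fgt'.
Qed.

Let seg y z (t : R) := t *: (z - y) + y.

Let seg0 y z : seg y z 0 = y. Proof. by rewrite /seg scale0r add0r. Qed.
Let seg1 y z : seg y z 1 = z. Proof. by rewrite /seg scale1r subrK. Qed.
Let seg_seg y z t u : seg y (seg y z t) u = seg y z (u * t).
Proof. by rewrite /seg addrK scalerA. Qed.

Let seg_continuous y z : continuous (seg y z).
Proof.
move=> t; apply: cvgD; last exact: cvg_cst.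
by apply: cvgZr_tmp; exact: cvg_id.
Qed.

Let seg_continuous2 y t : continuous (fun z => seg y z t).
Proof.
move=> z.
have H : z' - y @[z' --> z] --> z - y by exact: (cvgB cvg_id (cvg_cst y)).
exact: (cvgD (cvgZ (cvg_cst t) H) (cvg_cst y)).
Qed.

Let ball_seg c y z r t : ball c r y -> ball c r z -> 0 <= t <= 1 ->
  ball c r (seg y z t).
Proof.
rewrite -!ball_normE /= => yr zr /andP[t0 t1].
have -> : c - seg y z t = t *: (c - z) + (1 - t) *: (c - y).
  by apply/rowP => j; rewrite !mxE; ring.
apply: le_lt_trans (ler_normD _ _) _.
rewrite !normrZ ger0_norm // ger0_norm ?subr_ge0 //.
have [->|t_neq0] := eqVneq t 0; first by rewrite mul0r add0r subr0 mul1r.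
have t_gt0 : 0 < t by rewrite lt_neqAle eq_sym t_neq0.
have -> : r = t * r + (1 - t) * r by ring.
by apply: ltr_leD; [rewrite ltr_pM2l|apply: ler_wpM2l; rewrite ?subr_ge0 // ltW].
Qed.

Variable p0 : M.
Let y0 := psi p0.

(** The domain is star-shaped around y0, so two sections can be compared along rays by unique
    lifting and therefore agree on the intersection of their domains. *)
Let is_section (V : set 'rV[R]_n) (s : 'rV[R]_n -> M) :=
  [/\ open V, V y0, forall y t, V y -> 0 <= t <= 1 -> V (seg y0 y t),
      forall y, V y -> {for y, continuous s} /\ psi (s y) = y
    & s y0 = p0].

Let section_unique V s V' s' y : is_section V s -> is_section V' s' ->
  V y -> V' y -> s y = s' y.
Proof.
move=> [_ _ starV sV s0] [_ _ starV' sV' s0'] Vy Vy'.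
rewrite -(seg1 y0 y).
have segV t : t \in `[0, 1] -> V (seg y0 y t) /\ V' (seg y0 y t).
  by rewrite in_itv /= => t01; split; [exact: starV|exact: starV'].
have comp (s1 : 'rV[R]_n -> M) (t : R) : {for seg y0 y t, continuous s1} ->
    {for t, continuous (fun t => s1 (seg y0 y t))}.
  by move=> H A /H; exact: seg_continuous.
apply: (@unique_lift 0 1 (fun t => s (seg y0 y t)) (fun t => s' (seg y0 y t))) => //.
- by move=> t /segV[/sV[/comp]].
- by move=> t /segV[_ /sV'[/comp]].
- by move=> t /segV[/sV[_ ->] /sV'[_ ->]].
- by rewrite seg0 s0 s0'.
Qed.

(** The union of all sections: since any two agree on their common domain, they glue, and no
    maximality principle is needed. *)
Let maximal_section : exists V s, is_section V s /\
  forall V' s', is_section V' s' -> V' `<=` V.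
Proof.
pose Om : set 'rV[R]_n := [set y | exists Vs, is_section Vs.1 Vs.2 /\ Vs.1 y].
pose sig y : M := if pselect (Om y) is left H then (projT1 (cid H)).2 y else p0.
have sigE V s y : is_section V s -> V y -> sig y = s y.
  move=> Vs Vy; rewrite /sig; case: pselect => [H|[]]; last by exists (V, s).
  by case: cid => -[V' s'] /= [Vs' Vy']; exact: section_unique Vs' Vs Vy' Vy.
have OmE V s : is_section V s -> V `<=` Om by move=> Vs y Vy; exists (V, s).
have [V1 [s1 Vs1]] : exists V s, is_section V s.
  have [W [r [tau [Wo Wp r0 Wtau tauB]]]] := psi_local p0.
  exists (ball y0 r), tau; split.
  - exact: ball_open.
  - exact: ballxx.
  - by move=> y t yB; apply: ball_seg => //; exact: ballxx.
  - by move=> y /tauB[].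
  - by have [_ ->] := Wtau p0 Wp.
exists Om, sig; split; last by move=> V s /OmE.
have Vs1' := Vs1; have [_ V1y0 _ _ s1y0] := Vs1.
split.
- rewrite openE => y [[V s] /= [Vs Vy]]; have [Vo _ _ _ _] := Vs.
  apply: filterS (OmE V s Vs) _; exact: open_nbhs_nbhs.
- exact: (OmE V1 s1 Vs1).
- move=> y t [[V s] /= [Vs Vy]] t01; apply: (OmE V s Vs).
  by have [_ _ starV _ _] := Vs; exact: starV.
- move=> y [[V s] /= [Vs Vy]]; rewrite (sigE V s) //.
  have [Vo _ _ /(_ y Vy)[sc ->] _] := Vs; split=> //.
  rewrite /prop_for /continuous_at (sigE V s) //.
  apply: cvg_trans sc; apply: (near_eq_cvg (FF := nbhs_filter y)).
  have NV : nbhs y V by exact: open_nbhs_nbhs.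
  by apply: filterS NV => z Vz; rewrite (sigE V s).
- by rewrite (sigE V1 s1).
Qed.


(** The form in which completeness enters: the lift of a half-open segment starting at [y0] has an
    endpoint. *)
Hypothesis lift_limit : forall (gamma : R -> M) v,
  (forall t, 0 < t < 1 -> {for t, continuous gamma}) ->
  (forall t, 0 < t < 1 -> psi (gamma t) = t *: v + y0) ->
  exists p : M, gamma t @[t --> 1^'-] --> p.

Hypothesis psi_continuous : continuous psi.

(* If Om is the largest domain and y its first exit point along a ray, the lift
   of [y0, y[ has a limit by hypothesis; the local section there extends the
   section to Om together with the points beyond a small ball B around some
   point of the ray close to y. *)
Let global_section : exists s : 'rV[R]_n -> M,
  forall y, {for y, continuous s} /\ psi (s y) = y.
Proof.
have [Om [sig [Os Omax]]] := maximal_section.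
have [Oo Oy0 starO sO s0] := Os.
suff OT y : Om y by exists sig => y; exact: sO.
apply: contrapT => y1O.
pose T := [set t : R | 0 <= t /\ Om (seg y0 y t)].
have T0 : T 0 by rewrite /T /= seg0.
have Tub t : T t -> t < 1.
  move=> [t0 tO]; rewrite ltNge; apply/negP => t1; apply: y1O.
  have := starO (seg y0 y t) t^-1 tO; rewrite seg_seg mulVf ?gt_eqF ?(lt_le_trans _ t1) //.
  by rewrite seg1; apply; rewrite invr_ge0 t0 invf_le1 // (lt_le_trans _ t1).
have supT : has_sup T.
  by split; [exists 0|exists 1 => t /Tub/ltW].
pose ts := sup T; pose ys := seg y0 y ts.
have ts0 : 0 <= ts by exact: sup_upper_bound.
have Tlt t : 0 <= t < ts -> T t.
  move=> /andP[t0 tts]; split=> //.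
  have dt : 0 < ts - t by rewrite subr_gt0.
  have [u [u0 uO]] := sup_adherent dt supT.
  rewrite -/ts subKr => tu; have u_gt0 := le_lt_trans t0 tu.
  have -> : t = t / u * u by rewrite divfK // gt_eqF.
  rewrite -seg_seg; apply: starO => //.
  by rewrite divr_ge0 //= ler_pdivrMr // mul1r ltW.
have ysO : ~ Om ys.
  move=> ysO; have Nts : nbhs ts [set t | Om (seg y0 y t)].
    by apply: seg_continuous; exact: open_nbhs_nbhs.
  have /nbhs_ballP[e /= e0 eO] := Nts.
  have : T (ts + e / 2).
    split; first by rewrite addr_ge0 // divr_ge0 // ltW.
    apply: eO; rewrite -ball_normE /= opprD addrA subrr sub0r normrN gtr0_norm ?divr_gt0 //.
    by rewrite ltr_pdivrMr // ltr_pMr // ltr1n.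
  have tsub : ubound T ts by exact: sup_upper_bound.
  by move/tsub; rewrite gerDl leNgt divr_gt0.
have ts_gt0 : 0 < ts.
  rewrite lt_neqAle ts0 andbT; apply/eqP => ts_eq0; apply: ysO.
  by rewrite /ys -ts_eq0 seg0.
have segO t : 0 < t < 1 -> Om (seg y0 ys t).
  move=> /andP[/ltW t0 t1]; rewrite seg_seg.
  by have [] // := Tlt (t * ts); rewrite mulr_ge0 //= gtr_pMl.
have comp (t : R) : {for seg y0 ys t, continuous sig} ->
    {for t, continuous (fun t => sig (seg y0 ys t))}.
  by move=> H A /H; exact: seg_continuous.
have [||p gp] := @lift_limit (fun t => sig (seg y0 ys t)) (ys - y0).
- by move=> t /segO/sO[/comp].
- by move=> t /segO/sO[_ ->].
have N01 : \forall t \near (1 : R)^'-, 0 < t < 1.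
  apply: filterS2 (nbhs_left_gt (@ltr01 R)) (nbhs_left_lt (1 : R)).
  by move=> t t0 t1; apply/andP.
have psip : psi p = ys.
  apply: (@cvg_unique _ _ (psi \o (fun t => sig (seg y0 ys t)) @ 1^'-)).
  - exact: norm_hausdorff.
  - by apply: cvg_comp gp _; exact: psi_continuous.
  - have c1 : seg y0 ys t @[t --> 1^'-] --> ys.
      by apply: cvg_at_left_filter; rewrite -{2}(seg1 y0 ys); exact: seg_continuous.
    apply: cvg_trans c1; apply: near_eq_cvg.
    by apply: filterS N01 => t /segO/sO[_] /= ->.
have [W [r [tau [Wo Wp r0 Wtau tauB]]]] := psi_local p.
move: Wtau tauB; rewrite psip => Wtau tauB.
have [t1 [t1I t1B t1W]] : exists t, [/\ 0 < t < 1, ball ys r (seg y0 ys t) &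
   W (sig (seg y0 ys t))].
  have N2 : \forall t \near (1 : R)^'-, W (sig (seg y0 ys t)).
    by apply: gp; exact: open_nbhs_nbhs.
  have [t [tI tW]] := filter_ex (filterI N01 N2); exists t; split=> //.
  by have [_ <-] := sO _ (segO t tI); have [] := Wtau _ tW.
set zs := seg y0 ys t1 in t1B t1W.
have zsO : Om zs by exact: segO.
have [rho rho0 rhoP] : exists2 rho, 0 < rho &
    forall z, ball zs rho z -> [/\ Om z, ball ys r z & W (sig z)].
  have N1 : nbhs zs Om by exact: open_nbhs_nbhs.
  have N2 : nbhs zs (ball ys r) by apply: open_nbhs_nbhs; split=> //; exact: ball_open.
  have N3 : nbhs zs (sig @^-1` W) by apply: (sO _ zsO).1; exact: open_nbhs_nbhs.
  have N : nbhs zs (Om `&` (ball ys r `&` sig @^-1` W)).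
    exact: (@filterI _ _ (nbhs_filter zs) _ _ N1 (@filterI _ _ (nbhs_filter zs) _ _ N2 N3)).
  have /nbhs_ballP[rho /= rho0 rhoP] := N.
  by exists rho => // z /rhoP[? []].
have sigtau z : ball zs rho z -> sig z = tau z.
  move=> /rhoP[zO _ zW]; have [_ E] := sO z zO.
  by have [_] := Wtau _ zW; rewrite E.
(* The points of the ball at [ys] whose segment from [y0] meets [ball zs rho]. This ball lies in
   [Om], so [Om] together with [C] is star-shaped. *)
pose C := ball ys r `&` \bigcup_(u in [set u : R | 0 < u <= 1])
  ((fun z => seg y0 z u) @^-1` ball zs rho).
have CP z u : ball ys r z -> 0 < u <= 1 -> ball zs rho (seg y0 z u) -> C z.
  by move=> zr u01 zu; split=> //; exists u.
have Co : open C.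
  apply: openI; first exact: ball_open.
  apply: bigcup_open => u _; move: (@seg_continuous2 y0 u) => /continuousP; apply.
  exact: ball_open.
(* From its parameter u in the small ball up to z the ray stays in the convex [ball ys r], where
   [tau] is defined. *)
have Cseg z u t : ball ys r z -> ball zs rho (seg y0 z u) ->
    t \in `[u, 1] -> ball ys r (seg y0 z t).
  rewrite in_itv /= => zB zu /andP[ut t1'].
  have [_ zuB _] := rhoP _ zu.
  have [u1|u1] := eqVneq u 1.
    by have -> : t = 1 by [apply/eqP; rewrite eq_le t1' -u1]; rewrite seg1.
  have u_lt1 : 0 < 1 - u by rewrite subr_gt0 lt_neqAle u1 (le_trans ut).
  have -> : seg y0 z t = seg (seg y0 z u) z ((t - u) / (1 - u)).
    apply/rowP => j; rewrite !mxE; set a := z 0 j; set b := y0 0 j.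
    by field; rewrite gt_eqF.
  apply: ball_seg => //; rewrite divr_ge0 ?subr_ge0 //= ?(ltW u_lt1) //.
    by rewrite ler_pdivrMr // mul1r lerB.
  by rewrite (le_trans ut).
(* [Om] and [C] may also meet outside the small ball; there both lifts continue along the ray the
   value that they share at the parameter u. *)
have agree z : Om z -> C z -> sig z = tau z.
  move=> zO [zB [u /= /andP[u0 u1] zu]]; rewrite -(seg1 y0 z).
  apply: (@unique_lift u 1 (fun t => sig (seg y0 z t)) (fun t => tau (seg y0 z t))) => //.
  - move=> t; rewrite in_itv /= => /andP[ut tle1].
    have t01 : 0 <= t <= 1 by rewrite tle1 (le_trans (ltW u0)).
    by have [c _] := sO _ (starO z t zO t01); move=> A /c; exact: seg_continuous.
  - move=> t tu; have [_ _ c] := tauB _ (Cseg z u t zB zu tu).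
    by move=> A /c; exact: seg_continuous.
  - move=> t tu; have [_ -> _] := tauB _ (Cseg z u t zB zu tu).
    move: tu; rewrite in_itv /= => /andP[ut tle1].
    have t01 : 0 <= t <= 1 by rewrite tle1 (le_trans (ltW u0)).
    by have [_ ->] := sO _ (starO z t zO t01).
  - exact: sigtau.
pose s z := if `[< Om z >] then sig z else tau z.
have sOm z : Om z -> s z = sig z by move=> zO; rewrite /s asboolT.
have sC z : C z -> s z = tau z.
  by move=> zC; rewrite /s; case: asboolP => // zO; exact: agree.
apply: ysO; apply: (Omax (Om `|` C) s); last first.
  right; apply: (CP _ t1); first exact: ballxx.
    by case/andP: t1I => *; rewrite ltW ?andbT.
  exact: ballxx.
split.
- exact: openU.
- by left.
- move=> z t [zO|[zB [u /= u01 zu]]] t01; first by left; exact: starO.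
  have /andP[u0 u1] := u01; have /andP[t0 tle1] := t01.
  have [tu|/ltW ut] := leP t u.
    left; have -> : t = t / u * u by rewrite divfK // gt_eqF.
    rewrite -seg_seg; apply: starO; first by have [] := rhoP _ zu.
    by rewrite divr_ge0 ?(ltW u0) //= ler_pdivrMr // mul1r.
  have t_gt0 := lt_le_trans u0 ut.
  right; apply: (CP _ (u / t)).
  + by apply: Cseg zB zu _; rewrite in_itv /= ut.
  + by rewrite divr_gt0 //= ler_pdivrMr // mul1r.
  + by rewrite seg_seg divfK // gt_eqF.
- move=> z zV.
  have key (f : 'rV[R]_n -> M) (V : set 'rV[R]_n) : open V -> V z ->
      (forall y, V y -> s y = f y) -> {for z, continuous f} /\ psi (f z) = z ->
      {for z, continuous s} /\ psi (s z) = z.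
    move=> Vo Vz sf [fc fz]; rewrite sf //; split=> //.
    rewrite /prop_for /continuous_at sf //; apply: cvg_trans fc.
    apply: (near_eq_cvg (FF := nbhs_filter z)).
    have NV : nbhs z V by exact: open_nbhs_nbhs.
    by apply: filterS NV => z' Vz'; rewrite sf.
  case: zV => [zO|zC]; first exact: (key sig Om Oo zO sOm (sO z zO)).
  apply: (key tau C Co zC sC).
  by have [zB _] := zC; have [_ ? ?] := tauB z zB.
- by rewrite sOm.
Qed.

(** A global section makes psi surjective; injectivity means that the section is onto, and its range
    is open and closed in the connected M. *)
Theorem local_homeomorphism_bijective : connected [set: M] -> bijective psi.
Proof.
move=> cM; have [s sP] := global_section.
suff sT : range s = setT.
  exists s => [p|y]; last by have [] := sP y.
  have : range s p by rewrite sT.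
  by move=> [y _ <-]; have [_ ->] := sP y.
apply: connected_clopen => //; last by exists (s 0); exists 0.
  rewrite openE => _ [y _ <-].
  have [W [r [tau [Wo Wp r0 Wtau tauB]]]] := psi_local (s y).
  have N1 : nbhs (s y) W by exact: open_nbhs_nbhs.
  have N2 : nbhs (s y) (psi @^-1` (s @^-1` W)).
    have [sc sy] := sP y; apply: psi_continuous; rewrite sy; exact: sc.
  apply: filterS2 N1 N2 => q qW sqW; exists (psi q) => //.
  have [_ E] := sP (psi q).
  have [_ Eq] := Wtau _ qW; have [_ Es] := Wtau _ sqW.
  by rewrite -Es E.
(* If a point near q were s(y), then s and the local section at q would agree along the segment from
   y to psi(q), and q itself would lie in the range. *)
rewrite openE => q qs; have [W [r [tau [Wo Wp r0 Wtau tauB]]]] := psi_local q.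
have N1 : nbhs q W by exact: open_nbhs_nbhs.
apply: filterS N1 => q' q'W [y _ yq']; apply: qs; exists (psi q) => //.
have [_ sy] := sP y; have [yB tauy] := Wtau _ q'W.
have [_ tauq] := Wtau q Wp.
suff : s (psi q) = tau (psi q) by move=> ->.
have qB : ball (psi q) r (psi q) by exact: ballxx.
rewrite -yq' sy in yB tauy.
have segB t : t \in `[0, 1] -> ball (psi q) r (seg y (psi q) t).
  by rewrite in_itv => t01; exact: ball_seg.
rewrite -(seg1 y (psi q)).
apply: (@unique_lift 0 1 (fun t => s (seg y (psi q) t)) (fun t => tau (seg y (psi q) t))) => //.
- by move=> t _; have [c _] := sP (seg y (psi q) t); move=> A /c; exact: seg_continuous.
- by move=> t /segB/tauB[_ _ c] A /c; exact: seg_continuous.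
- by move=> t /segB/tauB[_ -> _]; have [_ ->] := sP (seg y (psi q) t).
- by rewrite seg0 tauy.
Qed.

End LocalHomeomorphism.

(** * Complete surfaces *)

Lemma mulmx_continuous (R : realType) m n (Q : 'M[R]_(m, n)) :
  continuous (mulmxr Q : 'rV[R]_m -> 'rV[R]_n).
Proof.
move=> x; apply: continuous_row => i.
rewrite (_ : (fun t => _) = (fun t : 'rV[R]_m => \sum_j t 0 j * Q j i)); last first.
  by apply/funext => t; rewrite /mulmxr mxE.
apply: differentiable_continuous.
rewrite (_ : (fun t => _) = \sum_j (fun t : 'rV[R]_m => t 0 j * Q j i)); last first.
  by apply/funext => t; rewrite fct_sumE.
apply: differentiable_sum => j.
by apply: differentiableM; [exact: differentiable_coord|exact: differentiable_cst].
Qed.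

Lemma is_derive_mulmx (R : realType) (V : normedModType R) m n
    (f : V -> 'rV[R]_m) (Q : 'M[R]_(m, n)) x v df :
  is_derive x v f df -> is_derive x v (fun y => f y *m Q) (df *m Q).
Proof.
move=> fx; apply: is_derive_mx => i j; rewrite ord1 mxE.
rewrite (_ : (fun y => _) = \sum_k (fun y => f y 0 k * Q k j)); last first.
  by apply/funext => y; rewrite mxE fct_sumE.
apply: is_derive_sum => k.
have H : is_derive x v (fun y => f y 0 k * Q k j) _ :=
  is_deriveM (is_derive_coord 0 k fx) (is_derive_cst (Q k j) x v).
apply: is_derive_eq H _.
by rewrite /GRing.scale /= mulr0 add0r mulrC.
Qed.

Lemma class_C_mulmx (R : realType) (V : normedModType R) m n k (U : set V)
    (f : V -> 'rV[R]_m) (Q : 'M[R]_(m, n)) : open U ->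
  class_C k U f -> class_C k U (fun y => f y *m Q).
Proof.
move=> oU; elim: k f => [|k IH] f /= => [fc x Ux|[fd fD]].
  have fx : {for x, continuous f} := fc x Ux.
  exact: (@continuous_comp _ _ _ f (mulmxr Q) x fx (@mulmx_continuous _ _ _ Q _)).
split=> [x Ux|v].
  apply: (@differentiable_comp _ _ _ _ f (mulmxr Q)); first exact: fd.
  exact: linear_differentiable (@mulmx_continuous _ _ _ Q).
apply: class_C_ext oU _ (IH _ (fD v)) => x Ux.
have fx : derivable f x v by apply: diff_derivable; exact: fd.
by have [_ ->] := is_derive_mulmx Q (derivableP fx).
Qed.

(** Cramer's rule, written out because the continuity of the velocity of a lifted curve is read off
    from it. *)
Lemma mulmx_inv2 (R : realType) (N : 'M[R]_2) (v : 'rV[R]_2) : N \in unitmx ->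
  let d := N 0 0 * N 1 1 - N 0 1 * N 1 0 in
  [/\ d != 0, (v *m invmx N) 0 0 = (v 0 0 * N 1 1 - v 0 1 * N 1 0) / d
    & (v *m invmx N) 0 1 = (v 0 1 * N 0 0 - v 0 0 * N 0 1) / d].
Proof.
move=> uN d; have d0 : d != 0.
  have [E00 E01 E10 E11] : [/\ (N *m invmx N) 0 0 = 1, (N *m invmx N) 0 1 = 0,
      (N *m invmx N) 1 0 = 0 & (N *m invmx N) 1 1 = 1].
    by rewrite mulmxV // !mxE.
  move: E00 E01 E10 E11; rewrite ![(N *m _) _ _]mxE !sum_ord2.
  move: (invmx N) => L E00 E01 E10 E11.
  have dL : d * (L 0 0 * L 1 1 - L 0 1 * L 1 0) = 1.
    transitivity ((N 0 0 * L 0 0 + N 0 1 * L 1 0) * (N 1 0 * L 0 1 + N 1 1 * L 1 1)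
      - (N 0 0 * L 0 1 + N 0 1 * L 1 1) * (N 1 0 * L 0 0 + N 1 1 * L 1 0)).
      by rewrite /d; ring.
    by rewrite E00 E01 E10 E11; ring.
  by apply/eqP => d0; move/eqP: dL; rewrite d0 mul0r eq_sym oner_eq0.
have := mulmxKV uN v; move: (v *m invmx N) => u E.
have := congr1 (fun w : 'rV[R]_2 => w 0 1) E; have := congr1 (fun w : 'rV[R]_2 => w 0 0) E.
rewrite /= !mulmx_row2 => <- <-.
by split=> //; apply: (mulIf d0); rewrite divfK // /d; ring.
Qed.

(** * The projection to the first two coordinates *)

Section Developing.
Variables (R : realType) (M : topologicalType) (S : atlas R M).
Variable phi : M -> 'rV[R]_4.
Hypothesis hM : hausdorff_space M.
Hypothesis cM : connected [set: M].
Hypothesis imm : immersion_in_AdS S phi.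
Hypothesis sl : spacelike S phi.
Variables (s : R) (A : 'M[R]_4).
Hypothesis s1 : s ^+ 2 < 1.
Hypothesis iA : linear_isometry A.
Hypothesis phiA : forall p, natural_H2 s (phi p *m A).

Let first2 : 'M[R]_(4, 2) := \matrix_(i, j) ((i : nat) == j)%:R.

Let first2E (x : 'rV[R]_4) : (x *m first2) 0 0 = x 0 0 /\ (x *m first2) 0 1 = x 0 1.
Proof.
rewrite !mxE !big_ord_recl !big_ord0 !mxE /= !mulr0 !mulr1 !addr0 add0r.
by split=> //; congr (x 0 _); apply/val_inj.
Qed.

Let psi p := phi p *m A *m first2.
Let F (a : cindex S) := phi \o param a.
Let g a x := F a x *m A *m first2.

Let FC a : smooth (ccod a) (F a). Proof. by have [_ + _] := imm. Qed.

Let gC a : class_C 1 (ccod a) (g a).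
Proof.
have oa := @open_ccod _ _ S a.
by apply: class_C_mulmx => //; apply: class_C_mulmx => //; exact: FC.
Qed.

Let Phi3 p : (phi p *m A) 0 3%:R = s.
Proof. by have /(natural_H2P _ s1)[] := phiA p. Qed.

Let psi_continuous : continuous psi.
Proof.
move=> p; have phic : {for p, continuous phi} by exact: (immersion_continuous imm).
have H : {for p, continuous (fun q => phi q *m A)}.
  exact: (@continuous_comp _ _ _ phi (mulmxr A) p phic (@mulmx_continuous _ _ _ A _)).
exact: (@continuous_comp _ _ _ _ (mulmxr first2) p H (@mulmx_continuous _ _ _ first2 _)).
Qed.

(** A tangent vector killed by the projection has fourth component 0, since the surface lies in a
    slice; its square is then minus that of its third component, which is impossible on a space-like
    surface. *)
Let g_injective a x : ccod a x -> injective (fun v => 'D_v (g a) x).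
Proof.
move=> ax; have [Fd _] := FC a 1; have {}Fd := Fd x ax.
have dF v : is_derive x v (F a) ('D_v (F a) x).
  by apply: derivableP; exact: diff_derivable.
have gE v : 'D_v (g a) x = 'D_v (F a) x *m A *m first2.
  by have [_] := is_derive_mulmx first2 (is_derive_mulmx A (dF v)).
move=> v w; rewrite !gE => vw; apply/eqP; rewrite -subr_eq0; apply/negP => /negP vw0.
have := sl ax vw0; rewrite -/(F a) -iA.
have E u : 'D_u (F a) x = 'd (F a) x u by exact: deriveE.
have {}E : 'D_(v - w) (F a) x = 'D_v (F a) x - 'D_w (F a) x by rewrite !E; exact: linearB.
have /(is_derive_mulmx A)/(is_derive_coord 0 3%:R) du3 := dF (v - w).
have u0 : 'D_(v - w) (F a) x *m A *m first2 = 0.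
  by move/eqP: vw; rewrite -subr_eq0 => /eqP vw; rewrite E !mulmxBl; exact: vw.
move: du3 u0; set u := _ *m A => du3 u0.
have u3 : u 0 3%:R = 0.
  have Fs : (fun y => (F a y *m A) 0 3%:R) = cst s by apply/funext => y; exact: Phi3.
  rewrite Fs in du3; have [_ <-] := du3; exact: derive_cst.
have [E0 E1] := first2E u; rewrite u0 in E0 E1.
have z0 i : (0 : 'rV[R]_2) 0 i = 0 by rewrite mxE.
rewrite !z0 in E0 E1; rewrite form4 u3 -E0 -E1 !mulr0 addr0 subr0 sub0r oppr_gt0 ltNge.
by rewrite -expr2 sqr_ge0.
Qed.

Let psi_param a q : cdom a q -> g a (chart a q) = psi q.
Proof. by move=> aq; rewrite /g /F /= chartK. Qed.

Let psi_local p : exists W r tau, local_section psi p W r tau.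
Proof.
have [a ap] := cdom_cover S p; have ax := chart_ccod ap.
set x0 := chart a p in ax.
have oa := @open_ccod _ _ S a; have [gd _] := gC a.
have Ju := jacobian_unit (gd x0 ax) (g_injective ax).
have [r [K [r0 K0 rU rK rsurj]]] := inverse_function oa (gC a) ax Ju.
rewrite psi_param // in rsurj.
pose rho := r / K / 2; have rho0 : 0 < rho by rewrite !divr_gt0.
have rsurj' y : ball (psi p) rho y -> exists2 x, ball x0 r x & g a x = y.
  move=> yB; apply: rsurj; move: yB; rewrite -ball_normE /= distrC; exact.
(* [x0] is a default value outside the ball, where [inv] is never evaluated below. *)
pose inv y : 'rV[R]_2 := if pselect (ball (psi p) rho y) is left H
  then projT1 (cid2 (rsurj' y H)) else x0.
have invP y : ball (psi p) rho y -> ball x0 r (inv y) /\ g a (inv y) = y.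
  by move=> yB; rewrite /inv; case: pselect => // H; case: cid2.
(* Both conditions are imposed: the chart value in the ball of injectivity, and the image in the
   ball onto which [W] is to be mapped. *)
pose W := cdom a `&` [set q | ball x0 r (chart a q)] `&` [set q | ball (psi p) rho (psi q)].
exists W, rho, (param a \o inv); split=> //.
- rewrite openE => q [[aq qr] qrho].
  have Nr : nbhs (chart a q) (ball x0 r) by apply: open_nbhs_nbhs; split=> //; exact: ball_open.
  have Nrho : nbhs (psi q) (ball (psi p) rho).
    by apply: open_nbhs_nbhs; split=> //; exact: ball_open.
  have N2 : nbhs q [set q | ball (psi p) rho (psi q)] by exact: (psi_continuous Nrho).
  by apply: filterS2 (near_chart aq Nr) N2 => q' [].
- by split; [split=> //|]; exact: ballxx.
- move=> q [[aq qr] qrho]; split=> //=.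
  have [xr gx] := invP _ qrho.
  have := rK _ _ xr qr; rewrite gx psi_param // subrr normr0 mulr0 normr_le0 subr_eq0.
  by move=> /eqP ->; rewrite chartK.
- move=> y yB; have [xr gx] := invP _ yB; have ay := rU _ xr.
  have psiy : psi (param a (inv y)) = y by exact: gx.
  split=> //=.
    split; last by rewrite /= psiy.
    by split; [exact: param_cdom|rewrite /= paramK].
  have invc : {for y, continuous inv}.
    apply/(@cvgrPdist_lt _ _ _ (nbhs y) (nbhs_filter y)) => e e0.
    have NB : nbhs y (ball (psi p) rho) by apply: open_nbhs_nbhs; split=> //; exact: ball_open.
    have eK : 0 < e / K by rewrite divr_gt0.
    have Ne : nbhs y (ball y (e / K)) by exact: nbhsx_ballx.
    apply: filterS2 NB Ne => y' yB'; rewrite -ball_normE /= => yy'.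
    have [xr' gx'] := invP _ yB'.
    apply: le_lt_trans (rK _ _ xr xr') _; rewrite gx gx'.
    by rewrite mulrC -ltr_pdivlMr.
  exact: (@continuous_comp _ _ _ inv (param a) y invc (param_continuous ay)).
Qed.

Section Lift.
Variables (gamma : R -> M) (v y : 'rV[R]_2).
Hypothesis gamma_continuous : forall t, 0 < t < 1 -> {for t, continuous gamma}.
Hypothesis psi_gamma : forall t, 0 < t < 1 -> psi (gamma t) = t *: v + y.

Let lift_dom (a : cindex S) := `]0, 1[ `&` gamma @^-1` cdom a.

Let near_lift a t : lift_dom a t -> \forall t' \near t, lift_dom a t'.
Proof.
move=> [tI ta]; have t01 : 0 < t < 1 by move: tI; rewrite /= in_itv.
have N1 : nbhs t [set` `]0, 1[%R].
  by apply: open_nbhs_nbhs; split=> //; exact: interval_open.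
have N2 : nbhs t (gamma @^-1` cdom a).
  by apply: (gamma_continuous t01); apply: open_nbhs_nbhs; split=> //; exact: open_cdom.
exact: filterI N1 N2.
Qed.

Let lift_continuous a t : lift_dom a t -> {for t, continuous (chart a \o gamma)}.
Proof.
move=> [tI ta]; have t01 : 0 < t < 1 by move: tI; rewrite /= in_itv.
exact: (@continuous_comp _ _ _ gamma (chart a) t (gamma_continuous t01) (chart_continuous ta)).
Qed.

Let jac a x := jacobian (g a) x.

Let jac_unit a x : ccod a x -> jac a x \in unitmx.
Proof.
move=> ax; have [gd _] := gC a.
exact: jacobian_unit (gd x ax) (g_injective ax).
Qed.

Let lift_derive a t : lift_dom a t ->
  is_derive t 1 (chart a \o gamma) (v *m invmx (jac a (chart a (gamma t)))).
Proof.
move=> tD; have [tI ta] := tD; have ax := chart_ccod ta.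
have H := @is_derive_lift _ _ _ _ (@open_ccod _ _ S a) (gC a) ax (jac_unit ax).
apply: (H (chart a \o gamma) t v y erefl (lift_continuous tD)).
apply: filterS (near_lift tD) => t' [tI' ta'].
by rewrite /= psi_param // psi_gamma //; move: tI'; rewrite /= in_itv.
Qed.

(** The product of v with the inverse Jacobian by Cramer's rule, a quotient of continuous functions
    of t. *)
Let velocity a t : 'rV[R]_2 :=
  let N := jac a (chart a (gamma t)) in
  let d := N 0 0 * N 1 1 - N 0 1 * N 1 0 in
  \row_i (if i == 0 then (v 0 0 * N 1 1 - v 0 1 * N 1 0) / d
          else (v 0 1 * N 0 0 - v 0 0 * N 0 1) / d).

Let velocityE a t : lift_dom a t -> v *m invmx (jac a (chart a (gamma t))) = velocity a t.
Proof.
move=> [_ ta]; have [_ E0 E1] := mulmx_inv2 v (jac_unit (chart_ccod ta)).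
apply/rowP; apply: ord2_ind; rewrite /velocity mxE /=; first exact: E0.
exact: E1.
Qed.

Let velocity_continuous a t : lift_dom a t -> {for t, continuous (velocity a)}.
Proof.
move=> tD; have [tI ta] := tD; have ax := chart_ccod ta.
have jc k i : {for t, continuous (fun t' => jac a (chart a (gamma t')) k i)}.
  rewrite (_ : (fun t' => _) = (fun N : 'rV[R]_2 => N 0 i) \o (pd k (g a) \o (chart a \o gamma))); last first.
    by apply/funext => t' /=; rewrite mxE.
  apply: continuous_comp; last exact: coord_continuous.
  apply: continuous_comp; first exact: lift_continuous.
  by have [_ /(_ (delta_mx 0 k))] := gC a; apply.
have [d0 _ _] := mulmx_inv2 v (jac_unit ax).
have cst_c (b : R) : {for t, continuous (fun _ : R => b)} by exact: cvg_cst.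
pose N t' := jac a (chart a (gamma t')).
have nc (b b' : R) k i k' i' :
    {for t, continuous (fun t' => b * N t' k i - b' * N t' k' i')}.
  exact: (continuousB (continuousM (cst_c b) (jc k i)) (continuousM (cst_c b') (jc k' i'))).
have dc : {for t, continuous (fun t' => N t' 0 0 * N t' 1 1 - N t' 0 1 * N t' 1 0)}.
  exact: (continuousB (continuousM (jc 0 0) (jc 1 1)) (continuousM (jc 0 1) (jc 1 0))).
have vc b b' k i k' i' : {for t, continuous (fun t' => (b * N t' k i - b' * N t' k' i') /
    (N t' 0 0 * N t' 1 1 - N t' 0 1 * N t' 1 0))}.
  have ic := @continuousV _ _ (fun t' => N t' 0 0 * N t' 1 1 - N t' 0 1 * N t' 1 0) t d0 dc.
  exact: (continuousM (nc b b' k i k' i') ic).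
apply: continuous_row => i.
pose f t' := if i == 0 then (v 0 0 * N t' 1 1 - v 0 1 * N t' 1 0) /
    (N t' 0 0 * N t' 1 1 - N t' 0 1 * N t' 1 0)
  else (v 0 1 * N t' 0 0 - v 0 0 * N t' 0 1) /
    (N t' 0 0 * N t' 1 1 - N t' 0 1 * N t' 1 0).
rewrite (_ : (fun t' => _) = f); last by apply/funext => t'; rewrite mxE.
by rewrite /f; case: (i == 0); exact: vc.
Qed.

Lemma lift_class_C (a : cindex S) : class_C 1 (`]0, 1[ `&` gamma @^-1` cdom a) (chart a \o gamma).
Proof.
have cd t : lift_dom a t -> differentiable (chart a \o gamma) t.
  by move=> /lift_derive[+ _] => /derivable1_diffP.
split=> // u t tD.
have E t' : lift_dom a t' -> u *: velocity a t' = 'D_u (chart a \o gamma) t'.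
  move=> t'D; have [_ H] := lift_derive t'D.
  rewrite deriveE; last exact: cd.
  rewrite -[u in RHS]mulr1 -[u * 1]/(u *: (1 : R)) linearZ -deriveE; last exact: cd.
  by rewrite H velocityE.
rewrite /prop_for /continuous_at -E //.
apply: cvg_trans (cvgZ (cvg_cst u) (velocity_continuous tD)).
apply: near_eq_cvg; apply: filterS (near_lift tD) => t' t'D.
by rewrite /= -E.
Qed.

(** In the slice the square of the velocity is |v|^2 minus the square of its third component: the
    projection does not decrease lengths, so lifts of segments have bounded speed. *)
Lemma lift_speed t : 0 < t < 1 ->
  form (derive1 (phi \o gamma) t) (derive1 (phi \o gamma) t) <= v 0 0 ^+ 2 + v 0 1 ^+ 2.
Proof.
move=> t01; have [a ta] := cdom_cover S (gamma t); have ax := chart_ccod ta.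
have tD : lift_dom a t by split=> //=; rewrite in_itv.
have phid : derivable (phi \o gamma) t 1.
  apply/derivable1_diffP; apply: (@near_eq_differentiable _ _ _ (F a \o (chart a \o gamma))).
    by apply: filterS (near_lift tD) => t' [_ ta']; rewrite /F /= chartK.
  apply: differentiable_comp; last by have [+ _] := FC a 1; exact.
  by have [+ _] := lift_class_C a; exact.
have dphi : is_derive t 1 (phi \o gamma) (derive1 (phi \o gamma) t).
  by rewrite derive1E; exact: derivableP.
rewrite -iA; have := is_derive_mulmx first2 (is_derive_mulmx A dphi).
have /(is_derive_coord 0 3%:R) := is_derive_mulmx A dphi.
set u := derive1 _ _ *m A => du3 du.
have u3 : u 0 3%:R = 0.
  have Fs : (fun y => ((phi \o gamma) y *m A) 0 3%:R) = cst s by apply/funext => z; exact: Phi3.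
  by rewrite Fs in du3; have [_ <-] := du3; exact: derive_cst.
have uv : u *m first2 = v.
  have [_ <-] := du.
  have H : is_derive t 1 (fun t' : R => t' *: v + y) v.
    have H1 := is_derive_scale (is_derive_id t (1 : R)) (is_derive_cst v t 1).
    have {}H1 := is_deriveD H1 (is_derive_cst y t 1).
    by apply: is_derive_eq H1 _; rewrite scale1r scaler0 !addr0.
  have [_ <-] := H; apply: near_eq_derive.
  by apply: filterS (near_lift tD) => t' [tI' _]; apply: psi_gamma; move: tI'; rewrite /= in_itv.
have [E0 E1] := first2E u; rewrite uv in E0 E1.
rewrite form4 u3 -E0 -E1 mulr0 subr0 -!expr2 lerBlDr lerDl.
exact: sqr_ge0.
Qed.

End Lift.

Variable p0 : M.
Hypothesis cS : complete_surface S phi.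

Theorem complete_bijective : set_bij [set: M] (natural_H2 s) (fun p => phi p *m A).
Proof.
have psi_bij : bijective psi.
  apply: (local_homeomorphism_bijective hM psi_local (p0 := p0)) => //.
  move=> gamma v gc psig; apply: (@cS gamma (v 0 0 ^+ 2 + v 0 1 ^+ 2) gc).
    by move=> a; exact: lift_class_C gc psig _.
  by move=> t; exact: lift_speed gc psig _.
have [inv psiK invK] := psi_bij.
have pos p : form (phi p *m A) (phi p *m A) = -1 /\ 0 < (phi p *m A) 0 2%:R.
  by have /(natural_H2P _ s1)[] := phiA p.
split=> [p _|p q _ _ pq|x xH] //; first by rewrite -[p]psiK -[q]psiK /psi pq.
have /(natural_H2P _ s1)[xx x3 x2] := xH.
exists (inv (x *m first2)) => //.
set p := inv _; have psip : psi p = x *m first2 by exact: invK.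
have [pp p2] := pos p; have p3 := Phi3 p.
have [E0 E1] := first2E x; have [E0' E1'] := first2E (phi p *m A).
rewrite -/(psi p) psip in E0' E1'.
rewrite E0 in E0'; rewrite E1 in E1'.
apply: row4; rewrite ?p3 //.
move: pp xx; rewrite !form4 p3 x3 -E0' -E1' => <- H.
(* The first two coordinates and x_4 = s determine the square of the third, which is positive on
   both sides. *)
have : (phi p *m A) 0 2%:R ^+ 2 = x 0 2%:R ^+ 2 by rewrite !expr2; lra.
by move/eqP; rewrite eqrXn2 // ?ltW // => /eqP.
Qed.

End Developing.

Theorem theorem2 (R : realType) (M : topologicalType) (S : atlas R M)
    (phi : M -> 'rV[R]_4) :
  hausdorff_space M -> @second_countable M -> connected [set: M] ->
  immersion_in_AdS S phi ->
  spacelike S phi ->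
  proper_biharmonic S phi ->
  exists A : 'M[R]_4,
    [/\ linear_isometry A,
        forall p, natural_H2 (Num.sqrt 2)^-1 (phi p *m A)
      & complete_surface S phi ->
        set_bij [set: M] (natural_H2 (Num.sqrt 2)^-1)
          (fun p => phi p *m A)].
Proof.
move=> hM _ cM imm sl pb.
have [A iA phiA] := biharmonic_normal_form cM imm sl pb.
exists A; split=> // cS.
have s1 : ((Num.sqrt 2)^-1 : R) ^+ 2 < 1 by rewrite sqr_invsqrt2 invf_lt1 ?ltr1n.
(* An empty surface would be harmonic. *)
have [p0 _] : [set: M] !=set0.
  apply/set0P/eqP => M0; have [_] := pb; apply=> a x ax.
  have : [set: M] (param a x) by [].
  by rewrite M0.
exact: (complete_bijective hM cM imm sl s1 iA phiA p0 cS).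
Qed.
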